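(* Let $d\ge 1$ be an integer and let $c_1,\dots,c_d$ be given (not necessarily distinct) points in the open unit disk $\mathbf{D}=\{z\in\mathbb{C}:|z|<1\}$. Then there exists a unique proper holomorphic map $f:\mathbf{D}\to\mathbf{D}$ of degree $d+1$, normalized by $f(0)=0$ and $f(1)=1$, with critical points at the $c_j$; that is, the critical points of $f$ in $\mathbf{D}$, counted with multiplicity, are exactly $c_1,\dots,c_d$.
   Context: Every proper holomorphic map $f:\mathbf{D}\to\mathbf{D}$ of degree $d+1$ is a finite Blaschke product $f(z)=\lambda\prod_{j=1}^{d+1}\frac{z-a_j}{1-\bar a_j z}$ with $|a_j|<1$, $|\lambda|=1$, so it extends holomorphically to a neighborhood of $\overline{\mathbf{D}}$; $f(1)$ denotes the value of this extension at $1$. Such an $f$ has exactly $d$ critical points in $\mathbf{D}$, counted with multiplicity (the multiplicity of a critical point is its order as a zero of $f'$). Whenever some point is repeated exactly $m$ times among the $c_j$, the map $f$ is required to have local degree $m+1$ at that point. *)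

(* Defs.v *)
From HB Require Import structures.
From mathcomp Require Import all_boot all_order all_algebra.
From mathcomp Require Import complex.
From mathcomp Require Import all_classical all_reals all_analysis.

Set Implicit Arguments.
Unset Strict Implicit.
Unset Printing Implicit Defensive.

Import Order.TTheory GRing.Theory Num.Theory.
Import numFieldNormedType.Exports.

Local Open Scope classical_set_scope.
Local Open Scope ring_scope.

(* [R[i]] packaged as a field, so that it gets the topology and normed-module
   structure over itself that every [numFieldType] carries: [derivable g z 1] is
   complex differentiability and [derive1 g] is the complex derivative. *)
Definition C (R : realType) : numClosedFieldType := R[i].

(* Maps defined on the disk are represented by total functions on [C R] whose
   values outside the disk are irrelevant. *)

Definition disk (R : realType) : set (C R) := [set z | `|z| < 1].
Definition closed_disk (R : realType) : set (C R) := [set z | `|z| <= 1].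

Definition holomorphic_on (R : realType) (U : set (C R)) (g : C R -> C R) :=
  forall z, U z -> derivable g z 1.

(* [m = 0] means that [g] does not vanish at [z]; a function vanishing
   identically near [z] has no order there. *)
Definition zero_order (R : realType) (g : C R -> C R) (z : C R) (m : nat) :=
  exists h : C R -> C R,
    [/\ \forall w \near z, derivable h w 1,
        h z != 0 &
        \forall w \near z, g w = (w - z) ^+ m * h w].

(* The zeros of [g] in the disk, listed with multiplicity, are [s]. *)
Definition disk_zeros (R : realType) (g : C R -> C R) (s : seq (C R)) :=
  (forall z, z \in s -> disk z) /\
  (forall z, disk z -> zero_order g z (count_mem z s)).

Definition proper_holomorphic_self_map (R : realType) (f : C R -> C R) :=
  [/\ holomorphic_on (@disk R) f,
      (forall z, disk z -> disk (f z)) &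
      forall K : set (C R), K `<=` @disk R -> compact K ->
        compact (@disk R `&` f @^-1` K)].

Definition has_degree (R : realType) (f : C R -> C R) (n : nat) :=
  forall w, disk w ->
    exists s : n.-tuple (C R), disk_zeros (fun z => f z - w) s.

Definition critical_points (R : realType) (f : C R -> C R) (s : seq (C R)) :=
  disk_zeros (derive1 f) s.

(* The holomorphic extension of [f] to a neighborhood of the closed disk takes
   the value [v] at [p]; for [p] in the closed disk this determines [v]. *)
Definition extension_value (R : realType) (f : C R -> C R) (p v : C R) :=
  exists (U : set (C R)) (F : C R -> C R),
    [/\ open U, @closed_disk R `<=` U, holomorphic_on U F,
        (forall z, disk z -> F z = f z) & F p = v].

Definition normalized_proper_map (R : realType) (d : nat) (c : d.-tuple (C R))
    (f : C R -> C R) :=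
  [/\ proper_holomorphic_self_map f, has_degree f d.+1, f 0 = 0,
      extension_value f 1 1 & critical_points f c].

(* Main.v *)
(* Write [star d g] for [z ^ d * conj (g (1 / conj z))]. A Blaschke product of degree [d + 1] fixing 0 is
   [f = p / q] with [p = 'X * g] and [q = star d g], where [g] has degree [d] and all its roots in the disk.
   Its critical points are the zeros in the disk of the Wronskian [W g = p' * q - p * q'], which is
   self-reciprocal of formal degree [2 d]. If [c] is the monic polynomial whose roots are the prescribed
   points, the condition on [f] becomes [W g = c * star d c] up to a positive factor, and [f 1 = 1] becomes
   reality of [g 1].

   Uniqueness. [N = |q|^2 - |p|^2] is positive in the disk and satisfies the Liouville equation
   [N * (d dbar N) - |d N|^2 = - |W g|^2]. If [W g = W k], the corresponding functions [N] agree to second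
   order along the unit circle, and the maximum principle for their quotient shows that they are equal;
   polarizing this identity gives [k = g] or [k = - g]. The same argument applied to the linearized
   equation shows that the derivative of [W] is injective, hence bijective by equality of dimensions.

   Existence. Move the right-hand side along the segment from [(d + 1) X^d = W X^d] to [c * star d c].
   The set of parameters for which the equation is solvable is open because the derivative of [W] is onto,
   and closed because on the unit circle [W g] dominates [|g|^2] and vanishes where a root of [g] lies.

   An abstract normalized map [f] is of this form: divide it by the Blaschke product with the same zeros to
   get a nonvanishing [u] with [|u| -> 1] at the boundary. The order condition on the zeros of [f'] makes
   [f'] complex differentiable, so [f] has second-order expansions; at a point with such an expansion
   [|u|^2 + e |z|^2] has no local maximum, whence [|u| = 1] and [u] is constant, without Cauchy theory. *)

From HB Require Import structures.
Require Import Defs.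
From mathcomp Require Import all_boot all_order all_algebra.
From mathcomp Require Import complex.
From mathcomp Require Import all_classical all_reals all_analysis.
From mathcomp Require Import ring lra zify.
Set Implicit Arguments.
Unset Strict Implicit.
Unset Printing Implicit Defensive.
Import Order.TTheory GRing.Theory Num.Theory.
Import numFieldNormedType.Exports.
Local Open Scope classical_set_scope.
Local Open Scope ring_scope.

(** * Complex numbers over a real type *)

Section ComplexNumbers.
Variable R : realType.
Local Notation K := (C R).
Implicit Types (x y r : R) (z w : K).

(** For [f = p / q], the quantity |W g| / N equals |f'| / (1 - |f|^2), the density of the
    pulled-back hyperbolic metric, and the Liouville equation says that this metric has constant
    curvature. On the circle [N] vanishes and its inward normal derivative is 2 conj(w^d) W g(w), so
    equal Wronskians make the ratio of the two functions [N] tend to 1 there. Equality of the forms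
    |q|^2 - |p|^2 determines (p, q) up to a pseudo-unitary change; vanishing of [p] at 0 leaves only
    a phase, and reality of [g 1] only a sign. The dimension count is exact: [g] has 2 d + 2 real
    coordinates, self-reciprocal polynomials of formal degree 2 d form a real space of dimension 2 d
    + 1, and the remaining equation normalizes the phase, since rotating [g] does not change [W g].
    Openness is obtained by minimizing a sum of squares over a small ball: a Newton step contradicts
    a positive interior minimum. Uniqueness also enters here, since it keeps other solutions off the
    bounding sphere. *)

Definition re z : R := complex.Re z.
Definition im z : R := complex.Im z.
Definition rc x : K := real_complex R x.
Definition cabs z : R := Normc.normc z.

HB.instance Definition _ := GRing.RMorphism.copy rc (real_complex R).

Lemma re_is_zmod_morphism : zmod_morphism re.
Proof. by move=> [a b] [c e]. Qed.
HB.instance Definition _ := GRing.isZmodMorphism.Build K R re re_is_zmod_morphism.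

Lemma im_is_zmod_morphism : zmod_morphism im.
Proof. by move=> [a b] [c e]. Qed.
HB.instance Definition _ := GRing.isZmodMorphism.Build K R im im_is_zmod_morphism.

Lemma normE z : `|z| = rc (cabs z). Proof. by []. Qed.

Lemma rcI : injective rc. Proof. by move=> x y []. Qed.
Lemma rc_eq0 x : (rc x == 0) = (x == 0).
Proof. by rewrite -(inj_eq rcI) rmorph0. Qed.
Lemma re_rc x : re (rc x) = x. Proof. by []. Qed.
Lemma im_rc x : im (rc x) = 0. Proof. by []. Qed.
Lemma re1 : re 1 = 1. Proof. by []. Qed.
Lemma im1 : im 1 = 0. Proof. by []. Qed.
Lemma lec_rc x y : (rc x <= rc y) = (x <= y). Proof. exact: lecR. Qed.
Lemma ltc_rc x y : (rc x < rc y) = (x < y). Proof. exact: ltcR. Qed.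
Lemma conj_rc x : (rc x)^* = rc x.
Proof. by apply/CrealP; rewrite realE -[0](rmorph0 rc) !lec_rc -realE num_real. Qed.

Lemma reM z w : re (z * w) = re z * re w - im z * im w.
Proof. by case: z w => [a b] [c e]. Qed.
Lemma imM z w : im (z * w) = re z * im w + im z * re w.
Proof. by case: z w => [a b] [c e]; rewrite /im/re/= . Qed.

Lemma reD z w : re (z + w) = re z + re w. Proof. exact: raddfD. Qed.
Lemma reN z : re (- z) = - re z. Proof. exact: raddfN. Qed.
Lemma imD z w : im (z + w) = im z + im w. Proof. exact: raddfD. Qed.
Lemma imN z : im (- z) = - im z. Proof. exact: raddfN. Qed.

Lemma complex_ext z w : re z = re w -> im z = im w -> z = w.
Proof. by case: z w => [a b] [c e] /= -> ->. Qed.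

Lemma conjD z w : (z + w)^* = z^* + w^*. Proof. exact: rmorphD. Qed.
Lemma conjN z : (- z)^* = - z^*. Proof. exact: rmorphN. Qed.
Lemma conjB z w : (z - w)^* = z^* - w^*. Proof. exact: rmorphB. Qed.
Lemma conjM z w : (z * w)^* = z^* * w^*. Proof. exact: rmorphM. Qed.
Lemma conjV z : (z^-1)^* = (z^*)^-1. Proof. exact: fmorphV. Qed.
Lemma conjX z n : (z ^+ n)^* = z^* ^+ n. Proof. exact: rmorphXn. Qed.
Lemma conjMn z n : (z *+ n)^* = z^* *+ n. Proof. exact: rmorphMn. Qed.
Lemma conj1 : (1 : K)^* = 1. Proof. exact: rmorph1. Qed.
Lemma conj0 : (0 : K)^* = 0. Proof. exact: rmorph0. Qed.
Lemma conj_nat n : (n%:R : K)^* = n%:R. Proof. exact: rmorph_nat. Qed.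
Lemma conj_sum (I : Type) (s : seq I) (P : pred I) (F : I -> K) :
  (\sum_(i <- s | P i) F i)^* = \sum_(i <- s | P i) (F i)^*.
Proof. exact: rmorph_sum. Qed.
Definition conj_morph := (conjD, conjN, conjM, conjX, conjMn, conj1, conj0, conj_nat).

Definition ci : K := (0 +i* 1)%C.
Lemma re_ci : re ci = 0. Proof. by []. Qed.
Lemma im_ci : im ci = 1. Proof. by []. Qed.

Lemma complexE z : z = rc (re z) + ci * rc (im z).
Proof. by apply: complex_ext; rewrite raddfD /= ?reM ?imM /re /im /=; ring. Qed.

Lemma conjE z : z^* = (re z -i* im z)%C.
Proof.
have [->|z0] := eqVneq z 0; first by rewrite conjC0; apply: complex_ext; rewrite /= ?oppr0.
apply: (mulfI z0); rewrite -normCK.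
by rewrite -[LHS]add_Re2_Im2; apply: complex_ext; case: z {z0} => [a b];
  rewrite ?reM ?imM /re/im/=; ring.
Qed.
Lemma re_conj z : re z^* = re z. Proof. by rewrite conjE. Qed.
Lemma im_conj z : im z^* = - im z. Proof. by rewrite conjE. Qed.
Definition reimE := (reD, reN, imD, imN, reM, imM, re_conj, im_conj).
Lemma ciJ : ci^* = - ci.
Proof. by apply: complex_ext; rewrite ?re_conj ?im_conj raddfN /= ?oppr0. Qed.
Lemma sqr_ci : ci * ci = -1.
Proof. by apply: complex_ext; rewrite ?reM ?imM raddfN /= /re /im /=; ring. Qed.

Lemma addcJ z : z + z^* = rc (2 * re z).
Proof. by apply: complex_ext; rewrite raddfD /= ?re_conj ?im_conj ?re_rc ?im_rc; lra. Qed.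

Lemma mulcJ z : z * z^* = rc (cabs z ^+ 2).
Proof. by rewrite -normCK normE -rmorphXn. Qed.

Lemma cabs_ge0 z : 0 <= cabs z.
Proof. by rewrite -lec_rc -normE rmorph0. Qed.
Lemma cabs0 : cabs 0 = 0. Proof. by apply: rcI; rewrite -normE normr0 rmorph0. Qed.
Lemma cabs1 : cabs 1 = 1. Proof. by apply: rcI; rewrite -normE normr1 rmorph1. Qed.
Lemma cabs_eq0 z : (cabs z == 0) = (z == 0).
Proof. by rewrite -rc_eq0 -normE normr_eq0. Qed.
Lemma cabs_gt0 z : (0 < cabs z) = (z != 0).
Proof. by rewrite lt_def cabs_ge0 andbT cabs_eq0. Qed.
Lemma cabsM z w : cabs (z * w) = cabs z * cabs w.
Proof. by apply: rcI; rewrite rmorphM /= -!normE normrM. Qed.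
Lemma cabsX z n : cabs (z ^+ n) = cabs z ^+ n.
Proof. by apply: rcI; rewrite rmorphXn /= -!normE normrX. Qed.
Lemma cabsV z : cabs z^-1 = (cabs z)^-1.
Proof. by apply: rcI; rewrite fmorphV /= -!normE normfV. Qed.
Lemma cabsN z : cabs (- z) = cabs z.
Proof. by apply: rcI; rewrite -!normE normrN. Qed.
Lemma cabsB z w : cabs (z - w) = cabs (w - z).
Proof. by rewrite -cabsN opprB. Qed.
Lemma cabsJ z : cabs z^* = cabs z.
Proof. by apply: rcI; rewrite -!normE norm_conjC. Qed.
Lemma cabs_rc x : cabs (rc x) = `|x|.
Proof. by rewrite /cabs /= expr0n /= addr0 sqrtr_sqr. Qed.
Lemma cabs_ci : cabs ci = 1.
Proof. by rewrite /cabs /= expr0n /= add0r expr1n sqrtr1. Qed.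
Lemma cabsD z w : cabs (z + w) <= cabs z + cabs w.
Proof. by rewrite -lec_rc rmorphD /= -!normE ler_normD. Qed.
Lemma cabs_triB z w : cabs (z - w) <= cabs z + cabs w.
Proof. by rewrite -(cabsN w) cabsD. Qed.
Lemma cabs_dist z w : cabs z - cabs w <= cabs (z - w).
Proof. by rewrite lerBlDr -{1}(subrK w z) cabsD. Qed.
Lemma sqr_cabs z : cabs z ^+ 2 = re z ^+ 2 + im z ^+ 2.
Proof. by apply: rcI; rewrite -mulcJ; apply: complex_ext; rewrite ?reM ?imM ?re_conj ?im_conj ?re_rc ?im_rc; ring. Qed.
Lemma ler_re z : `|re z| <= cabs z.
Proof. by rewrite -ler_sqr ?nnegrE ?cabs_ge0// sqr_cabs real_normK ?num_real// lerDl sqr_ge0. Qed.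
Lemma ler_im z : `|im z| <= cabs z.
Proof. by rewrite -ler_sqr ?nnegrE ?cabs_ge0// sqr_cabs real_normK ?num_real// lerDr sqr_ge0. Qed.
Lemma re_le_cabs z : re z <= cabs z.
Proof. exact: le_trans (ler_norm _) (ler_re z). Qed.
Lemma cabs_sum (I : Type) (s : seq I) (P : pred I) (F : I -> K) :
  cabs (\sum_(i <- s | P i) F i) <= \sum_(i <- s | P i) cabs (F i).
Proof.
elim/big_ind2: _ => [|a b c e ab ce|//]; first by rewrite cabs0.
by rewrite (le_trans (cabsD _ _)) ?lerD.
Qed.

Lemma reMrc x z : re (rc x * z) = x * re z.
Proof. by rewrite reM im_rc re_rc mul0r subr0. Qed.
Lemma imMrc x z : im (rc x * z) = x * im z.
Proof. by rewrite imM im_rc re_rc mul0r addr0. Qed.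
Lemma re_mulcJ z : re (z * z^*) = cabs z ^+ 2.
Proof. by rewrite mulcJ re_rc. Qed.

Lemma diskE z : disk z = (cabs z < 1).
Proof. by rewrite /disk /= normE -[1](rmorph1 rc) ltc_rc. Qed.
Lemma closed_diskE z : closed_disk z = (cabs z <= 1).
Proof. by rewrite /closed_disk /= normE -[1](rmorph1 rc) lec_rc. Qed.

Lemma near_cabs z (P : K -> Prop) :
  (\forall w \near z, P w) <->
  exists2 r : R, 0 < r & forall w, cabs (w - z) < r -> P w.
Proof.
split=> [/nbhs_ballP[e e0 eP]|[r r0 rP]].
  have e_real : e \is Num.real by rewrite realE (ltW e0).
  have eE : e = rc (complex.Re e) by rewrite /rc RRe_real.
  exists (complex.Re e); first by rewrite -ltc_rc -eE rmorph0.
  by move=> w wz; apply: eP; rewrite -ball_normE /= distrC eE normE ltc_rc.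
apply/nbhs_ballP; exists (rc r); first by rewrite /= -[0](rmorph0 rc) ltc_rc.
by move=> w; rewrite -ball_normE /= distrC normE ltc_rc => /rP.
Qed.

End ComplexNumbers.

Arguments re {R} z : simpl never.
Arguments im {R} z : simpl never.
Arguments rc {R} x : simpl never.
Arguments cabs {R} z : simpl never.
Arguments ci {R} : simpl never.

(** * Derivatives as linear approximations *)

Section DerivativeCriterion.
Variable F : numFieldType.

Lemma is_deriveP (f : F -> F) (z l : F) :
  is_derive z 1 f l <->
  forall e : F, 0 < e ->
    \forall h \near (0 : F), `|f (z + h) - f z - l * h| <= e * `|h|.
Proof.
pose q (h : F) : F := h^-1 *: ((f \o shift z) (h *: 1) - f z).
have key h (e : F) : h != 0 ->
    (`|l - q h| <= e) = (`|f (z + h) - f z - l * h| <= e * `|h|).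
  move=> h0; rewrite /q /= -[h *: 1]/(h * 1) mulr1 (addrC h) -ler_pdivrMr ?normr_gt0//.
  rewrite -normf_div distrC; congr (`|_| <= _).
  by rewrite -[_ *: _]/(h^-1 * _); field.
split=> [[df dl] e e0|H].
  have /cvgrPdist_le/(_ e e0) : q @ 0^' --> l by rewrite -dl; exact: df.
  rewrite near_withinE; apply: filterS => h; have [->|h0] := eqVneq h 0.
    by move=> _; rewrite addr0 mulr0 !subrr normr0 mulr0.
  by rewrite -key//; apply.
have ql : q @ 0^' --> l.
  apply/cvgrPdist_le => e e0; rewrite near_withinE.
  by apply: filterS (H e e0) => h + h0; rewrite key.
by split; [apply/cvg_ex; exists l|exact: cvg_lim].
Qed.

Lemma is_derive1P (f : F -> F) (z : F) : derivable f z 1 -> is_derive z 1 f (derive1 f z).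
Proof. by move=> df; split=> //; rewrite derive1E. Qed.

Lemma is_derive1E (f : F -> F) (z l : F) : is_derive z 1 f l -> derive1 f z = l.
Proof. by move=> [_ <-]; rewrite derive1E. Qed.

Lemma is_derive_horner (p : {poly F}) (z : F) : is_derive z (1 : F) (horner p) p^`().[z].
Proof.
elim/poly_ind: p => [|p c ih].
  have -> : horner (0 : {poly F}) = cst 0 by apply/funext => y; rewrite /= horner0.
  by rewrite deriv0 horner0; exact: is_derive_cst.
have -> : horner (p * 'X + c%:P) = (horner p * id + cst c)%R.
  by apply/funext => y; rewrite !fctE !hornerE.
apply: is_derive_eq.
rewrite derivD derivM derivX derivC addr0 mulr1 !hornerE.
by rewrite -![_ *: _]/(_ * _); ring.
Qed.

Lemma derivable_continuous (f : F -> F) (z : F) : derivable f z 1 -> {for z, continuous f}.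
Proof. by move=> /derivable1_diffP/differentiable_continuous. Qed.

Lemma continuous_horner_num (p : {poly F}) : continuous (horner p).
Proof. by move=> z; apply: derivable_continuous; case: (is_derive_horner p z). Qed.

End DerivativeCriterion.

(** * Continuity, compactness and extrema in terms of the real-valued modulus *)

Section ComplexTopology.
Variable R : realType.
Local Notation K := (C R).

Lemma near0_cabs (P : K -> Prop) :
  (\forall h \near (0 : K), P h) <->
  exists2 r : R, 0 < r & forall h, cabs h < r -> P h.
Proof.
split=> [/near_cabs[r r0 rP]|[r r0 rP]]; last apply/near_cabs;
  by exists r => // h; have := rP h; rewrite ?subr0.
Qed.

Lemma is_derive_cabsP (f : K -> K) (z l : K) :
  is_derive z 1 f l <->
  forall e : R, 0 < e -> exists2 r : R, 0 < r &
    forall h, cabs h < r -> cabs (f (z + h) - f z - l * h) <= e * cabs h.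
Proof.
split=> [/is_deriveP H e e0|H].
  have : 0 < rc e by rewrite -[0](rmorph0 (@rc R)) ltc_rc.
  move=> /H/near0_cabs[r r0 rP]; exists r => // h /rP.
  by rewrite !normE -rmorphM lec_rc.
apply/is_deriveP => e e0.
have eE : e = rc (complex.Re e) by rewrite /rc RRe_real// realE (ltW e0).
have re0 : 0 < complex.Re e by rewrite -ltc_rc -eE rmorph0.
have [r r0 rP] := H _ re0.
by apply/near0_cabs; exists r => // h /rP; rewrite {2}eE !normE -rmorphM lec_rc.
Qed.

Lemma cvg_cabsP (T : Type) (F : set_system T) {FF : Filter F} (f : T -> K) (l : K) :
  (f @ F --> l) <-> forall e : R, 0 < e -> \forall t \near F, cabs (f t - l) < e.
Proof.
split=> [/cvgrPdistC_lt H e e0|H].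
  have : 0 < rc e by rewrite -[0](rmorph0 (@rc R)) ltc_rc.
  by move=> /H; apply: filterS => t; rewrite normE ltc_rc.
apply/cvgrPdistC_lt => e e0.
have eE : e = rc (complex.Re e) by rewrite /rc RRe_real// realE (ltW e0).
have re0 : 0 < complex.Re e by rewrite -ltc_rc -eE rmorph0.
by apply: filterS (H _ re0) => t; rewrite normE {2}eE ltc_rc.
Qed.

Lemma continuous_cabsP (f : K -> K) (z : K) :
  {for z, continuous f} <-> forall e : R, 0 < e -> exists2 r : R, 0 < r &
    forall w, cabs (w - z) < r -> cabs (f w - f z) < e.
Proof.
split=> [H e e0|H].
  by have /(_ e e0)/near_cabs := (@cvg_cabsP _ _ (nbhs_filter z) f (f z)).1 H.
by apply/(@cvg_cabsP _ _ (nbhs_filter z)) => e e0; apply/near_cabs; exact: H.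
Qed.

Lemma cvg_lipschitz (T : topologicalType) (V : normedModType R) (f : T -> V) (g : T -> K) (z : T) :
  (forall t, `|f t - f z| <= cabs (g t - g z)) ->
  {for z, continuous g} -> {for z, continuous f}.
Proof.
move=> fg /(@cvg_cabsP _ _ (nbhs_filter z)) gz; apply/cvgrPdistC_lt => e e0.
by apply: filterS (gz e e0) => t; apply: le_lt_trans.
Qed.

Lemma continuous_re (T : topologicalType) (g : T -> K) z :
  {for z, continuous g} -> {for z, continuous (fun t => re (g t))}.
Proof. by apply: cvg_lipschitz => t; rewrite -raddfB ler_re. Qed.

Lemma continuous_im (T : topologicalType) (g : T -> K) z :
  {for z, continuous g} -> {for z, continuous (fun t => im (g t))}.
Proof. by apply: cvg_lipschitz => t; rewrite -raddfB ler_im. Qed.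

Lemma continuous_cabs (T : topologicalType) (g : T -> K) z :
  {for z, continuous g} -> {for z, continuous (fun t => cabs (g t))}.
Proof.
apply: cvg_lipschitz => t; rewrite ler_norml cabs_dist andbT.
by rewrite -lerN2 opprK opprB (le_trans (cabs_dist _ _))// cabsB.
Qed.

Lemma continuous_sq_cabs (T : topologicalType) (g : T -> K) z :
  {for z, continuous g} -> {for z, continuous (fun t => cabs (g t) ^+ 2)}.
Proof. by move=> /continuous_cabs gz; exact: (continuousM gz gz). Qed.

Lemma continuous_add_normsq (F : K -> R) (e : R) (z : K) : {for z, continuous F} ->
  {for z, continuous (fun w : K => F w + e * cabs w ^+ 2)}.
Proof.
move=> Fz; have c1 := @continuous_sq_cabs K id z cvg_id.
have c2 : {for z, continuous (fun=> e)} := @cst_continuous K R e z.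
have c3 := continuousM c2 c1.
exact: (continuousD Fz c3).
Qed.

Lemma continuous_conj (T : topologicalType) (g : T -> K) z :
  {for z, continuous g} -> {for z, continuous (fun t => (g t)^*)}.
Proof.
move=> /(@cvg_cabsP _ _ (nbhs_filter z)) gz; apply/(@cvg_cabsP _ _ (nbhs_filter z)) => e e0.
by apply: filterS (gz e e0) => t; rewrite -rmorphB cabsJ.
Qed.

Lemma continuous_rc : continuous (@rc R).
Proof.
move=> x; apply/(@cvg_cabsP _ _ (nbhs_filter x)) => e e0.
have /(_ e e0) := (@cvgrPdistC_lt _ _ _ _ (nbhs_filter x) id x).1 (@cvg_id _ (nbhs x)).
by apply: filterS => y; rewrite -rmorphB cabs_rc.
Qed.

Lemma compact_cabs_le (r : R) : compact [set z : K | cabs z <= r].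
Proof.
pose I : set R := `[- r, r]%classic.
pose g (p : R * R) : K := rc p.1 + ci * rc p.2.
have gc : continuous g.
  move=> p; apply: cvgD.
    by apply: (@continuous_comp _ _ _ fst (@rc R)); [exact: cvg_fst|exact: continuous_rc].
  apply: cvgM; first exact: cvg_cst.
  by apply: (@continuous_comp _ _ _ snd (@rc R)); [exact: cvg_snd|exact: continuous_rc].
have cI : compact (g @` (I `*` I)).
  apply: continuous_compact; first exact: continuous_subspaceT.
  by apply: compact_setX; exact: segment_compact.
apply: (subclosed_compact _ cI).
  have -> : [set z : K | cabs z <= r] = (@cabs R) @^-1` [set x | x <= r] by [].
  apply: preimage_closed; last exact: closed_le.
  move=> z _; exact: (@continuous_cabs K id).
move=> z /= zr; exists (re z, im z); last by rewrite /g /= -complexE.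
by rewrite /I /=; split; rewrite in_itv /= -ler_norml; apply: le_trans zr;
  [exact: ler_re|exact: ler_im].
Qed.

Lemma cabs_le_max (r : R) (f : K -> R) : 0 <= r ->
  (forall z, cabs z <= r -> {for z, continuous f}) ->
  exists2 z, cabs z <= r & forall w, cabs w <= r -> f w <= f z.
Proof.
move=> r0 fc.
have [|||z zr zm] := @compact_EVT_max K R f [set z : K | cabs z <= r].
- by exists (0 : K); change (cabs (0 : K) <= r); rewrite cabs0.
- exact: compact_cabs_le.
- apply/continuous_in_subspaceT => z; rewrite inE /=; exact: fc.
exists z; first by rewrite inE in zr.
by move=> w wr; apply: zm; rewrite inE.
Qed.

Lemma horner_bounded (p : {poly K}) (r : R) :
  exists2 M : R, 0 < M & forall z, cabs z <= r -> cabs p.[z] <= M.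
Proof.
have [r0|r0] := leP 0 r; last first.
  by exists 1 => // z; rewrite leNgt (lt_le_trans r0 (cabs_ge0 z)).
have [|z zr zm] := @cabs_le_max r (fun z => cabs p.[z]) r0.
  by move=> z _; apply: continuous_cabs; exact: continuous_horner_num.
exists (cabs p.[z] + 1); first by rewrite ltr_wpDl ?cabs_ge0.
by move=> w /zm wz; rewrite (le_trans wz)// lerDl.
Qed.

End ComplexTopology.

(** * Reciprocal polynomials and Wronskians *)

Section ReciprocalPolynomials.
Variable R : realType.
Local Notation K := (C R).
Implicit Types (p q g h : {poly K}) (z w : K).

(** The points e / (i + 2) are distinct, lie strictly between 0 and [e], and are as many as the size
    of [p]. *)
Lemma poly0_small_real p (e : R) : 0 < e ->
  (forall s : R, 0 < s < e -> p.[rc s] = 0) -> p = 0.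
Proof.
move=> e0 pe; pose rs := [seq rc (e / (i%:R + 2)) | i <- iota 0 (size p)].
apply: (@roots_geq_poly_eq0 _ p rs); last by rewrite size_map size_iota.
  apply/allP => _ /mapP[i _ ->]; apply/eqP/pe.
  have i2 : 0 < i%:R + 2 :> R by rewrite ltr_wpDl.
  rewrite divr_gt0//= ltr_pdivrMr// ltr_pMr// ltr_wpDl//; lra.
rewrite map_inj_uniq ?iota_uniq// => i j /rcI /(mulfI (lt0r_neq0 e0)) /invr_inj/addIr/eqP.
by rewrite eqr_nat => /eqP.
Qed.

(** Excluding 0 matches [horner_star], which involves 1 / conj z; identities between reciprocal
    polynomials can then be checked pointwise. *)
Lemma poly_ext_nz p q : (forall z, z != 0 -> p.[z] = q.[z]) -> p = q.
Proof.
move=> pq; apply/eqP; rewrite -subr_eq0; apply/eqP.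
apply: (@poly0_small_real _ 1) => // s /andP[s0 _].
by rewrite hornerD hornerN pq ?subrr// rc_eq0 gt_eqF.
Qed.

(* [z ^ n * conj (p (1 / conj z))] *)
Definition star (n : nat) p : {poly K} := \poly_(i < n.+1) (p`_(n - i))^*.

Lemma coef_star n p i : (star n p)`_i = if (i <= n)%N then (p`_(n - i))^* else 0.
Proof. by rewrite coef_poly ltnS. Qed.

Lemma size_star n p : (size (star n p) <= n.+1)%N.
Proof. exact: size_poly. Qed.

Lemma starD n p q : star n (p + q) = star n p + star n q.
Proof.
apply/polyP => i; rewrite coefD !coef_star coefD.
by case: ifP; rewrite ?addr0// conjD.
Qed.

Lemma starZ n a p : star n (a *: p) = a^* *: star n p.
Proof.
apply/polyP => i; rewrite coefZ !coef_star coefZ.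
by case: ifP; rewrite ?mulr0// conjM.
Qed.

Lemma starN n p : star n (- p) = - star n p.
Proof. by rewrite -scaleN1r starZ conjN conj1 scaleN1r. Qed.

Lemma starB n p q : star n (p - q) = star n p - star n q.
Proof. by rewrite starD starN. Qed.

Lemma starK n p : (size p <= n.+1)%N -> star n (star n p) = p.
Proof.
move=> sp; apply/polyP => i; rewrite coef_star; case: leqP => [ile|iln].
  by rewrite coef_star leq_subr subKn// conjCK.
by rewrite nth_default// (leq_trans sp).
Qed.

Lemma horner_star n p z : (size p <= n.+1)%N -> z != 0 ->
  (star n p).[z] = z ^+ n * (p.[(z^*)^-1])^*.
Proof.
move=> sp z0; rewrite horner_poly (horner_coef_wide _ sp) conj_sum mulr_sumr.
rewrite (reindex_inj rev_ord_inj) /=; apply: eq_bigr => i _.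
have ile : (i <= n)%N by rewrite -ltnS.
rewrite subSS subKn//  conjM conjX conjV conjCK mulrCA; congr (_ * _).
have -> : z ^+ n = z ^+ (n - i) * z ^+ i by rewrite -exprD subnK.
by rewrite exprVn mulfK// expf_neq0.
Qed.

Lemma inv_conj_circle z : cabs z = 1 -> (z^*)^-1 = z.
Proof.
move=> z1; have := mulcJ z; rewrite z1 expr1n rmorph1 => zz.
have z0 : z^* != 0 by apply: contraTneq isT => z0; move: zz; rewrite z0 mulr0 => /esym/eqP; rewrite oner_eq0.
by apply: (mulIf z0); rewrite mulVf.
Qed.

Lemma circle_neq0 z : cabs z = 1 -> z != 0.
Proof. by move=> z1; rewrite -cabs_eq0 z1 oner_neq0. Qed.

Lemma horner_star_circle n p z : (size p <= n.+1)%N -> cabs z = 1 ->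
  (star n p).[z] = z ^+ n * (p.[z])^*.
Proof. by move=> sp z1; rewrite horner_star ?circle_neq0// inv_conj_circle. Qed.

Lemma starM m n p q : (size p <= m.+1)%N -> (size q <= n.+1)%N ->
  star (m + n) (p * q) = star m p * star n q.
Proof.
move=> sp sq; apply: poly_ext_nz => z z0.
have spq : (size (p * q)%R <= (m + n).+1)%N.
  rewrite (leq_trans (size_polyMleq _ _))// -subn1 leq_subLR add1n.
  by rewrite (leq_trans (leq_add sp sq))// addSn addnS.
by rewrite hornerM !horner_star// hornerM conjM exprD; ring.
Qed.

Lemma star0 n p : (star n p).[0] = (p`_n)^*.
Proof. by rewrite horner_coef0 coef_star subn0. Qed.

Lemma coefX_deriv p i : ('X * p^`())`_i = i%:R * p`_i.
Proof. by rewrite coefXM; case: i => [|i]; rewrite ?mul0r// coef_deriv mulr_natl. Qed.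

(** The Euler operator X d/dX multiplies the coefficient of index i by i, and [star n] sends index i
    to n - i. Keeping the factor X preserves the formal degree. *)
Lemma deriv_star n p : 'X * (star n p)^`() = n%:R *: star n p - star n ('X * p^`()).
Proof.
apply/polyP => i; rewrite coefX_deriv coefB coefZ !coef_star coefX_deriv.
case: leqP => [iln|_]; last by rewrite !mulr0 subr0.
by rewrite conjM conj_nat -mulrBl natrB// opprB addrC subrK.
Qed.

Lemma size_Xderiv n p : (size p <= n.+1)%N -> (size ('X * p^`())%R <= n.+1)%N.
Proof.
move=> sp; rewrite (leq_trans (size_polyMleq _ _))// size_polyX /=.
have [->|p0] := eqVneq p 0; first by rewrite deriv0 size_poly0.
by rewrite (leq_trans _ sp)// lt_size_deriv.
Qed.

Lemma horner_deriv_star_circle n p z : (size p <= n.+1)%N -> cabs z = 1 ->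
  z * (star n p)^`().[z] = z ^+ n * (n%:R * p.[z] - z * p^`().[z])^*.
Proof.
move=> sp z1; rewrite -[LHS]/(z * _) -[X in X * _]hornerX -hornerM deriv_star//.
rewrite hornerD hornerN hornerZ !horner_star_circle ?size_Xderiv// hornerM hornerX.
by rewrite !conj_morph; ring.
Qed.

Definition blaschke_wronskian (d : nat) g : {poly K} :=
  ('X * g)^`() * star d g - 'X * g * (star d g)^`().

(** The polarization of the quadratic map [W], so that [B d g] is the derivative of [W] at [g]. It
    is bilinear over the reals only, because [star] is conjugate-linear. *)
Definition wronskian_polar (d : nat) g h : {poly K} :=
  ('X * g)^`() * star d h + ('X * h)^`() * star d g
  - 'X * g * (star d h)^`() - 'X * h * (star d g)^`().

Local Notation W := blaschke_wronskian.
Local Notation B := wronskian_polar.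

Lemma wronskian_polarC d g h : B d g h = B d h g.
Proof. by rewrite /B; ring. Qed.

Lemma wronskianD d g h : W d (g + h) = W d g + B d g h + W d h.
Proof. by rewrite /W /B starD (mulrDr 'X g h) !derivD; ring. Qed.

Lemma wronskian_polarDr d g h k : B d g (h + k) = B d g h + B d g k.
Proof. by rewrite /B starD (mulrDr 'X h k) !derivD; ring. Qed.

Lemma wronskian_polarZr d g (s : R) h : B d g (rc s *: h) = rc s *: B d g h.
Proof.
by rewrite /B starZ conj_rc -(scalerAr (rc s) 'X h) !derivZ -!mul_polyC; ring.
Qed.

Lemma wronskian_polarNr d g h : B d g (- h) = - B d g h.
Proof. by rewrite /B starN (mulrN 'X h) !derivN; ring. Qed.

(** A difference of squares: it turns the nonlinear equation W h = W g into the vanishing of one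
    value of [B], to which the boundary estimates apply. *)
Lemma wronskian_polarBD d g h : B d (h + g) (h - g) = (W d h - W d g) *+ 2.
Proof. by rewrite /B /W starB starD (mulrDr 'X h g) (mulrBr 'X h g) !derivD !derivN mulr2n; ring. Qed.

Lemma wronskianZ d a g : W d (a *: g) = rc (cabs a ^+ 2) *: W d g.
Proof.
by rewrite /W starZ -(scalerAr a 'X g) !derivZ -mulcJ -!mul_polyC polyCM; ring.
Qed.

(** With [deriv_star], every term becomes a polynomial of formal degree d times the [star] of
    another one. Self-reciprocity and the values on the circle can be read off this form. *)
Lemma wronskian_polarE d g h : B d g h =
  g * star d h + 'X * g^`() * star d h + h * star d g + 'X * h^`() * star d g
  - d%:R *: (g * star d h) + g * star d ('X * h^`())
  - d%:R *: (h * star d g) + h * star d ('X * g^`()).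
Proof.
have E (k l : {poly K}) : 'X * k * (star d l)^`() = k * (d%:R *: star d l - star d ('X * l^`())).
  by rewrite -deriv_star; ring.
by rewrite /B !E !derivM derivX -!mul_polyC; ring.
Qed.

(** [star] exchanges a * star b and b * star a, and the terms of [wronskian_polarE] come in such
    pairs. *)
Lemma star_polar d g h : (size g <= d.+1)%N -> (size h <= d.+1)%N ->
  star (d + d) (B d g h) = B d g h.
Proof.
move=> sg sh; rewrite wronskian_polarE.
have sX k := @size_Xderiv d k.
have := sX g sg; have := sX h sh; move: ('X * g^`()) ('X * h^`()) => a b sb sa.
rewrite !(starD, starN, starZ, conj_nat).
rewrite !(@starM d d) ?size_star// !starK//.
by rewrite -!mul_polyC; ring.
Qed.

Lemma polar_self d g : B d g g = W d g *+ 2.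
Proof. by rewrite /B /W mulr2n; ring. Qed.

Lemma star_wronskian d g : (size g <= d.+1)%N -> star (d + d) (W d g) = W d g.
Proof.
move=> sg; have -> : W d g = 2^-1 *: B d g g.
  by rewrite polar_self -(@scaler_nat K _ 2 (W d g)) scalerA mulVf ?pnatr_eq0// scale1r.
by rewrite starZ star_polar// conjV conj_nat.
Qed.

(** After removal of z^d the value is real, being a sum of conjugate pairs; it will be the normal
    derivative of the Blaschke form. *)
Lemma horner_polar_circle d g h z : (size g <= d.+1)%N -> (size h <= d.+1)%N ->
  cabs z = 1 ->
  (B d g h).[z] = z ^+ d * rc (2 * re ((1 - d%:R) * (g.[z] * h.[z]^*)
    + z * g^`().[z] * h.[z]^* + z * h^`().[z] * g.[z]^*)).
Proof.
move=> sg sh z1; rewrite wronskian_polarE.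
rewrite !(hornerD, hornerN, hornerZ, hornerM, hornerX).
rewrite !horner_star_circle ?size_Xderiv// !hornerM !hornerX.
rewrite -addcJ !(conj_morph, conjCK).
by ring.
Qed.

End ReciprocalPolynomials.

(** * Second-order expansions and maximum principles *)

Section Jets.
Variable R : realType.
Local Notation K := (C R).
Implicit Types (f g u v : K -> K) (F G : K -> R) (z a b c : K).

Definition small2 u := forall e : R, 0 < e -> exists2 r : R, 0 < r &
  forall h, cabs h < r -> cabs (u h) <= e * cabs h ^+ 2.

Definition bounded0 u := exists M : R, exists2 r : R, 0 < r &
  forall h, cabs h < r -> cabs (u h) <= M.

Lemma small2D u v : small2 u -> small2 v -> small2 (fun h => u h + v h).
Proof.
move=> su sv e e0; have e2 : 0 < e / 2 by rewrite divr_gt0.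
have [r r0 ru] := su _ e2; have [s s0 sw] := sv _ e2.
exists (Num.min r s); first by rewrite lt_min r0.
move=> h; rewrite lt_min => /andP[/ru hu /sw hv].
by rewrite (le_trans (cabsD _ _))// (splitr e) mulrDl lerD.
Qed.

Lemma small2M u v : small2 u -> bounded0 v -> small2 (fun h => u h * v h).
Proof.
move=> su [M [s s0 sM]] e e0.
have M1 : 0 < `|M| + 1 by rewrite ltr_wpDl.
have [|r r0 ru] := su (e / (`|M| + 1)); first by rewrite divr_gt0.
exists (Num.min r s); first by rewrite lt_min r0.
move=> h; rewrite lt_min => /andP[/ru hu /sM hv].
rewrite cabsM (le_trans (ler_pM (cabs_ge0 _) (cabs_ge0 _) hu hv))//.
rewrite mulrAC ler_wpM2r ?sqr_ge0// mulrAC ler_pdivrMr// ler_pM2l//.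
by rewrite (le_trans (ler_norm _))// lerDl.
Qed.

Lemma small2J u : small2 u -> small2 (fun h => (u h)^*).
Proof.
move=> su e e0; have [r r0 ru] := su e e0.
by exists r => // h; rewrite cabsJ; apply: ru.
Qed.

Lemma small2_ext u v : (forall h, u h = v h) -> small2 u -> small2 v.
Proof.
by move=> uv su e e0; have [r r0 ru] := su e e0; exists r => // h; rewrite -uv; apply: ru.
Qed.

Lemma small2_le u v : (forall h, cabs (v h) <= cabs (u h)) -> small2 u -> small2 v.
Proof.
move=> uv su e e0; have [r r0 ru] := su e e0; exists r => // h hr.
by rewrite (le_trans (uv h)) ?ru.
Qed.

Lemma small2_cube a : small2 (fun h => a * h ^+ 3).
Proof.
move=> e e0; have a1 : 0 < cabs a + 1 by rewrite ltr_wpDl ?cabs_ge0.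
exists (e / (cabs a + 1)); first by rewrite divr_gt0.
move=> h; rewrite ltr_pdivlMr// => hr.
rewrite cabsM cabsX exprS mulrA ler_wpM2r ?sqr_ge0// (le_trans _ (ltW hr))//.
by rewrite mulrC ler_wpM2l ?cabs_ge0// lerDl.
Qed.

Lemma bounded0_poly a b c : bounded0 (fun h => a + b * h + c * h ^+ 2).
Proof.
exists (cabs a + cabs b + cabs c), 1 => // h /ltW h1.
rewrite (le_trans (cabsD _ _))// lerD//.
  rewrite (le_trans (cabsD _ _))// lerD// cabsM ler_piMr ?cabs_ge0//.
by rewrite cabsM cabsX ler_piMr ?cabs_ge0// exprn_ile1 ?cabs_ge0.
Qed.

Lemma bounded0J u : bounded0 u -> bounded0 (fun h => (u h)^*).
Proof.
move=> [M [r r0 ru]]; exists M, r => // h hr; by rewrite cabsJ ru.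
Qed.

Lemma bounded0D u v : bounded0 u -> bounded0 v -> bounded0 (fun h => u h + v h).
Proof.
move=> [M [r r0 ru]] [N [s s0 sv]]; exists (M + N), (Num.min r s); first by rewrite lt_min r0.
by move=> h; rewrite lt_min => /andP[/ru hu /sv hv]; rewrite (le_trans (cabsD _ _))// lerD.
Qed.

Lemma small2_bounded u : small2 u -> bounded0 u.
Proof.
move=> /(_ 1 ltr01)[r r0 ru]; exists 1, (Num.min r 1); first by rewrite lt_min r0/=.
move=> h; rewrite lt_min => /andP[/ru hu /ltW h1]; rewrite (le_trans hu)// mul1r.
by rewrite exprn_ile1 ?cabs_ge0.
Qed.

(* Peano form of the second-order complex Taylor expansion *)
Definition jet g z a b c := small2 (fun h => g (z + h) - (a + b * h + c * h ^+ 2)).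

Lemma jet_val g z a b c : jet g z a b c -> g z = a.
Proof.
move=> /(_ 1 ltr01)[r r0 /(_ 0)]; rewrite cabs0 => /(_ r0).
rewrite addr0 !expr0n /= !mulr0 !addr0 => h.
by apply/eqP; rewrite -subr_eq0 -cabs_eq0 eq_le h cabs_ge0.
Qed.

Lemma jet_bounded g z a b c : jet g z a b c -> bounded0 (fun h => g (z + h)).
Proof.
move=> /small2_bounded/bounded0D/(_ (bounded0_poly a b c)).
by move=> [M [r r0 H]]; exists M, r => // h /H; rewrite subrK.
Qed.

Lemma jetM f g z a b c a' b' c' : jet f z a b c -> jet g z a' b' c' ->
  jet (fun w => f w * g w) z (a * a') (a * b' + b * a') (a * c' + b * b' + c * a').
Proof.
move=> jf jg.
have s1 := small2M jf (jet_bounded jg).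
have s2 := small2M jg (bounded0_poly a b c).
have s3 := small2M (@small2_cube 1) (bounded0_poly (b * c' + c * b') (c * c') 0).
by apply: small2_ext (small2D (small2D s1 s2) s3) => h /=; ring.
Qed.

Lemma jet_ext f g z a b c : (exists2 r : R, 0 < r & forall w, cabs (w - z) < r -> f w = g w) ->
  jet f z a b c -> jet g z a b c.
Proof.
move=> [r r0 fg] jf e e0; have [s s0 sf] := jf e e0.
exists (Num.min r s); first by rewrite lt_min r0.
by move=> h; rewrite lt_min => /andP[hr /sf]; rewrite fg// addrAC subrr add0r.
Qed.

Lemma eq_jet f g z a b c : (forall w, f w = g w) -> jet f z a b c -> jet g z a b c.
Proof. by move=> fg; apply: jet_ext; exists 1. Qed.

Lemma jetX g z a b c n : jet g z a b c ->
  exists b' c', jet (fun w => g w ^+ n) z (a ^+ n) b' c'.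
Proof.
move=> jg; elim: n => [|n [b' [c' ih]]].
  by exists 0, 0 => e e0; exists 1 => // h _; rewrite !expr0 !mul0r !addr0 subrr cabs0 mulr_ge0 ?sqr_ge0// ltW.
have := jetM jg ih; rewrite -exprS => J; do 2 eexists.
by apply: eq_jet J => w; rewrite exprS.
Qed.

Lemma jet_cst (k : K) z : jet (fun=> k) z k 0 0.
Proof. by move=> e e0; exists 1 => // h _; rewrite !mul0r !addr0 subrr cabs0 mulr_ge0 ?sqr_ge0// ltW. Qed.

Lemma jetD f g z a b c a' b' c' : jet f z a b c -> jet g z a' b' c' ->
  jet (fun w => f w + g w) z (a + a') (b + b') (c + c').
Proof. by move=> jf jg; apply: small2_ext (small2D jf jg) => h /=; ring. Qed.

Lemma jet_horner (p : {poly K}) z : exists c, jet (horner p) z p.[z] p^`().[z] c.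
Proof.
elim/poly_ind: p => [|p k [c ih]].
  by exists 0; rewrite deriv0 horner0; apply: eq_jet (jet_cst 0 z) => h; rewrite horner0.
have jX : jet (fun w => w) z z 1 0.
  by move=> e e0; exists 1 => // h _; rewrite mul1r mul0r addr0 subrr cabs0 mulr_ge0 ?sqr_ge0// ltW.
have J := jetD (jetM ih jX) (jet_cst k z).
eexists; apply: (@eq_jet (fun w => p.[w] * w + k)); first by move=> w; rewrite !hornerE.
have -> : (p * 'X + k%:P).[z] = p.[z] * z + k by rewrite !hornerE.
have -> : (p * 'X + k%:P)^`().[z] = p.[z] * 1 + p^`().[z] * z + 0.
  by rewrite derivD derivM derivX derivC !hornerE; ring.
exact: J.
Qed.

Lemma jet_near_neq0 g z a b c : jet g z a b c -> a != 0 ->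
  exists2 r : R, 0 < r & forall h, cabs h < r -> cabs a / 2 <= cabs (g (z + h)).
Proof.
move=> jg a0; have [r r0 rg] := jg 1 ltr01.
have a0' : 0 < cabs a by rewrite cabs_gt0.
pose M := cabs b + cabs c + 1.
have M0 : 0 < M by rewrite ltr_wpDl// addr_ge0 ?cabs_ge0.
exists (Num.min r (Num.min 1 (cabs a / 2 / M))).
  by rewrite !lt_min r0 ltr01 !divr_gt0.
move=> h; rewrite !lt_min => /andP[/rg hg /andP[/ltW h1]]; rewrite ltr_pdivlMr// => hM.
have h0 := cabs_ge0 h.
have hh : cabs h ^+ 2 <= cabs h by rewrite expr2 ler_piMl.
have hb : cabs (g (z + h) - a) <= cabs h * M.
  rewrite (_ : g (z + h) - a = g (z + h) - (a + b * h + c * h ^+ 2) + b * h + c * h ^+ 2); last by ring.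
  rewrite (le_trans (cabsD _ _))// /M mulrDr mulr1 mulrDr [leRHS]addrC addrA.
  rewrite lerD//; last by rewrite cabsM cabsX mulrC ler_wpM2r ?cabs_ge0.
  rewrite (le_trans (cabsD _ _))// lerD//; last by rewrite cabsM mulrC.
  by rewrite (le_trans hg)// mul1r.
have := cabs_dist a (g (z + h)); rewrite cabsB in hb; lra.
Qed.

Lemma jetV g z a b c : jet g z a b c -> a != 0 ->
  exists b' c', jet (fun w => (g w)^-1) z a^-1 b' c'.
Proof.
(* The coefficients of the formal inverse of a + b h + c h^2. *)
move=> jg a0; exists (- b / a ^+ 2), (b ^+ 2 / a ^+ 3 - c / a ^+ 2).
have [r r0 rg] := jet_near_neq0 jg a0.
pose P := fun h : K => a^-1 + (- b / a ^+ 2) * h + (b ^+ 2 / a ^+ 3 - c / a ^+ 2) * h ^+ 2.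
have bI : bounded0 (fun h => (g (z + h))^-1).
  exists (2 / cabs a), r => // h /rg; rewrite cabsV => hg.
  have a0' : 0 < cabs a by rewrite cabs_gt0.
  by rewrite -(invf_div _ 2) lef_pV2// posrE ?(lt_le_trans _ hg)// divr_gt0.
(* With [P] the truncated inverse, g P - 1 is the remainder of [g] times [P] plus a multiple of h^3;
   multiplying by the bounded function 1 / g gives P - 1 / g. *)
have s1 := small2M jg (bounded0_poly a^-1 (- b / a ^+ 2) (b ^+ 2 / a ^+ 3 - c / a ^+ 2)).
have s2 := small2M (@small2_cube 1) (bounded0_poly
  (b * (b ^+ 2 / a ^+ 3 - c / a ^+ 2) - c * b / a ^+ 2) (c * (b ^+ 2 / a ^+ 3 - c / a ^+ 2)) 0).
have s3 := small2M (small2D s1 s2) bI.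
move=> e e0; have [s s0 sh] := s3 e e0.
exists (Num.min r s); first by rewrite lt_min r0.
move=> h; rewrite lt_min => /andP[/rg hr /sh].
have g0 : g (z + h) != 0.
  by rewrite -cabs_gt0 (lt_le_trans _ hr)// divr_gt0// cabs_gt0.
rewrite -cabsN; congr (cabs _ <= _); field.
by rewrite g0 a0.
Qed.

(* [be] is twice the derivative with respect to [z], [tau] the mixed derivative with respect to [z] and [conj z] *)
Definition rjet F z (t : R) (be ga : K) (tau : R) :=
  small2 (fun h => rc (F (z + h) - (t + re (be * h) + re (ga * h ^+ 2) + tau * cabs h ^+ 2))).

Lemma rjet_val F z t be ga tau : rjet F z t be ga tau -> F z = t.
Proof.
move=> /(_ 1 ltr01)[r r0 /(_ 0)]; rewrite cabs0 => /(_ r0).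
rewrite addr0 !expr0n /= !mulr0 !raddf0 !addr0. rewrite cabs_rc => h.
by apply/eqP; rewrite -subr_eq0 -normr_eq0 eq_le h normr_ge0.
Qed.

Lemma rjet_ext F G z t be ga tau t' be' tau' : (forall w, F w = G w) ->
  t = t' -> be = be' -> tau = tau' ->
  rjet F z t be ga tau -> rjet G z t' be' ga tau'.
Proof. by move=> FG <- <- <-; apply: small2_ext => h; rewrite FG. Qed.

Lemma rjetD F G z t be ga tau t' be' ga' tau' :
  rjet F z t be ga tau -> rjet G z t' be' ga' tau' ->
  rjet (fun w => F w + G w) z (t + t') (be + be') (ga + ga') (tau + tau').
Proof.
move=> jF jG; apply: small2_ext (small2D jF jG) => h /=.
rewrite -rmorphD /=; congr rc; rewrite (mulrDl be) (mulrDl ga) !(raddfD re) /=; ring.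
Qed.

Lemma rjetZ F z t be ga tau (k : R) : rjet F z t be ga tau ->
  rjet (fun w => k * F w) z (k * t) (rc k * be) (rc k * ga) (k * tau).
Proof.
move=> jF e e0; have k1 : 0 < `|k| + 1 by rewrite ltr_wpDl.
have [|r r0 rF] := jF (e / (`|k| + 1)); first by rewrite divr_gt0.
exists r => // h /rF; rewrite !cabs_rc -!(mulrA (rc k)) !reMrc.
rewrite (_ : k * _ - _ = k * (F (z + h) - (t + re (be * h) + re (ga * h ^+ 2) + tau * cabs h ^+ 2))); last by ring.
move=> H; rewrite normrM (le_trans (ler_wpM2l (normr_ge0 _) H))// mulrA ler_wpM2r ?sqr_ge0//.
by rewrite mulrCA ler_piMr ?ltW// ltr_pdivrMr// mul1r ltrDl.
Qed.

(** In the expansion of f * conj g the only second-order mixed term is b * conj b' * h * conj h.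
    Taking real parts turns the terms in conj h into terms in h. *)
Lemma rjet_herm f g z a b c a' b' c' : jet f z a b c -> jet g z a' b' c' ->
  rjet (fun w => re (f w * (g w)^*)) z (re (a * a'^*)) (b * a'^* + a^* * b')
    (c * a'^* + a^* * c') (re (b * b'^*)).
Proof.
move=> jf jg.
have s1 := small2M jf (bounded0J (jet_bounded jg)).
have s2 := small2M (small2J jg) (bounded0_poly a b c).
have s3 := small2M (@small2_cube 1) (bounded0_poly (c * b'^*) (c * c'^*) 0).
have s4 := small2M (@small2_cube 1) (bounded0_poly (c' * b^*) 0 0).
have s3' : small2 (fun h => c * b'^* * h ^+ 2 * h^* + c * c'^* * h ^+ 2 * h^* ^+ 2 + b * c'^* * h * h^* ^+ 2).
  have e1 : small2 (fun h => c * b'^* * h ^+ 2 * h^*).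
    apply: small2_le (@small2_cube (c * b'^*)) => h.
    by rewrite !(cabsM, cabsX, cabsJ) exprSr !mulrA.
  have e2 : small2 (fun h => b * c'^* * h * h^* ^+ 2).
    apply: small2_le (@small2_cube (b * c'^*)) => h.
    by rewrite !(cabsM, cabsX, cabsJ) exprS !mulrA.
  have e3 : small2 (fun h => c * c'^* * h ^+ 2 * h^* ^+ 2).
    have := small2M (@small2_cube (c * c'^*)) (bounded0_poly 0 1 0).
    apply: small2_le => h; rewrite mul0r addr0 add0r mul1r.
    rewrite !(cabsM, cabsX, cabsJ).
    by rewrite (_ : _ * cabs h = cabs c * cabs c' * cabs h ^+ 2 * cabs h ^+ 2)//; ring.
  by apply: small2_ext (small2D (small2D e1 e3) e2) => h.
have := small2D (small2D s1 s2) s3'.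
apply: small2_le => h; rewrite cabs_rc.
set X := (X in _ <= cabs X).
suff -> : re (f (z + h) * (g (z + h))^*) - (re (a * a'^*) + re ((b * a'^* + a^* * b') * h)
    + re ((c * a'^* + a^* * c') * h ^+ 2) + re (b * b'^*) * cabs h ^+ 2) = re X by apply: ler_re.
have E1 : re (b * b'^*) * cabs h ^+ 2 = re (b * b'^* * (h * h^*)).
  by rewrite mulcJ [_ * rc _]mulrC reMrc mulrC.
have E2 : re ((b * a'^* + a^* * b') * h) = re (b * a'^* * h) + re (a * b'^* * h^*).
  rewrite mulrDl raddfD /=; congr (_ + _).
  by rewrite -re_conj !(conj_morph, conjCK).
have E3 : re ((c * a'^* + a^* * c') * h ^+ 2) = re (c * a'^* * h ^+ 2) + re (a * c'^* * h^* ^+ 2).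
  rewrite mulrDl raddfD /=; congr (_ + _).
  by rewrite -re_conj !(conj_morph, conjCK).
rewrite E1 E2 E3 -!raddfD -raddfB /=; congr re.
by rewrite /X !(conj_morph, conjB); ring.
Qed.

(** If [be] were nonzero, [F] would grow along conj be. Once it vanishes, adding the expansions at s
    and i s cancels the [ga] terms, whose squares are opposite, and leaves 2 tau s^2. *)
Lemma rjet_max F z t be ga tau : rjet F z t be ga tau ->
  (exists2 r : R, 0 < r & forall h, cabs h < r -> F (z + h) <= F z) ->
  be = 0 /\ tau <= 0.
Proof.
move=> jF [r r0 Fmax]; have Ft := rjet_val jF.
have be0 : be = 0.
  apply/eqP; rewrite -cabs_eq0 -[_ == _]negbK; apply/negP => nb.
  have b0 : 0 < cabs be by rewrite lt_def nb cabs_ge0.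
  have [r1 r10 r1F] := jF 1 ltr01.
  pose B := cabs be ^+ 2.
  have B0 : 0 < B by rewrite exprn_gt0.
  (* [M] dominates the second-order terms along h = s conj be after division by s^2, remainder
     included, so s M < B makes the linear gain s B win. *)
  pose M := `|re (ga * be^* ^+ 2)| + `|tau| * B + B + 1.
  have M0 : 0 < M by rewrite /M ltr_wpDl// !addr_ge0// ?mulr_ge0// ltW.
  have [s s0 [sr sr1 sM]] : exists2 s : R, 0 < s & [/\ s * cabs be < r, s * cabs be < r1 & s * M < B].
    exists (Num.min (r / cabs be) (Num.min (r1 / cabs be) (B / M)) / 2).
      by rewrite divr_gt0// !lt_min !divr_gt0.
    set mn := Num.min _ _.
    have mn0 : 0 < mn by rewrite !lt_min !divr_gt0.
    have : mn / 2 < mn by rewrite ltr_pdivrMr//; lra.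
    rewrite {2}/mn !lt_min => /andP[m1 /andP[m2 m3]].
    by split; rewrite -ltr_pdivlMr.
  have hs : cabs (rc s * be^*) = s * cabs be.
    by rewrite cabsM cabs_rc cabsJ gtr0_norm.
  have := r1F (rc s * be^*); rewrite hs => /(_ sr1).
  have := Fmax (rc s * be^*); rewrite hs => /(_ sr).
  rewrite cabs_rc Ft mul1r.
  have -> : re (be * (rc s * be^*)) = s * B by rewrite mulrCA reMrc re_mulcJ.
  have -> : re (ga * (rc s * be^*) ^+ 2) = s ^+ 2 * re (ga * be^* ^+ 2).
    by rewrite exprMn mulrCA -rmorphXn reMrc.
  rewrite exprMn -/B; set q := re (ga * _); move=> Fle.
  rewrite ler_norml => /andP[Fge _].
  have sM' : s * (s * M) < s * B by rewrite ltr_pM2l.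
  have q1 : s ^+ 2 * - `|q| <= s ^+ 2 * q by rewrite ler_wpM2l ?sqr_ge0// lerNl -normrN ler_norm.
  have q2 : s ^+ 2 * (- `|tau| * B) <= s ^+ 2 * (tau * B).
    by rewrite ler_wpM2l ?sqr_ge0// ler_wpM2r ?(ltW B0)// lerNl -normrN ler_norm.
  move: sM'; rewrite /M -/q; nra.
split=> //; rewrite leNgt; apply/negP => tau0.
have [|r1 r10 r1F] := jF (tau / 2); first by rewrite divr_gt0.
pose s := Num.min r r1 / 2.
have s0 : 0 < s by rewrite divr_gt0// lt_min r0.
have : s < Num.min r r1 by rewrite ltr_pdivrMr// ltr_pMr ?lt_min ?r0//; lra.
rewrite lt_min => /andP[sr sr1].
have hs1 : cabs (rc s) = s by rewrite cabs_rc gtr0_norm.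
have hs2 : cabs (ci * rc s) = s by rewrite cabsM cabs_ci mul1r hs1.
have := r1F (rc s); have := r1F (ci * rc s); rewrite hs1 hs2 => /(_ sr1) + /(_ sr1).
have := Fmax (rc s); have := Fmax (ci * rc s); rewrite hs1 hs2 => /(_ sr) + /(_ sr).
rewrite !cabs_rc be0 !mul0r !raddf0 Ft exprMn expr2 sqr_ci mulN1r mulrN raddfN /=.
rewrite !ler_norml => ? ? /andP[? _] /andP[? _].
have : 0 < tau * s ^+ 2 by rewrite mulr_gt0// exprn_gt0.
nra.
Qed.

End Jets.

(** * Maximum principles from second-order expansions *)

Section MaximumPrinciples.
Variable R : realType.
Local Notation K := (C R).
Implicit Types (f g u v U : K -> K) (F G M N : K -> R) (z a b c : K).

Lemma rjet_mul_normsq F z t be ga tau : rjet F z t be ga tau ->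
  rjet (fun w => cabs w ^+ 2 * F w) z (cabs z ^+ 2 * t)
    (rc (2 * t) * z^* + rc (cabs z ^+ 2) * be) (rc (cabs z ^+ 2) * ga + z^* * be)
    (cabs z ^+ 2 * tau + t + re (z * be)).
Proof.
move=> jF.
have sq h : cabs (z + h) ^+ 2 = cabs z ^+ 2 + 2 * re (z^* * h) + cabs h ^+ 2.
  by rewrite !sqr_cabs !raddfD reM /= re_conj im_conj; ring.
have b1 : bounded0 (fun h => rc (cabs (z + h) ^+ 2)).
  exists ((cabs z + 1) ^+ 2), 1 => // h /ltW h1; rewrite cabs_rc ger0_norm ?sqr_ge0//.
  by rewrite lerXn2r ?nnegrE ?addr_ge0 ?cabs_ge0// (le_trans (cabsD _ _))// lerD2l.
have s1 := small2M jF b1.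
(* The terms of order at least three in the product of the two expansions. *)
pose q h : R := 2 * re (z^* * h) * (re (ga * h ^+ 2) + tau * cabs h ^+ 2)
  + cabs h ^+ 2 * (re (be * h) + re (ga * h ^+ 2) + tau * cabs h ^+ 2).
have s2 : small2 (fun h => rc (q h)).
  pose m : R := 2 * cabs z * (cabs ga + `|tau|) + (cabs be + cabs ga + `|tau|).
  have m0 : 0 <= m by rewrite /m !addr_ge0 ?mulr_ge0 ?addr_ge0 ?cabs_ge0.
  move=> e e0; exists (Num.min 1 (e / (m + 1))).
    by rewrite lt_min ltr01 divr_gt0// ltr_wpDl.
  move=> h; rewrite lt_min ltr_pdivlMr ?ltr_wpDl// => /andP[/ltW h1 hm].
  rewrite cabs_rc.
  have h0 := cabs_ge0 h.
  have Bz : `|re (z^* * h)| <= cabs z * cabs h by rewrite (le_trans (ler_re _))// cabsM cabsJ.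
  have Bb : `|re (be * h)| <= cabs be * cabs h by rewrite (le_trans (ler_re _))// cabsM.
  have Bg : `|re (ga * h ^+ 2)| <= cabs ga * cabs h ^+ 2 by rewrite (le_trans (ler_re _))// cabsM cabsX.
  have Bt : `|tau * cabs h ^+ 2| <= `|tau| * cabs h ^+ 2 by rewrite normrM (ger0_norm (sqr_ge0 _)).
  have hh : cabs h ^+ 2 <= cabs h by rewrite expr2 ler_piMl.
  have B1 : `|re (ga * h ^+ 2) + tau * cabs h ^+ 2| <= (cabs ga + `|tau|) * cabs h ^+ 2.
    by rewrite mulrDl (le_trans (ler_normD _ _))// lerD.
  have B2 : `|re (be * h) + re (ga * h ^+ 2) + tau * cabs h ^+ 2| <= (cabs be + cabs ga + `|tau|) * cabs h.
    rewrite !mulrDl -addrA (le_trans (ler_normD _ _))// -addrA lerD// (le_trans (ler_normD _ _))// lerD//.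
      by rewrite (le_trans Bg)// ler_wpM2l ?cabs_ge0.
    by rewrite (le_trans Bt)// ler_wpM2l.
  apply: (@le_trans _ _ (cabs h * m * cabs h ^+ 2)); last first.
    rewrite ler_wpM2r ?sqr_ge0//; apply: le_trans (ltW hm); rewrite ler_wpM2l// lerDl//.
  have -> : cabs h * m * cabs h ^+ 2 =
      2 * (cabs z * cabs h * ((cabs ga + `|tau|) * cabs h ^+ 2)) +
      cabs h ^+ 2 * ((cabs be + cabs ga + `|tau|) * cabs h) by rewrite /m; ring.
  rewrite /q (le_trans (ler_normD _ _))// lerD//.
    by rewrite -mulrA normrM normrM ger0_norm// ler_pM2l// ler_pM.
  by rewrite normrM ger0_norm ?sqr_ge0// ler_wpM2l ?sqr_ge0.
apply: small2_ext (small2D s1 s2) => h; rewrite -rmorphM -rmorphD /=; congr rc.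
have E1 n : re ((rc (2 * t) * z^* + rc n * be) * h) = 2 * t * re (z^* * h) + n * re (be * h).
  by rewrite mulrDl (raddfD re) /= -!mulrA !reMrc mulrA.
have E2 n : re ((rc n * ga + z^* * be) * h ^+ 2) =
    n * re (ga * h ^+ 2) + (2 * re (z^* * h) * re (be * h) - re (z * be) * cabs h ^+ 2).
  rewrite mulrDl (raddfD re) /= -mulrA reMrc; congr (_ + _).
  by rewrite sqr_cabs !(reM, imM, re_conj, im_conj, expr2); ring.
by rewrite E1 E2 sq /q; ring.
Qed.

(** Adding e |z|^2 to |U|^2 makes the mixed derivative at least e > 0, which excludes an interior
    maximum. Expansions are needed only where [U] is nonzero, because [U] cannot vanish at the
    maximum point. *)
Lemma max_modulus U (rho b : R) : rho <= 1 -> 0 <= b ->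
  (forall z, cabs z <= rho -> {for z, continuous U}) ->
  (forall z, cabs z < rho -> U z != 0 -> exists a b c, jet U z a b c) ->
  (forall z, cabs z = rho -> cabs (U z) <= b) ->
  forall z, cabs z <= rho -> cabs (U z) <= b.
Proof.
move=> rho1 b0 Uc Uj Ub z1 z1r; rewrite leNgt; apply/negP => bU.
have rho0 : 0 <= rho := le_trans (cabs_ge0 _) z1r.
(* Half the gap at [z1]: the maximum of [v] is at least b^2 + 2 e, whereas e |z|^2 <= e because rho
   <= 1. This excludes the circle and the zeros of [U]. *)
pose e := (cabs (U z1) ^+ 2 - b ^+ 2) / 2.
have e0 : 0 < e by rewrite divr_gt0// subr_gt0 ltrXn2r// nnegrE ?cabs_ge0.
pose v z := cabs (U z) ^+ 2 + e * cabs z ^+ 2.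
have [|z0 z0r z0m] := @cabs_le_max R rho v rho0.
  by move=> z zr; apply: continuous_add_normsq; exact: (continuous_sq_cabs (Uc z zr)).
have sq1 z : cabs z <= rho -> e * cabs z ^+ 2 <= e.
  by move=> zr; rewrite ler_piMr ?(ltW e0)// exprn_ile1 ?cabs_ge0// (le_trans zr).
have v0 : b ^+ 2 + 2 * e <= v z0.
  apply: le_trans (z0m _ z1r); rewrite /v /e.
  have : 0 <= e * cabs z1 ^+ 2 by rewrite mulr_ge0 ?sqr_ge0// ltW.
  by rewrite /e; lra.
have z0r' : cabs z0 < rho.
  rewrite lt_neqAle z0r andbT; apply/eqP => z0r'.
  have : cabs (U z0) ^+ 2 <= b ^+ 2 by rewrite lerXn2r ?nnegrE ?cabs_ge0// Ub.
  have := sq1 _ z0r; move: v0; rewrite /v; lra.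
have U0 : U z0 != 0.
  apply/eqP => U0; move: v0; rewrite /v U0 cabs0 expr0n /=.
  have := sq1 _ z0r; have : 0 <= b ^+ 2 by apply: sqr_ge0. by lra.
have [a [b' [c jU]]] := Uj _ z0r' U0.
have [c2 jX] := jet_horner ('X : {poly K}) z0.
have J := rjetD (rjet_herm jU jU) (rjetZ e (rjet_herm jX jX)).
have vE w : re (U w * (U w)^*) + e * re ('X.[w] * ('X.[w])^*) = v w.
  by rewrite !re_mulcJ hornerX.
have [|_] := rjet_max J.
  exists (rho - cabs z0); first by rewrite subr_gt0.
  move=> h hr; rewrite !vE; apply: z0m; rewrite (le_trans (cabsD _ _))//.
  by rewrite -lerBrDl ltW.
rewrite derivX hornerC conj1 mulr1 re1 re_mulcJ => h.
have : 0 <= cabs b' ^+ 2 by apply: sqr_ge0. by lra.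
Qed.

(* The last hypothesis says that [M / N] is subharmonic wherever it exceeds [kap]. *)
Lemma ratio_max_principle M N (kap c C0 : R) : 0 < c -> 0 <= C0 ->
  (forall z, {for z, continuous M}) -> (forall z, {for z, continuous N}) ->
  (forall z, cabs z < 1 -> c * (1 - cabs z ^+ 2) <= N z) ->
  (forall z, cabs z < 1 -> M z - kap * N z <= C0 * (1 - cabs z ^+ 2) ^+ 2) ->
  (forall z, cabs z < 1 -> exists bM gM tM bN gN tN,
    [/\ rjet M z (M z) bM gM tM, rjet N z (N z) bN gN tN &
      kap * N z < M z -> 0 <= N z * tM - M z * tN - re (bM * bN^*) / 2
        + M z / N z * cabs bN ^+ 2 / 2]) ->
  forall z, cabs z < 1 -> M z <= kap * N z.
Proof.
move=> c0 C00 Mc Nc Nlb MN sub z1 z11; rewrite leNgt; apply/negP => MN1.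
have sq1 z : cabs z < 1 -> 0 < 1 - cabs z ^+ 2.
  by move=> z1'; rewrite subr_gt0 exprn_ilt1 ?cabs_ge0.
have N0 z : cabs z < 1 -> 0 < N z.
  by move=> z1'; apply: lt_le_trans (Nlb _ z1'); rewrite mulr_gt0// sq1.
pose eta := (M z1 / N z1 - kap) / 2.
have eta0 : 0 < eta by rewrite divr_gt0// subr_gt0 ltr_pdivlMr ?N0.
(* For |z| >= 1 - del one has 1 - |z|^2 <= 2 del, hence C0 (1 - |z|^2)^2 < c eta (1 - |z|^2) <= eta
   N, so M / N stays below kap + eta near the circle. *)
pose del := c * eta / (2 * (C0 + 1)).
have C01 : 0 < C0 + 1 by rewrite ltr_wpDl.
have del0 : 0 < del by apply: divr_gt0; exact: mulr_gt0.
pose rho := Num.max (cabs z1) (1 - del).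
have rho1 : rho < 1 by rewrite gt_max z11; lra.
have rho0 : 0 <= rho by rewrite le_max cabs_ge0.
pose v z := M z / N z + eta * cabs z ^+ 2.
have [|z0 z0r z0m] := @cabs_le_max R rho v rho0.
  move=> z zr; apply: continuous_add_normsq.
  have Nz : N z != 0 by rewrite gt_eqF// N0// (le_lt_trans zr).
  exact: (continuousM (Mc z) (continuousV Nz (Nc z))).
have v0 : kap + 2 * eta <= v z0.
  apply: le_trans (z0m z1 _); last by rewrite le_max lexx.
  have : 0 <= eta * cabs z1 ^+ 2 by rewrite mulr_ge0 ?sqr_ge0// ltW.
  by rewrite /v /eta; lra.
have z01 : cabs z0 < 1 := le_lt_trans z0r rho1.
have N00 := N0 _ z01.
have z02 : cabs z0 ^+ 2 <= 1 by have := sq1 _ z01; lra.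
have z0r' : cabs z0 < rho.
  rewrite lt_neqAle z0r andbT; apply/eqP => z0r'.
  suff : M z0 / N z0 < kap + eta.
    move: v0; rewrite /v; have : eta * cabs z0 ^+ 2 <= eta by rewrite ler_piMr// ltW.
    lra.
  rewrite ltr_pdivrMr//.
  have h1 := MN _ z01; have h2 := Nlb _ z01; have h3 := sq1 _ z01.
  have h4 : 1 - cabs z0 ^+ 2 <= 2 * del.
    have : 1 - del <= cabs z0 by rewrite z0r' le_max lexx orbT.
    have := cabs_ge0 z0; nra.
  have h5 : (C0 + 1) * (2 * del) = c * eta.
    by rewrite /del; field; rewrite gt_eqF// ltr_wpDl.
  set x := 1 - cabs z0 ^+ 2 in h1 h2 h3 h4.
  have h6 : C0 * x < c * eta by rewrite -h5; nra.
  have h7 : C0 * x ^+ 2 < c * eta * x by rewrite expr2 mulrA ltr_pM2r.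
  have h8 : eta * (c * x) <= eta * N z0 by rewrite ler_pM2l.
  nra.
have [bM [gM [tM [bN [gN [tN [jM jN]]]]]]] := sub _ z01.
(* The quotient need not be expanded: M + eta |w|^2 N - v(z0) N equals N (v - v(z0)), which has a
   local maximum at [z0], with value 0. *)
have J := rjetD jM (rjetD (rjetZ eta (rjet_mul_normsq jN)) (rjetZ (- v z0) jN)).
have [|be0 tau0] := rjet_max J.
  exists (rho - cabs z0); first by rewrite subr_gt0.
  move=> h hr.
  have hr' : cabs (z0 + h) <= rho.
    by rewrite (le_trans (cabsD _ _))// -lerBrDl ltW.
  have TE w : cabs w < 1 -> M w + (eta * (cabs w ^+ 2 * N w) + - v z0 * N w) = N w * (v w - v z0).
    by move=> w1; move: (v z0) => m; rewrite /v; field; rewrite gt_eqF// N0.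
  rewrite !TE ?subrr ?mulr0 ?(le_lt_trans hr')//.
  by rewrite pmulr_rle0 ?N0 ?(le_lt_trans hr')// subr_le0 z0m.
pose mu := M z0 / N z0.
have mE : v z0 = mu + eta * cabs z0 ^+ 2 by [].
have ME : M z0 = mu * N z0 by rewrite /mu divfK ?gt_eqF.
have muk : kap < mu.
  have : eta * cabs z0 ^+ 2 <= eta by rewrite ler_piMr// ltW.
  move: v0; rewrite mE; lra.
have bME : bM = rc mu * bN - rc (2 * eta * N z0) * z0^*.
  have := be0; rewrite mE !(rmorphD, rmorphM, rmorphN) /= => be0'.
  rewrite -[bM]subr0 -be0'; ring.
rewrite ME ltr_pM2r// => /(_ muk).
rewrite -/mu bME mulfK ?gt_eqF// -mulNr.
have -> : re ((rc mu * bN - rc (2 * eta * N z0) * z0^*) * bN^*) =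
   mu * cabs bN ^+ 2 - 2 * eta * N z0 * re (z0 * bN).
  have E : re (z0^* * bN^*) = re (z0 * bN).
    by rewrite -[LHS]re_conj !(conj_morph, conjCK).
  by rewrite mulrBl raddfB /= -(mulrA (rc mu)) -(mulrA (rc _)) !reMrc re_mulcJ E.
move: tau0; rewrite mE => tau0 H.
(* After substitution of [bM], N times the left side of [tau0] is the right side of [H] plus eta
   N^2: the two signs are incompatible. *)
have : 0 < eta * N z0 ^+ 2 by rewrite mulr_gt0// exprn_gt0.
have := ler_wpM2l (ltW N00) tau0.
nra.
Qed.

End MaximumPrinciples.

(** * Uniqueness *)

Section BlaschkeUniqueness.
Variable R : realType.
Local Notation K := (C R).
Implicit Types (p q g h k : {poly K}) (z w a : K) (d : nat) (s : seq K).
Local Notation W := blaschke_wronskian.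
Local Notation B := wronskian_polar.

Definition disk_rooted d g := exists a s,
  [/\ a != 0, size s = d, (forall z, z \in s -> cabs z < 1) &
      g = a *: \prod_(z <- s) ('X - z%:P)].

Lemma star_prod s : star (size s) (\prod_(z <- s) ('X - z%:P)) =
  \prod_(z <- s) (1 - z^* *: 'X).
Proof.
elim: s => [|a s ih].
  rewrite !big_nil; apply/polyP => i; rewrite coef_star coefC.
  by case: i => [|i] /=; rewrite ?subnn coefC //= conj1.
rewrite !big_cons -[size _]/(1 + size s)%N starM ?size_XsubC ?size_prod_XsubC// ih.
congr (_ * _); apply/polyP => i; rewrite coef_star !coefB coefX !coefC coefZ coefX.
case: i => [|[|i]] /=.
- by rewrite mulr0 !subr0 conj1.
- by rewrite mulr1 !sub0r conjN.
- by rewrite mulr0 subrr.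
Qed.

Lemma disk_rooted_size d g : disk_rooted d g -> size g = d.+1.
Proof. by case=> a [s [a0 <- _ ->]]; rewrite size_scale// size_prod_XsubC. Qed.

Lemma disk_rooted_sizeW d g : disk_rooted d g -> (size g <= d.+1)%N.
Proof. by move/disk_rooted_size ->. Qed.

Lemma sq_mobius a z : cabs (1 - a^* * z) ^+ 2 =
  cabs (z - a) ^+ 2 + (1 - cabs a ^+ 2) * (1 - cabs z ^+ 2).
Proof.
by rewrite !sqr_cabs !(raddfB re, raddfB im) /= !(reM, imM, re_conj, im_conj, re1, im1); ring.
Qed.

Lemma mobius_le a z : cabs a <= 1 -> cabs z <= 1 -> cabs (z - a) <= cabs (1 - a^* * z).
Proof.
move=> a1 z1; rewrite -ler_sqr ?nnegrE ?cabs_ge0// sq_mobius lerDl.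
by rewrite mulr_ge0// subr_ge0 exprn_ile1 ?cabs_ge0.
Qed.

Lemma mobius_ge a z : cabs a <= 1 -> 1 <= cabs z -> cabs (1 - a^* * z) <= cabs (z - a).
Proof.
move=> a1 z1; rewrite -ler_sqr ?nnegrE ?cabs_ge0// sq_mobius gerDl.
by rewrite mulr_ge0_le0// ?subr_ge0 ?subr_le0 ?exprn_ile1 ?exprn_ege1 ?cabs_ge0.
Qed.

Lemma mobius_neq0 a z : cabs a < 1 -> cabs z <= 1 -> 1 - a^* * z != 0.
Proof.
move=> a1 z1; apply: contraTneq (a1) => /eqP; rewrite subr_eq0 => /eqP az.
by rewrite -leNgt -(@cabs1 R) az cabsM cabsJ ler_piMr// cabs_ge0.
Qed.

Lemma horner_star_disk_rooted d g a s : size s = d ->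
  g = a *: \prod_(z <- s) ('X - z%:P) ->
  forall z, (star d g).[z] = a^* * \prod_(b <- s) (1 - b^* * z).
Proof.
move=> <- -> z; rewrite starZ star_prod hornerZ horner_prod; congr (_ * _).
by apply: eq_bigr => b _; rewrite !hornerE.
Qed.

Lemma horner_disk_rooted a s z :
  (a *: \prod_(z <- s) ('X - z%:P)).[z] = a * \prod_(b <- s) (z - b).
Proof.
rewrite hornerZ horner_prod; congr (_ * _).
by apply: eq_bigr => b _; rewrite !hornerE.
Qed.

Lemma cabs_prod s (F : K -> K) : cabs (\prod_(b <- s) F b) = \prod_(b <- s) cabs (F b).
Proof. by elim: s => [|b s ih]; rewrite ?big_nil ?cabs1// !big_cons cabsM ih. Qed.

Lemma ler_prod_seq s (F G : K -> R) :
  (forall b, b \in s -> 0 <= F b <= G b) -> \prod_(b <- s) F b <= \prod_(b <- s) G b.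
Proof. by move=> FG; rewrite big_seq [leRHS]big_seq ler_prod. Qed.

Lemma le_star_disk d g z : disk_rooted d g -> cabs z <= 1 ->
  cabs g.[z] <= cabs (star d g).[z].
Proof.
move=> [a [s [a0 sd s1 gE]]] z1; rewrite (horner_star_disk_rooted sd gE) gE horner_disk_rooted.
rewrite !cabsM cabsJ ler_wpM2l ?cabs_ge0// !cabs_prod ler_prod_seq// => b bs.
by rewrite cabs_ge0 mobius_le// ltW ?s1.
Qed.

Lemma ge_star_disk d g z : disk_rooted d g -> 1 <= cabs z ->
  cabs (star d g).[z] <= cabs g.[z].
Proof.
move=> [a [s [a0 sd s1 gE]]] z1; rewrite (horner_star_disk_rooted sd gE) gE horner_disk_rooted.
rewrite !cabsM cabsJ ler_wpM2l ?cabs_ge0// !cabs_prod ler_prod_seq// => b bs.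
by rewrite cabs_ge0 mobius_ge// ltW ?s1.
Qed.

Lemma star_disk_neq0 d g z : disk_rooted d g -> cabs z <= 1 -> (star d g).[z] != 0.
Proof.
move=> [a [s [a0 sd s1 gE]]] z1; rewrite (horner_star_disk_rooted sd gE).
rewrite mulf_neq0 ?conjC_eq0// prodf_seq_neq0; apply/allP => b bs /=.
by rewrite mobius_neq0// s1.
Qed.

Lemma star_disk_lb d g : disk_rooted d g ->
  exists2 c : R, 0 < c & forall z, cabs z <= 1 -> c <= cabs (star d g).[z].
Proof.
move=> dg; have [|z0 z01 z0m] := @cabs_le_max R 1 (fun z => - cabs (star d g).[z]) ler01.
  move=> z z1; apply: continuousN; apply: continuous_cabs; exact: continuous_horner_num.
exists (cabs (star d g).[z0]); first by rewrite cabs_gt0 star_disk_neq0.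
by move=> z /z0m; rewrite lerN2.
Qed.

(* The sesquilinear form polarizing [|q|^2 - |p|^2], where [p = 'X * g] and [q = star d g] *)
Definition blaschke_form d x y z : R :=
  re ((star d x).[z] * (star d y).[z]^*) - re (z * x.[z] * (z * y.[z])^*).

Local Notation S := blaschke_form.

Lemma blaschke_form_self d g z : S d g g z = cabs (star d g).[z] ^+ 2 - cabs z ^+ 2 * cabs g.[z] ^+ 2.
Proof. by rewrite /S !re_mulcJ cabsM exprMn. Qed.

Lemma blaschke_formBD d x y z : S d (x + y) (x - y) z = S d x x z - S d y y z.
Proof.
rewrite /S starD starB !(hornerD, hornerN, conj_morph, mulrDr, mulrDl, mulrN, mulNr).
rewrite !(raddfD re, raddfN re) /=.
have E (u v : K) : re (u * v^*) = re (v * u^*).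
  by rewrite -re_conj !(conj_morph, conjCK) mulrC.
have E' (u v : K) : re (z * u * (z^* * v^*)) = re (z * v * (z^* * u^*)).
  by rewrite -re_conj !(conj_morph, conjCK) mulrC.
rewrite (E (star d x).[z] (star d y).[z]) (E' x.[z] y.[z]); ring.
Qed.

Lemma continuous_blaschke_form d x y z : {for z, continuous (S d x y)}.
Proof.
have cj p : {for z, continuous (fun w => (p.[w])^*)}.
  by apply: continuous_conj; exact: continuous_horner_num.
have E : S d x y = (fun w => re ((star d x).[w] * ((star d y).[w])^*)) -
    (fun w => re (('X * x).[w] * (('X * y).[w])^*)).
  by apply/funext => w; rewrite /S !fctE !hornerM hornerX.
by rewrite E; apply: continuousB; apply: continuous_re; apply: continuousM;
  [exact: continuous_horner_num|exact: cj|exact: continuous_horner_num|exact: cj].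
Qed.

Lemma horner_Xderiv g z : ('X * g)^`().[z] = g.[z] + z * g^`().[z].
Proof. by rewrite derivM derivX mul1r !hornerE. Qed.

Lemma rjet_blaschke_form d x y z : exists ga,
  rjet (S d x y) z (S d x y z)
    ((star d x)^`().[z] * (star d y).[z]^* + (star d x).[z]^* * (star d y)^`().[z]
     - (('X * x)^`().[z] * (z * y.[z])^* + (z * x.[z])^* * ('X * y)^`().[z]))
    ga
    (re ((star d x)^`().[z] * (star d y)^`().[z]^*)
     - re (('X * x)^`().[z] * ('X * y)^`().[z]^*)).
Proof.
have [c1 j1] := jet_horner (star d x) z; have [c2 j2] := jet_horner (star d y) z.
have [c3 j3] := jet_horner ('X * x) z; have [c4 j4] := jet_horner ('X * y) z.
have J := rjetD (rjet_herm j1 j2) (rjetZ (-1) (rjet_herm j3 j4)).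
have E w : re ((star d x).[w] * ((star d y).[w])^*) + -1 * re (('X * x).[w] * (('X * y).[w])^*) = S d x y w.
  by rewrite /S !hornerM hornerX mulN1r.
eexists; apply: (rjet_ext E _ _ _ J).
- by rewrite -E.
- by rewrite rmorphN rmorph1 mulN1r !hornerM !hornerX.
- by rewrite mulN1r.
Qed.

(** The point is that [c0] is uniform in [w] on the circle. In the induction the old remainder is
    multiplied by (1 - t) w and a term t^2 w^2 p'(w) is added. *)
Lemma horner_expand p : exists2 c0 : R, 0 <= c0 & forall w (t : R),
  cabs w = 1 -> 0 <= t <= 1 ->
  cabs (p.[rc (1 - t) * w] - (p.[w] - rc t * (w * p^`().[w]))) <= c0 * t ^+ 2.
Proof.
elim/poly_ind: p => [|p k [c0 c00 ih]].
  by exists 0 => // w t _ _; rewrite deriv0 !horner0 !mulr0 !subrr cabs0 mul0r.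
have [m m0 mb] := horner_bounded p^`() 1.
exists (c0 + m); first by rewrite addr_ge0// ltW.
move=> w t w1 /[dup] /andP[t0 t1] /(ih w t w1) H.
have -> : (p * 'X + k%:P).[rc (1 - t) * w] - ((p * 'X + k%:P).[w] - rc t * (w * (p * 'X + k%:P)^`().[w]))
  = rc (1 - t) * w * (p.[rc (1 - t) * w] - (p.[w] - rc t * (w * p^`().[w])))
    + rc t ^+ 2 * (w ^+ 2 * p^`().[w]).
  rewrite derivD derivM derivX derivC addr0 mulr1 !(hornerD, hornerM, hornerX, hornerC).
  by rewrite (rmorphB rc) rmorph1 /=; ring.
rewrite (le_trans (cabsD _ _))// mulrDl lerD//.
  rewrite !cabsM w1 mulr1 cabs_rc ger0_norm ?subr_ge0// (le_trans _ H)//.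
  by rewrite ler_piMl ?cabs_ge0// lerBlDr lerDl.
rewrite !(cabsM, cabsX) w1 expr1n mul1r cabs_rc ger0_norm// mulrC ler_wpM2r ?sqr_ge0//.
by rewrite mb// w1.
Qed.

Lemma herm_expand p q : exists2 c0 : R, 0 <= c0 & forall w (t : R),
  cabs w = 1 -> 0 <= t <= 1 ->
  `|re (p.[rc (1 - t) * w] * q.[rc (1 - t) * w]^*) - (re (p.[w] * q.[w]^*)
    - t * re (w * p^`().[w] * q.[w]^* + p.[w] * (w * q^`().[w])^*))| <= c0 * t ^+ 2.
Proof.
have [cp cp0 hp] := horner_expand p; have [cq cq0 hq] := horner_expand q.
have [m1 m10 b1] := horner_bounded p 1; have [m2 m20 b2] := horner_bounded q 1.
have [m3 m30 b3] := horner_bounded p^`() 1; have [m4 m40 b4] := horner_bounded q^`() 1.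
exists (cp * m2 + (m1 + m3) * cq + m3 * m4).
  by rewrite !addr_ge0 ?mulr_ge0 ?addr_ge0// ltW.
move=> w t w1 t01; have /andP[t0 t1] := t01.
have wt1 : cabs (rc (1 - t) * w) <= 1.
  by rewrite cabsM w1 mulr1 cabs_rc ger0_norm ?subr_ge0// lerBlDr lerDl.
have w1' : cabs w <= 1 by rewrite w1.
have {}hp := hp w t w1 t01; have {}hq := hq w t w1 t01.
set P := p.[rc _ * w] in hp *; set Q := q.[rc _ * w] in hq *.
have Qb : cabs Q <= m2 by apply: b2.
have Pb : cabs (p.[w] - rc t * (w * p^`().[w])) <= m1 + m3.
  rewrite (le_trans (cabs_triB _ _))// lerD ?b1// !cabsM w1 mul1r cabs_rc ger0_norm//.
  by rewrite (le_trans _ (b3 w w1'))// ler_piMl ?cabs_ge0.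
rewrite -reMrc -!raddfB /= (le_trans (ler_re _))//.
have -> : P * Q^* - (p.[w] * q.[w]^* - rc t * (w * p^`().[w] * q.[w]^* + p.[w] * (w * q^`().[w])^*))
  = (P - (p.[w] - rc t * (w * p^`().[w]))) * Q^*
  + (p.[w] - rc t * (w * p^`().[w])) * (Q - (q.[w] - rc t * (w * q^`().[w])))^*
  + rc t ^+ 2 * ((w * w^*) * (p^`().[w] * q^`().[w]^*)).
  by rewrite !(conj_morph) !conj_rc; ring.
rewrite (le_trans (cabsD _ _))// (mulrDl _ _ (t ^+ 2)) lerD//.
  rewrite (le_trans (cabsD _ _))// (mulrDl _ _ (t ^+ 2)) lerD// cabsM cabsJ.
    by rewrite mulrAC ler_pM ?cabs_ge0.
  by rewrite -mulrA ler_pM ?cabs_ge0.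
rewrite !(cabsM, cabsX, cabsJ) w1 !mul1r cabs_rc ger0_norm// mulrC ler_wpM2r ?sqr_ge0//.
by rewrite ler_pM ?cabs_ge0 ?b3 ?b4.
Qed.

(** [star d x] is w^d conj(x) on the circle, so the form vanishes there, and its inward normal
    derivative is the real number conj(w^d) B(w). Hence B = 0 means vanishing to second order along
    the circle. *)
Lemma blaschke_form_expand d (x y : {poly K}) : (size x <= d.+1)%N -> (size y <= d.+1)%N ->
  exists2 c0 : R, 0 <= c0 & forall w (t : R), cabs w = 1 -> 0 <= t <= 1 ->
  `|S d x y (rc (1 - t) * w) - t * re ((w ^+ d)^* * (B d x y).[w])| <= c0 * t ^+ 2.
Proof.
move=> sx sy; have [c1 c10 h1] := herm_expand (star d x) (star d y).
have [c2 c20 h2] := herm_expand ('X * x) ('X * y).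
exists (c1 + c2); first by rewrite addr_ge0.
move=> w t w1 t01; have {}h1 := h1 w t w1 t01; have {}h2 := h2 w t w1 t01.
rewrite mulrDl (le_trans _ (lerD h1 h2))// (le_trans _ (ler_normB _ _))//.
rewrite le_eqVlt; apply/orP; left; apply/eqP; congr `|_|.
rewrite /S !hornerM !hornerX !horner_Xderiv (horner_star_circle sx w1) (horner_star_circle sy w1).
rewrite (horner_deriv_star_circle sx w1) (horner_deriv_star_circle sy w1).
rewrite horner_polar_circle//.
have ww : w * w^* = 1 by rewrite mulcJ w1 expr1n rmorph1.
have wd : w ^+ d * (w ^+ d)^* = 1 by rewrite conjX -exprMn ww expr1n.
rewrite (mulrA (w ^+ d)^*) (mulrC (w ^+ d)^*) wd mul1r re_rc.
have E (u v k l m : K) : k * k^* = 1 -> k * u * (k * v)^* = u * v^*.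
  by move=> kk; rewrite conjM mulrACA kk mul1r.
rewrite !(E _ _ _ w w ww) !(E _ _ _ w w wd).
set Z := (1 - d%:R) * _ + _ + _.
set f1 := x.[w]^* * _; set f2 := x.[w] * y.[w]^*.
set g1 := (d%:R * x.[w] - _)^* * _ + _; set g2 := (x.[w] + _) * _ + _.
have e1 : re f1 = re f2 by rewrite -re_conj /f1 /f2 !(conj_morph, conjCK).
have e2 : re g2 - re g1 = 2 * re Z.
  apply: (@mulfI _ 2); first by rewrite pnatr_eq0.
  apply: rcI; rewrite -raddfB -addcJ rmorphM /= -addcJ rmorph_nat.
  by rewrite /g1 /g2 /Z !(conj_morph, conjCK); ring.
by rewrite e1 -[re g2](subrK (re g1)) e2; ring.
Qed.

End BlaschkeUniqueness.

(** * The Liouville equation and rigidity *)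

Section BlaschkeRigidity.
Variable R : realType.
Local Notation K := (C R).
Implicit Types (p q g h k : {poly K}) (z w a : K) (d : nat).
Local Notation W := blaschke_wronskian.
Local Notation B := wronskian_polar.
Local Notation S := blaschke_form.

Lemma polar_decomposition z : cabs z <= 1 -> exists w (t : R),
  [/\ cabs w = 1, 0 <= t <= 1, z = rc (1 - t) * w & t = 1 - cabs z].
Proof.
move=> z1; have t01 : 0 <= 1 - cabs z <= 1 by rewrite subr_ge0 z1 lerBlDr lerDl cabs_ge0.
have [->|z0] := eqVneq z 0.
  exists 1, 1; rewrite cabs1 cabs0 subrr subr0 rmorph0 mul0r.
  by split=> //; rewrite ler01 lexx.
have z0' : cabs z != 0 by rewrite cabs_eq0.
exists (rc (cabs z)^-1 * z), (1 - cabs z); split=> //.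
  by rewrite cabsM cabs_rc ger0_norm ?invr_ge0 ?cabs_ge0// mulVf.
by rewrite subKr mulrA -rmorphM /= divff// rmorph1 mul1r.
Qed.

Lemma blaschke_form_boundary d (x y : {poly K}) : (size x <= d.+1)%N -> (size y <= d.+1)%N ->
  exists2 c0 : R, 0 <= c0 & forall z, cabs z <= 1 -> `|S d x y z| <= c0 * (1 - cabs z).
Proof.
move=> sx sy; have [c0 c00 H] := blaschke_form_expand sx sy.
have [m m0 mb] := horner_bounded (B d x y) 1.
exists (c0 + m); first by rewrite addr_ge0// ltW.
move=> z z1; have [w [t [w1 t01 zE tE]]] := polar_decomposition z1.
have := H w t w1 t01; have /andP[t0 t1] := t01.
rewrite -zE -tE.
have : `|re ((w ^+ d)^* * (B d x y).[w])| <= m.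
  by rewrite (le_trans (ler_re _))// cabsM cabsJ cabsX w1 expr1n mul1r mb// w1.
have : c0 * t ^+ 2 <= c0 * t by rewrite ler_wpM2l// expr2 ler_piMl.
rewrite !ler_norml => ? /andP[? ?] /andP[? ?].
by apply/andP; split; nra.
Qed.

Lemma blaschke_form_boundary0 d (x y : {poly K}) : (size x <= d.+1)%N -> (size y <= d.+1)%N ->
  B d x y = 0 ->
  exists2 c0 : R, 0 <= c0 & forall z, cabs z < 1 -> `|S d x y z| <= c0 * (1 - cabs z ^+ 2) ^+ 2.
Proof.
move=> sx sy B0; have [c0 c00 H] := blaschke_form_expand sx sy.
exists c0 => // z z1; have [w [t [w1 t01 zE tE]]] := polar_decomposition (ltW z1).
have := H w t w1 t01; rewrite B0 horner0 mulr0 raddf0 mulr0 subr0 -zE => /le_trans; apply.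
have := cabs_ge0 z; have /andP[t0 t1] := t01 => z0.
rewrite ler_wpM2l// lerXn2r ?nnegrE//; rewrite tE in t0 *.
  by rewrite subr_ge0 exprn_ile1// ltW.
by rewrite lerD2l lerN2 expr2 ler_piMr// ltW.
Qed.

(** From |g| <= |star d g| in the disk, the form is at least (1 - |z|^2) |star d g|^2, and
    [star d g] is bounded away from 0 on the closed disk. *)
Lemma blaschke_form_lb d g : disk_rooted d g ->
  exists2 c : R, 0 < c & forall z, cabs z < 1 -> c * (1 - cabs z ^+ 2) <= S d g g z.
Proof.
move=> dg; have [c c0 cb] := star_disk_lb dg.
exists (c ^+ 2); first by rewrite exprn_gt0.
move=> z /ltW z1; rewrite blaschke_form_self.
have := le_star_disk dg z1; have := cb z z1.
have : cabs z ^+ 2 <= 1 by rewrite exprn_ile1// cabs_ge0.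
have := cabs_ge0 g.[z]; set x := cabs g.[z]; set y := cabs (star d g).[z].
have : 0 <= cabs z ^+ 2 by apply: sqr_ge0.
move: (cabs z ^+ 2) => n n0 x0 n1 cy xy.
have x2 : x ^+ 2 <= y ^+ 2 by rewrite lerXn2r// nnegrE// (le_trans x0).
have c2 : c ^+ 2 <= y ^+ 2 by rewrite lerXn2r ?nnegrE ?(ltW c0)// (le_trans x0).
nra.
Qed.

Section Curvature.
Variables u u1 v v1 : K.
Let N := re (u * u^*) - re (v * v^*).
Let bN := u1 * u^* + u^* * u1 - (v1 * v^* + v^* * v1).
Let tN := re (u1 * u1^*) - re (v1 * v1^*).

(** The Gram determinant identity for the form |u|^2 - |v|^2 of signature (1, 1), applied to the
    vectors (u, v) and (u1, v1). It is used with [u], [v] the values of q and p at a point and [u1],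
    [v1] those of their derivatives. *)
Lemma liouville_identity : N * tN = cabs bN ^+ 2 / 4 - cabs (v1 * u - v * u1) ^+ 2.
Proof.
by rewrite /N /bN /tN !sqr_cabs !reimE; field.
Qed.

(** The derivative of [liouville_identity] in the direction (a, b): the hypothesis says that the
    Wronskian does not vary, so the variation of its squared modulus drops out. *)
Lemma liouville_linearized (a a1 b b1 : K) :
  v1 * a + b1 * u - v * a1 - b * u1 = 0 ->
  N * (re (a1 * u1^*) - re (b1 * v1^*)) + (re (a * u^*) - re (b * v^*)) * tN
  = re ((a1 * u^* + a^* * u1 - (b1 * v^* + b^* * v1)) * bN^*) / 2.
Proof.
move=> B0.
have : re ((v1 * u - v * u1) * (v1 * a + b1 * u - v * a1 - b * u1)^*) = 0.
  by rewrite B0 conj0 mulr0 raddf0.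
rewrite /N /bN /tN !reimE => H.
apply/eqP; rewrite -subr_eq0; apply/eqP; rewrite -[RHS]oppr0 -H.
by field.
Qed.

End Curvature.

Lemma horner_W d g z : (W d g).[z] =
  ('X * g)^`().[z] * (star d g).[z] - z * g.[z] * (star d g)^`().[z].
Proof. by rewrite /W !(hornerD, hornerN, hornerM, hornerX). Qed.

Lemma horner_B d g h z : (B d g h).[z] =
  ('X * g)^`().[z] * (star d h).[z] + ('X * h)^`().[z] * (star d g).[z]
  - z * g.[z] * (star d h)^`().[z] - z * h.[z] * (star d g)^`().[z].
Proof. by rewrite /B !(hornerD, hornerN, hornerM, hornerX). Qed.

(** The maximum principle with kap = 0 for M = S h g and N = S g g. By the linearized equation the
    expression to be bounded below is 2 (M / N) |W g|^2, which is nonnegative where M > 0. *)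
Lemma blaschke_form_polar_le0 d g h : disk_rooted d g -> (size h <= d.+1)%N ->
  B d g h = 0 -> forall z, cabs z < 1 -> S d h g z <= 0.
Proof.
move=> dg sh B0 z z1; have sg := disk_rooted_sizeW dg.
have [c c0 Nlb] := blaschke_form_lb dg.
have [m m0 Mb] := blaschke_form_boundary0 sh sg (etrans (wronskian_polarC d h g) B0).
have := @ratio_max_principle R (S d h g) (S d g g) 0 c m c0 m0
  (@continuous_blaschke_form R d h g) (@continuous_blaschke_form R d g g) Nlb.
rewrite -[X in _ <= X](mul0r (S d g g z)); apply=> // w w1.
  by rewrite mul0r subr0 (le_trans (ler_norm _)) ?Mb.
have [gM jM] := rjet_blaschke_form d h g w; have [gN jN] := rjet_blaschke_form d g g w.
do 6 eexists; split; [exact: jM|exact: jN|rewrite mul0r => M0].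
have N0 : 0 < S d g g w.
  by rewrite (lt_le_trans _ (Nlb _ w1))// mulr_gt0// subr_gt0 exprn_ilt1 ?cabs_ge0.
have := liouville_identity (star d g).[w] (star d g)^`().[w] (w * g.[w]) ('X * g)^`().[w].
have := @liouville_linearized (star d g).[w] (star d g)^`().[w] (w * g.[w]) ('X * g)^`().[w]
  (star d h).[w] (star d h)^`().[w] (w * h.[w]) ('X * h)^`().[w].
rewrite -horner_B B0 horner0 => /(_ erefl).
rewrite -/(S d g g w) -/(S d h g w).
move: N0 M0; move: (S d g g w) (S d h g w) => N M N0 M0.
set tM := re _ - re _; set tN := re _ - re _; set rMN := re (_ * _^*); set nN := cabs _ ^+ 2.
set cW := cabs _ ^+ 2 => lin liou.
have cW0 : 0 <= cW by apply: sqr_ge0.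
have -> : N * tM - M * tN - rMN / 2 + M / N * nN / 2 = 2 * M / N * cW.
  have -> : rMN = 2 * (N * tM + M * tN) by rewrite lin; field.
  have -> : nN = 4 * (N * tN + cW) by rewrite liou; field.
  by field; rewrite gt_eqF.
by rewrite mulr_ge0// divr_ge0 ?mulr_ge0// ltW.
Qed.

Lemma blaschke_formNl d (x y : {poly K}) z : S d (- x) y z = - S d x y z.
Proof. by rewrite /S starN !hornerN mulrN !mulNr !(raddfN re) /= opprB opprK addrC. Qed.

Lemma blaschke_form_polar_eq0 d g h : disk_rooted d g -> (size h <= d.+1)%N ->
  B d g h = 0 -> forall z, cabs z < 1 -> S d h g z = 0.
Proof.
move=> dg sh B0 z z1; apply/eqP; rewrite eq_le blaschke_form_polar_le0//=.
by rewrite -oppr_le0 -blaschke_formNl blaschke_form_polar_le0 ?size_polyN// wronskian_polarNr B0 oppr0.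
Qed.

(** The maximum principle with kap = 1. The difference of the forms is S (k + g) (k - g), which
    vanishes to second order on the circle because B (k + g) (k - g) = 0. *)
Lemma blaschke_form_le d g k : disk_rooted d g -> disk_rooted d k ->
  W d g = W d k -> forall z, cabs z < 1 -> S d k k z <= S d g g z.
Proof.
move=> dg dk Wgk z z1; have sg := disk_rooted_sizeW dg; have sk := disk_rooted_sizeW dk.
have [c c0 Nlb] := blaschke_form_lb dg.
have B0 : B d (k + g) (k - g) = 0 by rewrite wronskian_polarBD Wgk subrr mul0rn.
have skg : (size (k + g)%R <= d.+1)%N by rewrite (leq_trans (size_polyD _ _))// geq_max sk.
have skg' : (size (k - g)%R <= d.+1)%N by rewrite (leq_trans (size_polyD _ _))// geq_max size_polyN sk.
have [m m0 Mb] := blaschke_form_boundary0 skg skg' B0.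
have := @ratio_max_principle R (S d k k) (S d g g) 1 c m c0 m0
  (@continuous_blaschke_form R d k k) (@continuous_blaschke_form R d g g) Nlb.
rewrite -[X in _ <= X](mul1r (S d g g z)); apply=> // w w1.
  by rewrite mul1r (le_trans _ (Mb w w1))// blaschke_formBD ler_norm.
have [gM jM] := rjet_blaschke_form d k k w; have [gN jN] := rjet_blaschke_form d g g w.
do 6 eexists; split; [exact: jM|exact: jN|rewrite mul1r => NM].
have N0 : 0 < S d g g w.
  by rewrite (lt_le_trans _ (Nlb _ w1))// mulr_gt0// subr_gt0 exprn_ilt1 ?cabs_ge0.
have := liouville_identity (star d g).[w] (star d g)^`().[w] (w * g.[w]) ('X * g)^`().[w].
have := liouville_identity (star d k).[w] (star d k)^`().[w] (w * k.[w]) ('X * k)^`().[w].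
rewrite -!horner_W Wgk -/(S d g g w) -/(S d k k w).
move: N0 NM; move: (S d g g w) (S d k k w) => N M N0 NM.
set bM := _ + _ - _; set bN := _ + _ - _.
set tM := re _ - re _; set tN := re _ - re _; set cW := cabs (W d k).[w] ^+ 2 => lM lN.
have cW0 : 0 <= cW by apply: sqr_ge0.
have M0 : 0 < M := lt_trans N0 NM.
have sq : cabs (rc N * bM - rc M * bN) ^+ 2 =
    N ^+ 2 * cabs bM ^+ 2 + M ^+ 2 * cabs bN ^+ 2 - 2 * N * M * re (bM * bN^*).
  rewrite !sqr_cabs (raddfB re) (raddfB im) /= !reMrc !imMrc reM re_conj im_conj; ring.
(* Subharmonicity of M / N where M > N: by the Liouville equations with a common Wronskian, it is a
   square plus (M^2 - N^2) |W|^2. *)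
have E : M * N * (N * tM - M * tN - re (bM * bN^*) / 2 + M / N * cabs bN ^+ 2 / 2)
   = cabs (rc N * bM - rc M * bN) ^+ 2 / 4 + (M ^+ 2 - N ^+ 2) * cW.
  rewrite sq.
  have -> : cabs bM ^+ 2 = 4 * (M * tM + cW) by rewrite lM; field.
  have -> : cabs bN ^+ 2 = 4 * (N * tN + cW) by rewrite lN; field.
  by field; rewrite gt_eqF.
rewrite -(pmulr_rge0 _ (mulr_gt0 M0 N0)) E addr_ge0//.
  by rewrite divr_ge0// sqr_ge0.
by rewrite mulr_ge0// subr_ge0 lerXn2r// ?nnegrE ?ltW.
Qed.

(** For z = x + i y the sum is a polynomial in the real variables x, y. It stays zero when first x
    and then y become complex, and then x + i y and x - i y are independent. *)
Lemma hermitian_polarization (s : seq ({poly K} * {poly K})) (e : R) : 0 < e ->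
  (forall z, cabs z < e -> \sum_(x <- s) x.1.[z] * x.2.[z]^* = 0) ->
  forall z w, \sum_(x <- s) x.1.[z] * x.2.[w]^* = 0.
Proof.
move=> e0 H; pose cj p := map_poly (@Num.conj K) p.
have cjE p w : p.[w]^* = (cj p).[w^*] by rewrite /cj horner_map.
pose P (x y : K) := \sum_(a <- s) a.1.[x + ci * y] * (cj a.2).[x - ci * y].
have e2 : 0 < e / 2 by rewrite divr_gt0.
have P1 (x y : R) : 0 < x < e / 2 -> 0 < y < e / 2 -> P (rc x) (rc y) = 0.
  move=> /andP[x0 xe] /andP[y0 ye]; rewrite -[RHS](H (rc x + ci * rc y)).
    by apply: eq_bigr => a _; rewrite cjE conjD conjM !conj_rc ciJ mulNr.
  rewrite (le_lt_trans (cabsD _ _))// cabsM cabs_ci mul1r !cabs_rc !gtr0_norm//; lra.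
have P2 (x : K) (y : R) : 0 < y < e / 2 -> P x (rc y) = 0.
  move=> ye.
  pose Q := \sum_(a <- s) (a.1 \Po ('X + (ci * rc y)%:P)) * (cj a.2 \Po ('X - (ci * rc y)%:P)).
  have QE t : Q.[t] = P t (rc y).
    rewrite /Q horner_sum; apply: eq_bigr => a _.
    by rewrite hornerM !horner_comp !(hornerD, hornerN, hornerX, hornerC).
  rewrite -QE (_ : Q = 0) ?horner0//; apply: (poly0_small_real e2) => t te.
  by rewrite QE P1.
have P3 (x y : K) : P x y = 0.
  pose Q := \sum_(a <- s) (a.1 \Po (x%:P + ci *: 'X)) * (cj a.2 \Po (x%:P - ci *: 'X)).
  have QE t : Q.[t] = P x t.
    rewrite /Q horner_sum; apply: eq_bigr => a _.
    by rewrite hornerM !horner_comp !(hornerD, hornerN, hornerZ, hornerX, hornerC).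
  rewrite -QE (_ : Q = 0) ?horner0//; apply: (poly0_small_real e2) => t te.
  by rewrite QE P2.
(* The solution of x + i y = z, x - i y = conj w. *)
move=> z w; rewrite -[RHS](P3 ((z + w^*) / 2) (- ci * (z - w^*) / 2)).
have ci2 : ci * (- ci * (z - w^*) / 2) = (z - w^*) / 2 by rewrite !mulrA mulrN sqr_ci opprK mul1r.
rewrite /P ci2; apply: eq_bigr => a _; rewrite cjE.
by congr (_.[_] * _.[_]); field.
Qed.

Lemma disk_rooted_horner1 d g : disk_rooted d g -> g.[1] != 0.
Proof.
move=> dg; rewrite -cabs_gt0 (lt_le_trans _ (ge_star_disk dg _)) ?cabs1//.
by rewrite cabs_gt0 (star_disk_neq0 dg)// cabs1.
Qed.

(** In the polarized identity, w = 0 removes the terms with factor X and shows that h is an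
    imaginary multiple of g, the direction of phase rotation. The condition on [h.[1]] excludes it,
    given that re g(1) is nonzero. *)
Lemma wronskian_polar_inj d g h : disk_rooted d g -> (size h <= d.+1)%N ->
  re g.[1] != 0 -> im h.[1] = 0 -> B d g h = 0 -> h = 0.
Proof.
move=> dg sh g1 h1 B0; have sg := disk_rooted_sizeW dg.
pose s := [:: (star d h, star d g); (star d g, star d h); (- ('X * h), 'X * g); (- ('X * g), 'X * h)].
have H0 z : cabs z < 1 -> \sum_(x <- s) x.1.[z] * x.2.[z]^* = 0.
  move=> z1; have := blaschke_form_polar_eq0 dg sh B0 z1; rewrite /S => /(congr1 (fun x => rc (2 * x))).
  rewrite mulr0 rmorph0 mulrBr rmorphB /= -!addcJ => E.
  rewrite -[RHS]E !big_cons big_nil /= !(hornerN, hornerM, hornerX) !(conj_morph, conjCK); ring.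
have H z : (star d h).[z] * (star d g).[0]^* + (star d g).[z] * (star d h).[0]^* = 0.
  rewrite -[RHS](hermitian_polarization ltr01 H0 z 0) !big_cons big_nil /= !(hornerN, hornerM, hornerX) !mul0r conj0 !mulr0.
  by rewrite !addr0.
have g0 : (star d g).[0]^* != 0 by rewrite conjC_eq0 (star_disk_neq0 dg)// cabs0.
pose ka := - (star d h).[0]^* / (star d g).[0]^*.
have hs : star d h = ka *: star d g.
  apply: poly_ext_nz => z _; rewrite hornerZ; apply: (mulIf g0).
  have /eqP := H z; rewrite addr_eq0 => /eqP ->.
  by rewrite /ka; field.
have kaJ : ka^* = - ka.
  have : ka * (star d g).[0]^* = - (star d h).[0]^* by rewrite /ka divfK.
  by rewrite hs hornerZ conjM -mulNr => /(mulIf g0) e; rewrite [in RHS]e opprK.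
have hE : h = ka^* *: g by rewrite -[LHS](starK sh) hs starZ starK.
have reka : re ka = 0.
  by have := congr1 re kaJ; rewrite re_conj reN => ?; lra.
have imka : im ka = 0.
  move: h1; rewrite hE hornerZ imM re_conj im_conj reka mul0r add0r mulNr => /eqP.
  by rewrite oppr_eq0 mulf_eq0 (negPf g1) orbF => /eqP.
by rewrite hE (_ : ka = 0) ?conj0 ?scale0r//; apply: complex_ext; rewrite ?imka ?reka raddf0.
Qed.

(** Setting w = 0 in the polarized equality of forms gives k = conj(ka) g, and z = 0 gives |ka| = 1.
    Since g(1) is real and nonzero, reality of k(1) makes [ka] real. *)
Lemma blaschke_wronskian_inj d g k : disk_rooted d g -> disk_rooted d k ->
  im g.[1] = 0 -> im k.[1] = 0 -> W d g = W d k -> k = g \/ k = - g.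
Proof.
move=> dg dk g1 k1 Wgk; have sg := disk_rooted_sizeW dg; have sk := disk_rooted_sizeW dk.
pose s := [:: (star d k, star d k); (- star d g, star d g); (- ('X * k), 'X * k); ('X * g, 'X * g)].
have H0 z : cabs z < 1 -> \sum_(x <- s) x.1.[z] * x.2.[z]^* = 0.
  move=> z1; have : S d k k z = S d g g z.
    by apply/eqP; rewrite eq_le !blaschke_form_le.
  rewrite !blaschke_form_self => /(congr1 rc); rewrite -!exprMn -!cabsM !rmorphB /= -!mulcJ.
  move/eqP; rewrite -subr_eq0 => /eqP E.
  by rewrite -[RHS]E !big_cons big_nil /= !(hornerN, hornerM, hornerX); ring.
have H z : (star d k).[z] * (star d k).[0]^* = (star d g).[z] * (star d g).[0]^*.
  apply/eqP; rewrite -subr_eq0; apply/eqP; rewrite -[RHS](hermitian_polarization ltr01 H0 z 0) !big_cons big_nil /=.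
  by rewrite !(hornerN, hornerM, hornerX) !mul0r conj0 !mulr0 !addr0 mulNr.
have g0 : (star d g).[0]^* != 0 by rewrite conjC_eq0 (star_disk_neq0 dg)// cabs0.
have k0 : (star d k).[0]^* != 0 by rewrite conjC_eq0 (star_disk_neq0 dk)// cabs0.
pose ka := (star d g).[0]^* / (star d k).[0]^*.
have ks : star d k = ka *: star d g.
  apply: poly_ext_nz => z _; rewrite hornerZ; apply: (mulIf k0).
  by rewrite H /ka; field.
have ka1 : cabs ka = 1.
  have E : cabs (star d k).[0] = cabs (star d g).[0].
    apply/eqP; rewrite -(@eqrXn2 _ 2) ?cabs_ge0// !expr2 -{2}[cabs (star d k).[0]]cabsJ.
    by rewrite -{2}[cabs (star d g).[0]]cabsJ -!cabsM H.
  rewrite /ka cabsM cabsV !cabsJ E divff// cabs_eq0; by rewrite conjC_eq0 in g0.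
have kE : k = ka^* *: g by rewrite -[LHS](starK sk) ks starZ starK.
have g10 : re g.[1] != 0.
  apply: contra (disk_rooted_horner1 dg) => /eqP r0.
  by apply/eqP; apply: complex_ext; rewrite ?r0 ?g1 raddf0.
have imka : im ka = 0.
  move: k1; rewrite kE hornerZ imM im_conj g1 mulr0 add0r mulNr => /eqP.
  by rewrite oppr_eq0 mulf_eq0 (negPf g10) orbF => /eqP.
have kar : ka^* = rc (re ka) by apply: complex_ext; rewrite ?re_conj ?im_conj ?re_rc ?im_rc ?imka ?oppr0.
have := sqr_cabs ka; rewrite ka1 imka expr1n expr0n addr0 => /esym/eqP; rewrite sqrf_eq1.
rewrite kE kar => /orP[] /eqP ->; [left|right]; first by rewrite rmorph1 scale1r.
by rewrite rmorphN rmorph1 scaleN1r.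
Qed.

End BlaschkeRigidity.

(** * Existence *)

Section ContinuousCoefficients.
Variable R : realType.
Local Notation K := (C R).

Lemma continuous_sum_seq (V : numFieldType) (T : topologicalType) (I : Type) (s : seq I)
    (F : I -> T -> V) (x : T) :
  (forall i, {for x, continuous (F i)}) -> {for x, continuous (fun y => \sum_(i <- s) F i y)}.
Proof.
move=> Fc; elim: s => [|i s ih].
  under [X in {for x, continuous X}]funext do rewrite big_nil.
  exact: cst_continuous.
under [X in {for x, continuous X}]funext do rewrite big_cons.
exact: (continuousD (Fc i) ih).
Qed.

Lemma continuous_cst (T : topologicalType) (c : K) (x : T) : {for x, continuous (fun=> c)}.
Proof. exact: cst_continuous. Qed.

(** Only finitely many coefficients enter the functions to be minimized, so continuity of each
    coefficient separately suffices. *)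
Definition ccoef (T : topologicalType) (P : T -> {poly K}) (x : T) :=
  forall k, {for x, continuous (fun y => (P y)`_k)}.

Section Closure.
Variables (T : topologicalType) (x : T).
Implicit Types P Q : T -> {poly K}.

Lemma ccoef_ext P Q : (forall y, P y = Q y) -> ccoef P x -> ccoef Q x.
Proof. by move=> PQ; rewrite (funext PQ). Qed.

Lemma ccoef_cst (p : {poly K}) : ccoef (fun=> p) x.
Proof. by move=> k; exact: continuous_cst. Qed.

Lemma ccoefD P Q : ccoef P x -> ccoef Q x -> ccoef (fun y => P y + Q y) x.
Proof.
move=> cP cQ k; under [X in {for x, continuous X}]funext do rewrite coefD.
exact: (continuousD (cP k) (cQ k)).
Qed.

Lemma ccoefN P : ccoef P x -> ccoef (fun y => - P y) x.
Proof.
move=> cP k; under [X in {for x, continuous X}]funext do rewrite coefN.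
exact: (continuousN (cP k)).
Qed.

Lemma ccoefM P Q : ccoef P x -> ccoef Q x -> ccoef (fun y => P y * Q y) x.
Proof.
move=> cP cQ k; under [X in {for x, continuous X}]funext do rewrite coefM.
by apply: continuous_sum_seq => i; exact: (continuousM (cP _) (cQ _)).
Qed.

Lemma ccoefC (c : T -> K) : {for x, continuous c} -> ccoef (fun y => (c y)%:P) x.
Proof.
move=> cc k; under [X in {for x, continuous X}]funext do rewrite coefC.
by case: k => [|k]; [exact: cc|exact: continuous_cst].
Qed.

Lemma ccoef_deriv P : ccoef P x -> ccoef (fun y => (P y)^`()) x.
Proof.
move=> cP k; under [X in {for x, continuous X}]funext do rewrite coef_deriv -mulr_natr.
exact: (continuousM (cP k.+1) (@continuous_cst T k.+1%:R x)).
Qed.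

Lemma ccoef_star n P : ccoef P x -> ccoef (fun y => star n (P y)) x.
Proof.
move=> cP k; under [X in {for x, continuous X}]funext do rewrite coef_star.
by case: ifP => _; [exact: (continuous_conj (cP (n - k)%N))|exact: continuous_cst].
Qed.

Lemma ccoef_prod (I : Type) (s : seq I) (P : I -> T -> {poly K}) :
  (forall i, ccoef (P i) x) -> ccoef (fun y => \prod_(i <- s) P i y) x.
Proof.
move=> cP; elim: s => [|i s ih].
  by apply: (ccoef_ext (P := fun=> 1)); [move=> y; rewrite big_nil|exact: ccoef_cst].
by apply: ccoef_ext (ccoefM (cP i) ih) => y; rewrite big_cons.
Qed.

Lemma ccoef_wronskian d P : ccoef P x -> ccoef (fun y => blaschke_wronskian d (P y)) x.
Proof.
move=> cP; have cXP := ccoefM (@ccoef_cst 'X) cP; have csP := @ccoef_star d _ cP.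
exact: (ccoefD (ccoefM (ccoef_deriv cXP) csP) (ccoefN (ccoefM cXP (ccoef_deriv csP)))).
Qed.

End Closure.

Lemma continuous_coord n (i : 'I_n) (x : 'rV[K]_n) : {for x, continuous (fun y : 'rV[K]_n => y 0 i)}.
Proof. exact: coord_continuous. Qed.

Lemma ccoef_rVpoly n (x : 'rV[K]_n) : ccoef (fun y : 'rV[K]_n => rVpoly y) x.
Proof.
move=> k; under [X in {for x, continuous X}]funext do rewrite coef_rVpoly.
by case: insubP => [i _ _|_]; [exact: continuous_coord|exact: continuous_cst].
Qed.

Lemma compact_cabs_ball (a : K) (r : R) : compact [set z : K | cabs (z - a) <= r].
Proof.
apply: (subclosed_compact _ (@compact_cabs_le R (r + cabs a))).
  have -> : [set z : K | cabs (z - a) <= r] = (fun z : K => cabs (z - a)) @^-1` [set x | x <= r] by [].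
  apply: preimage_closed; last exact: closed_le.
  move=> z _; have cz : {for z, continuous (fun w : K => w)} by exact: cvg_id.
  exact: (continuous_cabs (continuousB cz (@continuous_cst K a z))).
by move=> z /= za; rewrite -[z](subrK a) (le_trans (cabsD _ _))// lerD2r.
Qed.

End ContinuousCoefficients.

(** * The linearized equation and the residual *)

Section Residual.
Variable R : realType.
Local Notation K := (C R).
Implicit Types (g h P D : {poly K}) (d : nat).
Local Notation W := blaschke_wronskian.
Local Notation B := wronskian_polar.

(** A square real linear system of size 2 d + 2, injective by [wronskian_polar_inj]. A
    self-reciprocal polynomial of formal degree 2 d is determined by its coefficients of index at
    most d, the middle one being real. *)
Lemma wronskian_polar_surj d g D (y : R) : disk_rooted d g -> re g.[1] != 0 ->
  star (d + d) D = D ->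
  exists h, [/\ (size h <= d.+1)%N, forall k, (k <= d)%N -> (B d g h)`_k = D`_k & im h.[1] = y].
Proof.
move=> dg g1 DE; have sg := disk_rooted_sizeW dg.
have mid_real (E : {poly K}) : star (d + d) E = E -> im E`_d = 0.
  move=> /(congr1 (fun p : {poly K} => p`_d)); rewrite coef_star leq_addr addnK => /(congr1 im).
  by rewrite im_conj => ?; lra.
have low0 (E : {poly K}) : star (d + d) E = E -> (forall k, (k <= d)%N -> E`_k = 0) -> E = 0.
  move=> sE E0; apply/polyP => k; rewrite coef0; case: (leqP k d) => [/E0//|dk].
  by rewrite -sE coef_star; case: leqP => // k2; rewrite E0 ?conj0//; lia.
pose io (v : 'rV[R]_(d.+1 + d.+1)) : {poly K} :=
  \poly_(k < d.+1) (rc (v 0 (lshift _ (inord k))) + ci * rc (v 0 (rshift _ (inord k)))).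
have sio v : (size (io v) <= d.+1)%N by exact: size_poly.
have io_lin (a : R) u v : io (a *: u + v) = rc a *: io u + io v.
  apply/polyP => k; rewrite coefD coefZ !coef_poly; case: ifP => _; last by rewrite mulr0 addr0.
  by rewrite !mxE !(rmorphD rc) !(rmorphM rc) /=; ring.
(* The imaginary part of the coefficient of index d vanishes identically; its slot carries the phase
   condition, which makes the system square. *)
pose f (v : 'rV[R]_(d.+1 + d.+1)) : 'rV[R]_(d.+1 + d.+1) := \row_j match fintype.split j with
  | inl k => re (B d g (io v))`_k
  | inr k => if (k < d)%N then im (B d g (io v))`_k else im (io v).[1] end.
have f_lin : linear f.
  move=> a u v; apply/rowP => j; rewrite !mxE io_lin wronskian_polarDr wronskian_polarZr.
  case: fintype.split => k; first by rewrite coefD coefZ reD reMrc.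
  by case: ifP => _; rewrite ?(coefD, coefZ) ?(hornerD, hornerZ) imD imMrc.
pose fL : {linear 'rV[R]_(d.+1 + d.+1) -> 'rV[R]_(d.+1 + d.+1)} :=
  HB.pack f (GRing.isLinear.Build _ _ _ _ f f_lin).
have funit : lin1_mx fL \in unitmx.
  rewrite -row_free_unit; apply: inj_row_free => v; rewrite mul_rV_lin1 => /rowP fv.
  have fl k : re (B d g (io v))`_(k : 'I_d.+1) = 0.
    by have := fv (lshift _ k); rewrite !mxE -[lshift _ _]/(unsplit (inl k)) unsplitK.
  have fr (k : 'I_d.+1) : (if (k < d)%N then im (B d g (io v))`_k else im (io v).[1]) = 0.
    by have := fv (rshift _ k); rewrite !mxE -[rshift _ _]/(unsplit (inr k)) unsplitK.
  have sB := star_polar sg (sio v).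
  have B0 : B d g (io v) = 0.
    apply: low0 => // k kd; apply: complex_ext; rewrite raddf0.
      by have := fl (inord k); rewrite inordK.
    move: kd; rewrite leq_eqVlt => /orP[/eqP ->|kd]; first exact: mid_real.
    by have := fr (inord k); rewrite inordK ?kd// ltnW.
  have im1 : im (io v).[1] = 0 by have := fr ord_max; rewrite ltnn.
  have io0 := wronskian_polar_inj dg (sio v) g1 im1 B0.
  have vE k : rc (v 0 (lshift _ k)) + ci * rc (v 0 (rshift _ k)) = 0.
    by have := congr1 (fun p : {poly K} => p`_k) io0; rewrite coef0 coef_poly ltn_ord inord_val.
  apply/rowP => j; rewrite mxE -(fintype.splitK j); case: (fintype.split j) => k /=.
    by have := congr1 re (vE k); rewrite reD reM re_rc im_rc re_ci mul0r mulr0 subrr addr0.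
  by have := congr1 im (vE k); rewrite imD imM re_rc !im_rc im_ci re_ci mul0r mul1r !add0r.
pose b : 'rV[R]_(d.+1 + d.+1) := \row_j match fintype.split j with
  | inl k => re D`_k | inr k => if (k < d)%N then im D`_k else y end.
pose v := b *m invmx (lin1_mx fL).
have fv : f v = b by rewrite -[f v](mul_rV_lin1 fL) /v mulmxKV.
have sB := star_polar sg (sio v).
exists (io v); split => // [k kd|]; last first.
  by have := congr1 (fun u : 'rV_(_) => u 0 (unsplit (inr ord_max))) fv; rewrite !mxE unsplitK ltnn.
apply: complex_ext.
  have := congr1 (fun u : 'rV_(_) => u 0 (unsplit (inl (inord k)))) fv.
  by rewrite !mxE unsplitK inordK.
move: kd; rewrite leq_eqVlt => /orP[/eqP ->|kd]; first by rewrite !mid_real.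
have := congr1 (fun u : 'rV_(_) => u 0 (unsplit (inr (inord k)))) fv.
by rewrite !mxE unsplitK inordK ?kd// ltnW.
Qed.

(** Indices at most d suffice by self-reciprocity. The last sum is g(1), written through
    coefficients so that continuity in them is immediate. *)
Definition residual d P g : R :=
  \sum_(k < d.+1) cabs (W d g - P)`_k ^+ 2 + im (\sum_(k < d.+1) g`_k) ^+ 2.

Lemma residual_ge0 d P g : 0 <= residual d P g.
Proof. by rewrite addr_ge0 ?sqr_ge0// sumr_ge0// => k _; exact: sqr_ge0. Qed.

Lemma sum_coef_horner1 d g : (size g <= d.+1)%N -> \sum_(k < d.+1) g`_k = g.[1].
Proof. by move=> sg; rewrite (horner_coef_wide _ sg); apply: eq_bigr => k _; rewrite expr1n mulr1. Qed.

Lemma residual_eq0 d P g : (size g <= d.+1)%N -> star (d + d) P = P ->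
  residual d P g = 0 -> W d g = P /\ im g.[1] = 0.
Proof.
move=> sg sP /eqP; rewrite paddr_eq0 ?sqr_ge0 ?sumr_ge0// => [/andP[]|k _]; last exact: sqr_ge0.
rewrite psumr_eq0 => [|k _]; last exact: sqr_ge0.
move=> /allP W0; rewrite sqrf_eq0 sum_coef_horner1// => /eqP im0; split=> //.
apply/eqP; rewrite -subr_eq0; apply/eqP.
have sE : star (d + d) (W d g - P) = W d g - P by rewrite starB star_wronskian// sP.
have E0 k : (k <= d)%N -> (W d g - P)`_k = 0.
  move=> kd; have := W0 (inord k) (mem_index_enum _).
  by rewrite sqrf_eq0 inordK// cabs_eq0 => /eqP.
apply/polyP => k; rewrite coef0; case: (leqP k d) => [/E0//|dk].
by rewrite -sE coef_star; case: leqP => // k2; rewrite E0 ?conj0//; lia.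
Qed.

Lemma residual_solution d P g : (size g <= d.+1)%N -> im g.[1] = 0 ->
  residual d P g = \sum_(k < d.+1) cabs (W d g - P)`_k ^+ 2.
Proof. by move=> sg g1; rewrite /residual sum_coef_horner1// g1 expr0n addr0. Qed.

Lemma continuous_residual (T : topologicalType) d P (G : T -> {poly K}) (x : T) :
  ccoef G x -> {for x, continuous (fun y => residual d P (G y))}.
Proof.
move=> cG; have cD := ccoefD (@ccoef_wronskian _ _ _ d _ cG) (ccoefN (@ccoef_cst R T x P)).
apply: (@continuousD _ R^o); last first.
  have : {for x, continuous (fun y => im (\sum_(k < d.+1) (G y)`_k))}.
    by apply: continuous_im; apply: continuous_sum_seq => k; exact: cG.
  by move=> c; exact: (continuousM c c).
by apply: continuous_sum_seq => k; apply: continuous_sq_cabs; exact: cD.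
Qed.

End Residual.

(** * Estimates on the circle, stability of disk-rootedness, descent *)

Section BlaschkeExistence.
Variable R : realType.
Local Notation K := (C R).
Implicit Types (g h P V : {poly K}) (d : nat) (a z w : K).
Local Notation W := blaschke_wronskian.
Local Notation B := wronskian_polar.

(** Each root contributes Re(w / (w - a)) >= 1/2 to the real part of w g' / g. Multiplying by |g|^2
    covers roots on the circle as well. *)
Lemma circle_log_deriv_ge (s : seq K) w : cabs w = 1 -> (forall z, z \in s -> cabs z <= 1) ->
  let g := \prod_(z <- s) ('X - z%:P) in
  (size s)%:R * cabs g.[w] ^+ 2 <= 2 * re (w * g^`().[w] * g.[w]^*).
Proof.
move=> w1; elim: s => [|a s ih] s1 /=.
  by rewrite big_nil mulr0n mul0r derivC horner0 mulr0 mul0r (raddf0 re) mulr0.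
rewrite big_cons; have {ih} := ih (fun z zs => s1 z (mem_behead (s := a :: s) zs)).
have a1 : cabs a <= 1 by apply: s1; rewrite mem_head.
move: (\prod_(z <- s) _) => h /= ih.
rewrite derivM derivXsubC mul1r !(hornerXsubC, hornerD, hornerM).
have -> : w * (h.[w] + (w - a) * h^`().[w]) * ((w - a) * h.[w])^*
   = rc (cabs h.[w] ^+ 2) * (w * (w - a)^*) + rc (cabs (w - a) ^+ 2) * (w * h^`().[w] * h.[w]^*).
  by rewrite -!mulcJ !conjM; ring.
rewrite reD !reMrc cabsM exprMn.
have -> : re (w * (w - a)^*) = 1 - re (w * a^*) by rewrite conjB mulrBr reD reN re_mulcJ w1 expr1n.
have E : cabs (w - a) ^+ 2 = 1 - 2 * re (w * a^*) + cabs a ^+ 2.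
  have : cabs w ^+ 2 = 1 by rewrite w1 expr1n.
  by rewrite !sqr_cabs !reimE => ?; lra.
have aa : cabs a ^+ 2 <= 1 by rewrite exprn_ile1 ?cabs_ge0.
have := ler_wpM2l (sqr_ge0 (cabs (w - a))) ih.
have := mulr_ge0 (sqr_ge0 (cabs h.[w])) (_ : 0 <= 1 - cabs a ^+ 2).
rewrite subr_ge0 => /(_ aa).
rewrite -[(size s).+1]add1n natrD E.
lra.
Qed.

(** The right-hand side is (1 - d) |g|^2 + 2 Re(w g' conj g), and the last term is at least d
    |g|^2. *)
Lemma wronskian_circle_ge d a (s : seq K) g w : size s = d -> cabs w = 1 ->
  (forall z, z \in s -> cabs z <= 1) -> g = a *: \prod_(z <- s) ('X - z%:P) ->
  cabs g.[w] ^+ 2 <= re ((w ^+ d)^* * (W d g).[w]).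
Proof.
move=> sd w1 s1 gE; have /= := circle_log_deriv_ge w1 s1.
have sg : (size g <= d.+1)%N by rewrite gE (leq_trans (size_scale_leq _ _))// size_prod_XsubC sd.
have ww : (w ^+ d)^* * w ^+ d = 1 by rewrite mulrC mulcJ cabsX w1 !expr1n rmorph1.
have WE : (W d g).[w] = w ^+ d * rc ((1 - d%:R) * cabs g.[w] ^+ 2 + 2 * re (w * g^`().[w] * g.[w]^*)).
  have : (W d g).[w] *+ 2 = (B d g g).[w] by rewrite polar_self hornerMn.
  rewrite horner_polar_circle// -mulr_natl => E.
  apply: (@mulfI _ 2); first by rewrite pnatr_eq0.
  rewrite E (rmorphM rc) rmorph_nat mulrCA; congr (_ * (_ * rc _)).
  have -> : (1 - d%:R) * (g.[w] * g.[w]^*) = rc (1 - d%:R) * (g.[w] * g.[w]^*) by rewrite (rmorphB rc) rmorph1 rmorph_nat.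
  by rewrite !reD reMrc re_mulcJ; ring.
rewrite WE mulrA ww mul1r re_rc sd gE hornerZ derivZ hornerZ cabsM.
set h := \prod_(z <- s) _ => H.
have -> : w * (a * h^`().[w]) * (a * h.[w])^* = rc (cabs a ^+ 2) * (w * h^`().[w] * h.[w]^*).
  by rewrite -mulcJ conjM; ring.
rewrite reMrc exprMn.
have := ler_wpM2l (sqr_ge0 (cabs a)) H; lra.
Qed.

(** Nonvanishing of [star d g] on a compact disk survives perturbation, which makes disk-rootedness
    an open condition. The value at 0 controls the degree, and a root z outside the open disk would
    give the zero 1 / conj z. *)
Lemma disk_rooted_of_star d g : (size g <= d.+1)%N ->
  (forall z, cabs z <= 1 -> (star d g).[z] != 0) -> disk_rooted d g.
Proof.
move=> sg gs; have [r gE] := closed_field_poly_normal g.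
have gd : g`_d != 0 by have := gs 0; rewrite star0 conjC_eq0 cabs0; apply; exact: ler01.
have sg' : size g = d.+1.
  by apply/eqP; rewrite eqn_leq sg ltnNge; apply: contra gd => /(nth_default 0) ->.
have g0 : lead_coef g != 0 by rewrite lead_coef_eq0 -size_poly_eq0 sg'.
exists (lead_coef g), r; split=> //.
  by move: sg'; rewrite {1}gE size_scale// size_prod_XsubC => -[].
move=> z zr; rewrite ltNge; apply/negP => z1.
have z0 : z != 0 by rewrite -cabs_gt0 (lt_le_trans ltr01).
have := gs (z^*)^-1; rewrite cabsV cabsJ invf_le1 ?(lt_le_trans ltr01 z1)// => /(_ z1)/negP; apply.
rewrite horner_star ?invr_eq0 ?conjC_eq0// conjV conjCK invrK gE hornerZ.
by have /rootP -> := etrans (root_prod_XsubC r z) zr; rewrite mulr0 conj0 mulr0.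
Qed.

Lemma disk_rooted_near d g0 : disk_rooted d g0 -> exists2 r : R, 0 < r &
  forall g, (size g <= d.+1)%N -> (forall k, (k <= d)%N -> cabs (g`_k - g0`_k) < r) ->
  disk_rooted d g.
Proof.
move=> dg0; have [c c0 cb] := star_disk_lb dg0; have d0 : 0 < d.+1%:R :> R by rewrite ltr0n.
exists (c / d.+1%:R); first by rewrite divr_gt0.
move=> g sg gg0; apply: disk_rooted_of_star => // z z1.
rewrite -cabs_gt0; have := cb z z1; have := cabs_dist (star d g0).[z] (star d g).[z].
suff : cabs ((star d g0).[z] - (star d g).[z]) < c by lra.
rewrite -hornerN -hornerD -starB horner_poly (le_lt_trans (cabs_sum _ _ _))//.
have -> : c = \sum_(i < d.+1) (c / d.+1%:R) by rewrite sumr_const card_ord -(mulr_natr (c / d.+1%:R)) divfK// gt_eqF.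
apply: ltr_sum => [|i _]; first by apply/hasP; exists ord0; rewrite ?mem_index_enum.
rewrite cabsM cabsJ cabsX -cabsN coefB opprB (le_lt_trans _ (gg0 _ (leq_subr i d)))//.
by rewrite ler_piMr ?cabs_ge0// exprn_ile1// cabs_ge0.
Qed.

(* The descent direction is a Newton step: [wronskian_polar_surj] solves the linearized equation. *)
Lemma residual_descent d P g : disk_rooted d g -> re g.[1] != 0 ->
  star (d + d) P = P -> 0 < residual d P g ->
  exists h, (size h <= d.+1)%N /\ exists2 s0 : R, 0 < s0 &
    forall s : R, 0 < s < s0 -> residual d P (g - rc s *: h) < residual d P g.
Proof.
move=> dg g1 sP F0; have sg := disk_rooted_sizeW dg.
have sD : star (d + d) (W d g - P) = W d g - P by rewrite starB star_wronskian// sP.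
have [h [sh hB h1]] := wronskian_polar_surj (im g.[1]) dg g1 sD.
exists h; split=> //.
pose a k := (W d g - P)`_k; pose b k := (W d h)`_k.
pose X := \sum_(k < d.+1) cabs (a k) ^+ 2.
pose Y := \sum_(k < d.+1) re (a k * (b k)^*).
pose Z := \sum_(k < d.+1) cabs (b k) ^+ 2.
have FE (s : R) : residual d P (g - rc s *: h) =
    (1 - s) ^+ 2 * residual d P g + 2 * s ^+ 2 * (1 - s) * Y + s ^+ 4 * Z.
  have sgh : (size (g - rc s *: h)%R <= d.+1)%N.
    by rewrite (leq_trans (size_polyD _ _))// geq_max sg size_polyN (leq_trans (size_scale_leq _ _)).
  have SE : \sum_(k < d.+1) cabs (W d (g - rc s *: h) - P)`_k ^+ 2 =
      (1 - s) ^+ 2 * X + 2 * s ^+ 2 * (1 - s) * Y + s ^+ 4 * Z.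
    rewrite /X /Y /Z !mulr_sumr -!big_split /=; apply: eq_bigr => k _.
    (* Since B g h agrees with W g - P in these coefficients, the step scales the defect by 1 - s,
       up to the quadratic term s^2 W h. *)
    have -> : (W d (g - rc s *: h) - P)`_k = rc (1 - s) * a k + rc (s ^+ 2) * b k.
      rewrite -scaleNr -rmorphN wronskianD wronskian_polarZr wronskianZ cabs_rc real_normK ?num_real// sqrrN.
      have := hB k (ltn_ord k); rewrite /a /b.
      move: (W d g) (W d h) (B d g h) => u v t; rewrite !coefB !coefD !coefZ => ->.
      by rewrite (rmorphB rc) rmorphN rmorph1 /=; ring.
    by rewrite !sqr_cabs !reimE !re_rc !im_rc; ring.
  rewrite /residual SE !sum_coef_horner1// hornerD hornerN hornerZ imD imN imMrc h1 -/X.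
  by ring.
(* For s <= 1 the residual F changes by at most - 2 s F + s^2 M, which is negative as soon as s M <
   F. *)
pose M := residual d P g + 2 * `|Y| + Z.
have Z0 : 0 <= Z by apply: sumr_ge0 => k _; exact: sqr_ge0.
have M0 : 0 < M by rewrite /M -addrA ltr_pwDl// addr_ge0// mulr_ge0.
exists (Num.min 1 (residual d P g / M)); first by rewrite lt_min ltr01 divr_gt0.
move=> s; rewrite lt_min ltr_pdivlMr// => /andP[s0 /andP[s1 sM]].
rewrite FE -subr_gt0; have Y1 := ler_norm Y.
move: sM; rewrite /M; move: (residual d P g) F0 => F F0 sM.
have : s * (s * (F + 2 * `|Y| + Z)) < s * F by rewrite ltr_pM2l.
have : s ^+ 2 * (1 - s) * Y <= s ^+ 2 * `|Y|.
  have : s ^+ 2 * (1 - s) * Y <= s ^+ 2 * (1 - s) * `|Y| by rewrite ler_wpM2l// mulr_ge0 ?sqr_ge0// subr_ge0 ltW.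
  move/le_trans; apply; rewrite ler_wpM2r// ler_piMr ?sqr_ge0//; lra.
have : s ^+ 4 * Z <= s ^+ 2 * Z.
  rewrite ler_wpM2r// -[4%N]/(2 + 2)%N exprD ler_piMr ?sqr_ge0// exprn_ile1// ltW//.
nra.
Qed.

Definition solvable d P := exists g, [/\ disk_rooted d g, im g.[1] = 0 & W d g = P].

End BlaschkeExistence.

(** * Openness of the set of solvable parameters *)

Section ContinuityMethod.
Variable R : realType.
Local Notation K := (C R).
Implicit Types (g h P V : {poly K}) (d : nat) (a z w : K).
Local Notation W := blaschke_wronskian.

Lemma compact_min (T : topologicalType) (A : set T) (f : T -> R) :
  A !=set0 -> compact A -> (forall x, A x -> {for x, continuous f}) ->
  exists2 x, A x & forall y, A y -> f x <= f y.
Proof.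
move=> A0 cA fc; have [|x xA xm] := @compact_EVT_min T R f A A0 cA.
  by apply/continuous_in_subspaceT => x; rewrite inE; exact: fc.
by exists x => [|y yA]; [rewrite inE in xA|apply: xm; rewrite inE].
Qed.

(** This is |a - b|^2 >= |a|^2 / 2 - |b|^2 in each coefficient; it carries a lower bound for the
    residual over to a nearby right-hand side. *)
Lemma residual_shift_lb d P V g (t : R) :
  residual d P g / 2 - t ^+ 2 * (\sum_(k < d.+1) cabs V`_k ^+ 2) <= residual d (P + rc t *: V) g.
Proof.
rewrite /residual mulrDl mulr_suml mulr_sumr -addrA addrCA addrC lerD//.
  rewrite -sumrB ler_sum// => k _.
  have -> : (W d g - (P + rc t *: V))`_k = (W d g - P)`_k - rc t * V`_k.
    by rewrite opprD addrA [LHS]coefB coefZ.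
  move: (_`_k) (V`_k) => a b; rewrite !sqr_cabs !(reD, imD, reN, imN, reMrc, imMrc).
  have := sqr_ge0 (re a - 2 * (t * re b)); have := sqr_ge0 (im a - 2 * (t * im b)); lra.
by have := sqr_ge0 (im (\sum_(k < d.+1) g`_k)); lra.
Qed.

(* On a small sphere around a solution the residual is bounded below, so for nearby right-hand sides
   its minimum over the ball is interior and [residual_descent] forces it to vanish. *)
Lemma solvable_open d P V : star (d + d) P = P -> star (d + d) V = V -> solvable d P ->
  exists2 e : R, 0 < e & forall t : R, `|t| < e -> solvable d (P + rc t *: V).
Proof.
move=> sP sV [g0 [dg0 g01 Wg0]]; have sg0 := disk_rooted_sizeW dg0.
have [r1 r10 near_rooted] := disk_rooted_near dg0.
have g0re : re g0.[1] != 0.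
  apply: contra (disk_rooted_horner1 dg0) => /eqP r0.
  by apply/eqP; apply: complex_ext; rewrite ?r0 ?g01 raddf0.
pose n : R := d.+1%:R; have n0 : 0 < n by rewrite ltr0n.
pose x0 : 'rV[K]_d.+1 := poly_rV g0.
have x0E : rVpoly x0 = g0 by rewrite poly_rV_K.
pose nsq (x : 'rV[K]_d.+1) : R := \sum_i cabs (x 0 i - x0 0 i) ^+ 2.
pose m0 : R := \sum_i cabs (x0 0 i) ^+ 2.
have m00 : 0 < m0.
  rewrite lt_def sumr_ge0 ?andbT; last by move=> i _; exact: sqr_ge0.
  rewrite psumr_eq0; last by move=> i _; exact: sqr_ge0.
  apply/negP => /allP H; move: (disk_rooted_horner1 dg0); rewrite -x0E.
  suff -> : x0 = 0 by rewrite raddf0 horner0 eqxx.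
  apply/rowP => i; rewrite [RHS]mxE; have := H i (mem_index_enum _).
  by rewrite sqrf_eq0 cabs_eq0 => /eqP.
(* In the ball of radius r < mn, [r1] keeps the roots in the disk and the second entry keeps re g(1)
   nonzero. The bounds 1 and [m0] give r^2 < 4 m0, the squared distance from g0 to - g0. *)
pose mn := Num.min r1 (Num.min (`|re g0.[1]| / n) (Num.min 1 m0)).
have mn0 : 0 < mn by rewrite !lt_min r10 ltr01 m00 divr_gt0// normr_gt0.
pose r := mn / 2; have r0 : 0 < r by rewrite divr_gt0.
have : r < mn by rewrite /r; lra.
rewrite /mn !lt_min ltr_pdivlMr// => /andP[rr1 /andP[rre /andP[r_1 rm0]]].
have coord x i : nsq x <= r ^+ 2 -> cabs (x 0 i - x0 0 i) <= r.
  move=> xr; rewrite -ler_sqr ?nnegrE ?cabs_ge0 ?(ltW r0)// (le_trans _ xr)// /nsq (bigD1 i)//= lerDl.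
  by apply: sumr_ge0 => j _; exact: sqr_ge0.
have gx_coef x k : nsq x <= r ^+ 2 -> (k <= d)%N -> cabs ((rVpoly x)`_k - g0`_k) <= r.
  move=> xr kd; have := coord x (inord k) xr.
  by rewrite -x0E -!coef_rVpoly_ord inordK.
have sgx (x : 'rV[K]_d.+1) : (size (rVpoly x) <= d.+1)%N by exact: size_poly.
have gx_rooted x : nsq x <= r ^+ 2 -> disk_rooted d (rVpoly x).
  by move=> xr; apply: near_rooted => // k kd; rewrite (le_lt_trans (gx_coef _ _ xr kd)).
have gx_re x : nsq x <= r ^+ 2 -> re (rVpoly x).[1] != 0.
  move=> xr; apply/eqP => gx0; suff : `|re g0.[1]| <= r * n by rewrite leNgt rre.
  rewrite -normrN -[- _]add0r -gx0 -reN -reD (le_trans (ler_re _))//.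
  rewrite -(sum_coef_horner1 (sgx x)) -(sum_coef_horner1 sg0) -sumrB (le_trans (cabs_sum _ _ _))//.
  have -> : r * n = \sum_(k < d.+1) r by rewrite sumr_const card_ord -mulr_natr.
  by apply: ler_sum => k _; apply: gx_coef => //; rewrite -ltnS.
have nsq_cont x : {for x, continuous nsq}.
  apply: continuous_sum_seq => i.
  have c1 := @continuous_coord R _ i x; have c2 := @continuous_cst R _ (x0 0 i) x.
  exact: (continuous_sq_cabs (continuousB c1 c2)).
have res_cont Q x : {for x, continuous (fun y : 'rV[K]_d.+1 => residual d Q (rVpoly y))}.
  by apply: continuous_residual; exact: ccoef_rVpoly.
pose poly_disc := [set x : 'rV[K]_d.+1 | forall i, [set z : K | cabs (z - x0 0 i) <= r] (x 0 i)].
have cD : compact poly_disc.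
  exact: (@rV_compact K _ (fun i => [set z : K | cabs (z - x0 0 i) <= r])
    (fun i => @compact_cabs_ball R (x0 0 i) r)).
have cBall : compact [set x | nsq x <= r ^+ 2].
  apply: subclosed_compact cD _ => [|x xr i]; last exact: coord.
  by apply: (@preimage_closed _ _ nsq [set y | y <= r ^+ 2]); [move=> x _; exact: nsq_cont|exact: closed_le].
have cSph : compact [set x | nsq x = r ^+ 2].
  apply: subclosed_compact cD _ => [|x xr i]; last by apply: coord; rewrite xr.
  by apply: (@preimage_closed _ _ nsq [set y | y = r ^+ 2]); [move=> x _; exact: nsq_cont|exact: closed_eq].
have nsq0 : nsq x0 = 0 by apply: big1 => i _; rewrite subrr cabs0 expr0n.
(* A zero of the residual on the sphere would be g0 or - g0 by uniqueness, and neither lies at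
   distance r from g0. For an empty sphere any bound serves. *)
have [de de0 Sde] : exists2 de : R, 0 < de & forall x, nsq x = r ^+ 2 -> de <= residual d P (rVpoly x).
  have [[x1 x1S]|Sph0] := pselect ([set x | nsq x = r ^+ 2] !=set0); last first.
    by exists 1 => // x xS; case: Sph0; exists x.
  have [|x xS xm] := compact_min (ex_intro _ x1 x1S) cSph (f := fun x : 'rV[K]_d.+1 => residual d P (rVpoly x)).
    by move=> x _; exact: res_cont.
  exists (residual d P (rVpoly x)); last by move=> y yS; apply: xm.
  rewrite lt_def residual_ge0 andbT; apply/eqP => res0.
  have [Wx x1r] := residual_eq0 (sgx x) sP res0.
  have xr : nsq x <= r ^+ 2 by rewrite xS.
  have r2 : r ^+ 2 < 4 * m0.
    have : r ^+ 2 <= r by rewrite expr2 ler_piMl// ltW.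
    by move=> /le_lt_trans; apply; lra.
  have [xE|xE] := blaschke_wronskian_inj dg0 (gx_rooted _ xr) g01 x1r (etrans Wg0 (esym Wx)).
    have xx0 : x = x0 by rewrite -[x]rVpolyK xE.
    by move: xS; rewrite /= xx0 nsq0 => /esym/eqP; rewrite expf_eq0 /= gt_eqF.
  have xx0 : x = - x0 by rewrite -[x]rVpolyK xE -x0E -raddfN rVpolyK.
  move: xS r2; rewrite /= => <-; rewrite xx0 /nsq /m0 mulr_sumr => /lt_geF/negP; apply.
  apply: ler_sum => i _; rewrite [(- x0) 0 i]mxE -opprD cabsN.
  have -> : x0 0 i + x0 0 i = rc 2 * x0 0 i by rewrite rmorph_nat; ring.
  by rewrite cabsM cabs_rc gtr0_norm// exprMn -natrX.
pose v := \sum_(k < d.+1) cabs V`_k ^+ 2.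
have v0 : 0 <= v by apply: sumr_ge0 => k _; exact: sqr_ge0.
(* This gives t^2 v < de / 8, so the value at the center, at most t^2 v, is below the bound de / 2 -
   t^2 v valid on the sphere. *)
have dv0 : 0 < de / (8 * (v + 1)) by rewrite divr_gt0 ?mulr_gt0 ?ltr_wpDl.
exists (Num.min 1 (de / (8 * (v + 1)))); first by rewrite lt_min ltr01.
move=> t; rewrite lt_min => /andP[t1]; rewrite ltr_pdivlMr; last by rewrite mulr_gt0 ?ltr_wpDl.
move=> tv; pose Q := P + rc t *: V.
have t2 : t ^+ 2 * v < de / 8.
  have : t ^+ 2 <= `|t| by rewrite -real_normK ?num_real// expr2 ler_piMr// ltW.
  have := normr_ge0 t; nra.
have Ball0 : [set x | nsq x <= r ^+ 2] !=set0 by exists x0; rewrite /= nsq0 sqr_ge0.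
have [|x xr xm] := compact_min Ball0 cBall (f := fun x : 'rV[K]_d.+1 => residual d Q (rVpoly x)).
  by move=> x _; exact: res_cont.
have Qx : residual d Q (rVpoly x) <= t ^+ 2 * v.
  apply: (@le_trans _ _ (residual d Q (rVpoly x0))).
    by apply: xm; rewrite /= nsq0 sqr_ge0.
  rewrite x0E residual_solution// Wg0 /v mulr_sumr ler_sum// => k _.
  by rewrite /Q opprD addNKr -scaleNr coefZ cabsM exprMn -rmorphN cabs_rc real_normK ?num_real// sqrrN.
have xr' : nsq x < r ^+ 2.
  rewrite lt_neqAle; apply/andP; split; last exact: xr.
  apply/eqP => /Sde de_x; have := residual_shift_lb d P V (rVpoly x) t; rewrite -/v -/Q; lra.
have sQ : star (d + d) Q = Q by rewrite starD starZ conj_rc sP sV.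
have [res0|/eqP resn0] := eqVneq (residual d Q (rVpoly x)) 0.
  by have [Wx x1r] := residual_eq0 (sgx x) sQ res0; exists (rVpoly x); split=> //; apply: gx_rooted.
have res_gt0 : 0 < residual d Q (rVpoly x) by rewrite lt_def residual_ge0 andbT; apply/eqP.
have [h [sh [s0 s00 desc]]] := residual_descent (gx_rooted _ xr) (gx_re _ xr) sQ res_gt0.
pose y : 'rV[K]_d.+1 := poly_rV h.
(* For s < 1 the step increases the squared distance to g0 by at most s A, so a small step from an
   interior point stays in the ball. *)
pose A := \sum_i (2 * cabs (x 0 i - x0 0 i) * cabs (y 0 i) + cabs (y 0 i) ^+ 2).
have A0 : 0 <= A by apply: sumr_ge0 => i _; rewrite addr_ge0 ?sqr_ge0// !mulr_ge0// cabs_ge0.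
pose mns := Num.min s0 (Num.min 1 ((r ^+ 2 - nsq x) / (A + 1))).
have mns0 : 0 < mns by rewrite !lt_min s00 ltr01 divr_gt0 ?subr_gt0// ltr_wpDl.
pose s := mns / 2; have s_gt0 : 0 < s by rewrite divr_gt0.
have : s < mns by rewrite /s; lra.
have A1 : 0 < A + 1 by rewrite ltr_wpDl.
rewrite /mns !lt_min ltr_pdivlMr// => /andP[ss0 /andP[s1 sA]].
have yE : rVpoly (x - rc s *: y) = rVpoly x - rc s *: h by rewrite linearB linearZ /= poly_rV_K.
have := desc s; rewrite s_gt0 ss0 => /(_ isT); rewrite -yE ltNge => /negP[].
apply: xm => /=; apply: (@le_trans _ _ (nsq x + s * A)); last first.
  have : s * A <= s * (A + 1) by rewrite ler_wpM2l ?ltW// ltrDl.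
  by move: sA; lra.
rewrite /nsq /A mulr_sumr -big_split ler_sum// => i _ /=.
have -> : (x - rc s *: y) 0 i = x 0 i - rc s * y 0 i.
  by rewrite [LHS]mxE; congr (_ + _); rewrite [LHS]mxE; congr (- _); rewrite [LHS]mxE.
move: (x 0 i) (x0 0 i) (y 0 i) => a b c.
have -> : a - rc s * c - b = (a - b) - rc s * c by ring.
have := cabs_triB (a - b) (rc s * c); rewrite cabsM cabs_rc gtr0_norm// => H.
have := cabs_ge0 (a - b); have := cabs_ge0 c; have := cabs_ge0 (a - b - rc s * c) => h1 h2 h3.
apply: (@le_trans _ _ ((cabs (a - b) + s * cabs c) ^+ 2)).
  by rewrite lerXn2r ?nnegrE// (le_trans h1).
have : s * (s * cabs c ^+ 2) <= s * (1 * cabs c ^+ 2).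
  by rewrite ler_wpM2l ?(ltW s_gt0)// ler_wpM2r ?sqr_ge0// ltW.
nra.
Qed.

End ContinuityMethod.

(** * Closedness, and the path to the prescribed critical points *)

Section CriticalPointRealization.
Variable R : realType.
Local Notation K := (C R).
Implicit Types (g h P V : {poly K}) (d : nat) (a z w : K).
Local Notation W := blaschke_wronskian.

(** The modulus of the leading coefficient is |star d g| at 0, and on the circle |star d g| = |g| is
    controlled by the Wronskian: the maximum principle gives the a priori bound that compactness
    needs. *)
Lemma disk_rooted_lead_bound d a (s : seq K) g (A : R) : 0 <= A -> size s = d ->
  (forall z, z \in s -> cabs z < 1) -> g = a *: \prod_(z <- s) ('X - z%:P) ->
  (forall w, cabs w = 1 -> re ((w ^+ d)^* * (W d g).[w]) <= A ^+ 2) -> cabs a <= A.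
Proof.
move=> A0 sd s1 gE WA.
have sg : (size g <= d.+1)%N by rewrite gE (leq_trans (size_scale_leq _ _))// size_prod_XsubC sd.
have : cabs (star d g).[0] <= A.
  apply: (@max_modulus R (horner (star d g)) 1 A) => //; last by rewrite cabs0 ler01.
  - by move=> z _; exact: continuous_horner_num.
  - by move=> z _ _; have [c jc] := jet_horner (star d g) z; do 3 eexists; exact: jc.
  - move=> w w1; rewrite horner_star_circle// cabsM cabsX w1 expr1n mul1r cabsJ.
    rewrite -ler_sqr ?nnegrE ?cabs_ge0//; apply: le_trans (WA w w1).
    by apply: (wronskian_circle_ge sd w1 _ gE) => z /s1/ltW.
rewrite (horner_star_disk_rooted sd gE) big1 ?mulr1 ?cabsJ// => b _.
by rewrite mulr0 subr0.
Qed.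

(** For self-reciprocal polynomials of formal degree 2 d these values are real. Positivity rules out
    zeros of the Wronskian on the circle along the whole segment. *)
Definition path_positive d P V := forall (t : R) w, 0 <= t <= 1 -> cabs w = 1 ->
  0 < re ((w ^+ d)^* * (P + rc t *: V).[w]).

(* The limit is taken in the leading coefficient and the roots. A root of the limit on the unit circle
   would also be a root of its reciprocal, hence of the Wronskian, against [path_positive]. *)
Lemma solvable_closed d P V (t0 : R) : star (d + d) P = P -> star (d + d) V = V ->
  path_positive d P V -> 0 <= t0 <= 1 ->
  (forall e : R, 0 < e -> exists t : R,
    [/\ 0 <= t <= 1, `|t - t0| < e & solvable d (P + rc t *: V)]) ->
  solvable d (P + rc t0 *: V).
Proof.
move=> sP sV pos t01 near_t0.
have [mP mP0 bP] := horner_bounded P 1; have [mV mV0 bV] := horner_bounded V 1.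
(* A^2 exceeds mP + mV, which bounds the whole path on the circle; [A] then bounds the leading
   coefficients. *)
pose A := mP + mV + 1.
have A0 : 0 <= A by rewrite /A !addr_ge0// ltW.
have AA : mP + mV <= A ^+ 2 by rewrite /A; nra.
have pathA t w : 0 <= t <= 1 -> cabs w = 1 -> re ((w ^+ d)^* * (P + rc t *: V).[w]) <= A ^+ 2.
  move=> /andP[tge tle] w1; apply: le_trans AA; rewrite (le_trans (re_le_cabs _))//.
  rewrite cabsM cabsJ cabsX w1 expr1n mul1r hornerD hornerZ (le_trans (cabsD _ _))//.
  rewrite lerD ?bP ?w1// cabsM cabs_rc ger0_norm// (le_trans (ler_piMl _ tle)) ?cabs_ge0//.
  by rewrite bV// w1.
pose Q := P + rc t0 *: V.
have sQ : star (d + d) Q = Q by rewrite starD starZ conj_rc sP sV.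
(* Coordinate 0 is the leading coefficient and the others are the roots, so the candidates fill a
   compact polydisc. *)
pose G (y : 'rV[K]_d.+1) := (y 0 ord0)%:P * \prod_(j < d) ('X - (y 0 (lift ord0 j))%:P).
pose D (i : 'I_d.+1) : set K := [set z | cabs (z - 0) <= if i == ord0 then A else 1].
pose D' := [set y : 'rV[K]_d.+1 | forall i, D i (y 0 i)].
have cD : compact D'.
  by apply: (@rV_compact K _ D) => i; exact: compact_cabs_ball.
have D0 : D' !=set0.
  exists 0 => i; rewrite /D /= mxE subrr cabs0; case: ifP => _ //; exact: ler01.
have GE (y : 'rV[K]_d.+1) : G y = y 0 ord0 *: \prod_(z <- [seq y 0 (lift ord0 j) | j <- enum 'I_d]) ('X - z%:P).
  by rewrite /G mul_polyC big_map big_enum.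
have sGE (y : 'rV[K]_d.+1) : size [seq y 0 (lift ord0 j) | j <- enum 'I_d] = d.
  by rewrite size_map size_enum_ord.
have sG y : (size (G y) <= d.+1)%N.
  by rewrite GE (leq_trans (size_scale_leq _ _))// size_prod_XsubC sGE.
have cG y : ccoef G y.
  apply: ccoefM; first by apply: ccoefC; exact: continuous_coord.
  apply: (@ccoef_prod R _ y 'I_d _ (fun j y => 'X - (y 0 (lift ord0 j))%:P)) => j.
  apply: ccoefD; first exact: ccoef_cst.
  by apply: ccoefN; apply: ccoefC; exact: continuous_coord.
have [|y yD ym] := compact_min D0 cD (f := fun y : 'rV[K]_d.+1 => residual d Q (G y)).
  by move=> y _; apply: continuous_residual; exact: cG.
pose v := \sum_(k < d.+1) cabs V`_k ^+ 2.
have v0 : 0 <= v by apply: sumr_ge0 => k _; exact: sqr_ge0.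
(* A solution at parameter [t] has residual (t - t0)^2 v with respect to [Q], so the minimum over
   the polydisc is 0. *)
have res0 : residual d Q (G y) = 0.
  apply/eqP; rewrite eq_le residual_ge0 andbT leNgt; apply/negP => mu0.
  have v1 : 0 < v + 1 by rewrite ltr_wpDl.
  have e0 : 0 < Num.min 1 (residual d Q (G y) / (v + 1)) by rewrite lt_min ltr01 divr_gt0.
  have [t [tt tt0 [g [[a [s [a0 sd s1 gE]]] g1 Wg]]]] := near_t0 _ e0.
  pose x : 'rV[K]_d.+1 := \row_i (if i == ord0 then a else s`_i.-1).
  have GxE : G x = g.
    rewrite /G gE mul_polyC mxE eqxx; congr (_ *: _).
    rewrite (big_nth 0) big_mkord sd; apply: eq_bigr => j _.
    by rewrite mxE.
  have xD : D' x.
    move=> i; rewrite /D /= mxE subr0; case: eqP => [_|/eqP i0].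
      apply: (disk_rooted_lead_bound A0 sd s1 gE) => w w1.
      by rewrite Wg; exact: pathA.
    apply/ltW/s1/mem_nth; rewrite sd; move: i0 (ltn_ord i); rewrite -val_eqE /=.
    by case: (nat_of_ord i).
  have := ym x xD; rewrite leNgt => /negP; apply.
  have sg : (size g <= d.+1)%N by rewrite -GxE.
  rewrite GxE residual_solution// Wg.
  have -> : \sum_(k < d.+1) cabs (P + rc t *: V - Q)`_k ^+ 2 = (t - t0) ^+ 2 * v.
    rewrite /v mulr_sumr; apply: eq_bigr => k _.
    rewrite /Q opprD addrACA subrr add0r -scalerBl -rmorphB coefZ cabsM exprMn cabs_rc.
    by rewrite real_normK ?num_real.
  move: tt0; rewrite lt_min ltr_pdivlMr// => /andP[n1 nv].
  have : (t - t0) ^+ 2 <= `|t - t0| by rewrite -real_normK ?num_real// expr2 ler_piMr// ltW.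
  have := normr_ge0 (t - t0); nra.
have [WG G1] := residual_eq0 (sG y) sQ res0.
exists (G y); split=> //.
have y0 : y 0 ord0 != 0.
  apply/eqP => y0; have := pos t0 1 t01 (@cabs1 R).
  by rewrite -/Q -WG GE y0 scale0r /W mulr0 deriv0 !mul0r subr0 horner0 mulr0 raddf0 ltxx.
exists (y 0 ord0), [seq y 0 (lift ord0 j) | j <- enum 'I_d]; split=> // z zs; have /mapP[j _ zE] := zs.
have zle : cabs z <= 1 by have := yD (lift ord0 j); rewrite /D /= subr0 -zE.
rewrite lt_neqAle zle andbT; apply/eqP => z1.
have := pos t0 z t01 z1; rewrite -/Q -WG.
have Gz : (G y).[z] = 0.
  by rewrite GE horner_disk_rooted (big_rem z)//= subrr mul0r mulr0.
rewrite horner_W horner_star_circle// Gz conj0 !mulr0 mul0r subrr mulr0 raddf0 ltxx//.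
Qed.

(** Connectedness of [0, 1] through a supremum: closedness puts it in the set, and openness passes
    beyond it unless it is 1. *)
Lemma solvable_path d P V : star (d + d) P = P -> star (d + d) V = V ->
  path_positive d P V -> solvable d P -> solvable d (P + V).
Proof.
move=> sP sV pos solP.
pose E := [set t : R | 0 <= t <= 1 /\ solvable d (P + rc t *: V)].
have E0 : E 0 by split; rewrite ?lexx ?ler01// rmorph0 scale0r addr0.
have hE : has_sup E.
  by split; [exists 0|exists 1 => t [/andP[]]].
pose t0 := sup E.
have t0ub t : E t -> t <= t0 by exact: sup_upper_bound.
have t01 : 0 <= t0 <= 1.
  by rewrite t0ub//= ge_sup//; [exists 0|move=> t [/andP[]]].
have sol0 : solvable d (P + rc t0 *: V).
  apply: solvable_closed => // e e0.
  have [t Et et] := sup_adherent e0 hE; exists t; have [tt tsol] := Et; split=> //.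
  by rewrite ler0_norm ?subr_le0 ?t0ub// opprB ltrBlDr -ltrBlDl.
have [t01'|t01'] := eqVneq t0 1; first by move: sol0; rewrite t01' rmorph1 scale1r.
have sQ : star (d + d) (P + rc t0 *: V) = P + rc t0 *: V by rewrite starD starZ conj_rc sP sV.
have [e e0 He] := solvable_open sQ sV sol0.
have t0lt : t0 < 1 by rewrite lt_neqAle t01'; case/andP: t01.
pose s := Num.min e (1 - t0) / 2.
have mn0 : 0 < Num.min e (1 - t0) by rewrite lt_min e0 subr_gt0.
have s0 : 0 < s by rewrite divr_gt0.
have : s < Num.min e (1 - t0) by rewrite /s; lra.
rewrite lt_min => /andP[se s1].
have : E (t0 + s).
  split; last by rewrite rmorphD scalerDl addrA; apply: He; rewrite gtr0_norm.
  by case/andP: t01 => ? ?; apply/andP; split; lra.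
by move/t0ub; rewrite gerDl leNgt s0.
Qed.

Lemma blaschke_wronskian_surj d (s : seq K) : size s = d -> (forall z, z \in s -> cabs z < 1) ->
  let c := \prod_(z <- s) ('X - z%:P) in
  exists g, [/\ disk_rooted d g, im g.[1] = 0 & W d g = c * star d c].
Proof.
move=> sd s1 c; have sc : (size c <= d.+1)%N by rewrite size_prod_XsubC sd.
have starX : star d ('X^d : {poly K}) = 1.
  apply/polyP => i; rewrite coef_star coefXn coef1; case: i => [|i] /=.
    by rewrite subn0 eqxx conj1.
  by case: leqP => // id; rewrite (_ : (d - i.+1 == d)%N = false) ?conj0//; lia.
have star1 : star d (1 : {poly K}) = 'X^d by rewrite -starX starK// size_polyXn.
pose P : {poly K} := d.+1%:R *: 'X^d.
have sP : star (d + d) P = P.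
  by rewrite /P starZ conj_nat -[X in star _ X]mulr1 starM ?size_polyXn ?size_poly1// starX star1 mul1r.
have scc : star (d + d) (c * star d c) = c * star d c.
  by rewrite starM ?size_star// starK// mulrC.
have WX : W d 'X^d = P.
  rewrite /W starX derivC mulr0 subr0 mulr1 -exprS derivXn /P -scaler_nat.
  by rewrite -mulr_natl.
have := @solvable_path d P (c * star d c - P) sP; rewrite starB scc sP (addrC P (_ - _)) subrK; apply=> //.
  (* After multiplication by conj(w^d) the ends of the segment take the values d + 1 and |c(w)|^2 on
     the circle, both positive, and so do their convex combinations. *)
  move=> t w /andP[t0 t1] w1; rewrite hornerD (hornerZ (rc t)) hornerD hornerN.
  have wd : (w ^+ d)^* * w ^+ d = 1 by rewrite mulrC mulcJ cabsX w1 !expr1n rmorph1.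
  have Pw : (w ^+ d)^* * P.[w] = d.+1%:R by rewrite /P hornerZ hornerXn mulrCA wd mulr1.
  have cw : (w ^+ d)^* * (c * star d c).[w] = rc (cabs c.[w] ^+ 2).
    by rewrite hornerM horner_star_circle// mulrCA (mulrA (w ^+ d)^*) wd mul1r mulcJ.
  rewrite mulrDr mulrCA mulrBr cw Pw reD reMrc reD reN re_rc.
  have -> : re (d.+1%:R : K) = d.+1%:R by rewrite -(rmorph_nat (@rc R)) re_rc.
  have c0 : 0 < cabs c.[w] ^+ 2.
    rewrite exprn_gt0// cabs_gt0 /c horner_prod prodf_seq_neq0; apply/allP => z zs /=.
    rewrite hornerXsubC subr_eq0; apply: contraTneq (s1 z zs) => <-.
    by rewrite w1 ltxx.
  have d0 : 0 < d.+1%:R :> R by rewrite ltr0n.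
  have [->|tn0] := eqVneq t 0; first by rewrite mul0r addr0.
  have tgt : 0 < t by rewrite lt_def tn0.
  have := mulr_gt0 tgt c0.
  have := mulr_ge0 (ltW d0) (_ : 0 <= 1 - t); rewrite subr_ge0 => /(_ t1).
  lra.
exists 'X^d; split=> //; last by rewrite hornerXn expr1n im1.
exists 1, (nseq d 0); split; rewrite ?oner_eq0 ?size_nseq//.
  by move=> z /nseqP[-> _]; rewrite cabs0 ltr01.
by rewrite scale1r big_nseq subr0 iter_mulr_1.
Qed.

End CriticalPointRealization.

(** * Blaschke products as normalized proper maps *)

Section BlaschkeMap.
Variable R : realType.
Local Notation K := (C R).
Implicit Types (g h p q : {poly K}) (d : nat) (a z w : K) (s : seq K).
Local Notation W := blaschke_wronskian.

Definition blaschke_map d g z : K := z * g.[z] / (star d g).[z].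

Lemma is_derive_quotient p q z : q.[z] != 0 ->
  is_derive z (1 : K) (fun w => p.[w] / q.[w]) ((p^`().[z] * q.[z] - p.[z] * q^`().[z]) / q.[z] ^+ 2).
Proof.
move=> qz.
have [dp pE] := is_derive_horner p z; have [dq qE] := is_derive_horner q z.
have dqV := derivableV qz dq.
have -> : (fun w => p.[w] / q.[w]) = horner p * (fun w => (q.[w])^-1) by [].
split; first exact: (derivableM dp dqV).
rewrite (deriveM dp dqV) (deriveV qz dq) pE qE -![_ *: _]/(_ * _).
by field.
Qed.

Lemma derivable_horner_num p z : derivable (horner p) z (1 : K).
Proof. by case: (is_derive_horner p z). Qed.

Lemma is_derive_blaschke_map d g z : (star d g).[z] != 0 ->
  is_derive z (1 : K) (blaschke_map d g) ((W d g).[z] / (star d g).[z] ^+ 2).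
Proof.
move=> qz; have -> : blaschke_map d g = (fun w => ('X * g).[w] / (star d g).[w]).
  by apply/funext => w; rewrite /blaschke_map hornerM hornerX.
have := is_derive_quotient ('X * g) qz.
by rewrite horner_W hornerM hornerX.
Qed.

Lemma near_horner_neq0 q z : q.[z] != 0 -> \forall w \near z, q.[w] != 0.
Proof.
move=> qz; apply/near_cabs; have q0 : 0 < cabs q.[z] by rewrite cabs_gt0.
have [r r0 rq] := (@continuous_cabsP R (horner q) z).1 (@continuous_horner_num K q z) _ q0.
exists r => // w /rq; apply: contraTneq => ->.
by rewrite sub0r cabsN ltxx.
Qed.

Lemma prod_count s z w : \prod_(b <- s) (w - b) =
  (w - z) ^+ count_mem z s * \prod_(b <- s | b != z) (w - b).
Proof.
elim: s => [|b s ih] /=; first by rewrite !big_nil mulr1.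
rewrite !big_cons ih; case: eqVneq => [->|_] /=; first by rewrite exprS mulrA.
by rewrite add0n mulrCA.
Qed.

Lemma zero_order_prod s (k : K -> K) z : (\forall w \near z, derivable k w 1) -> k z != 0 ->
  zero_order (fun w => (\prod_(b <- s) (w - b)) * k w) z (count_mem z s).
Proof.
move=> dk kz; pose t := \prod_(b <- s | b != z) ('X - b%:P).
have tE w : t.[w] = \prod_(b <- s | b != z) (w - b).
  by rewrite horner_prod; apply: eq_bigr => b _; rewrite hornerXsubC.
exists (horner t * k); split.
- by apply: filterS dk => w dkw; exact: (derivableM (@derivable_horner_num t w) dkw).
- rewrite fctE mulf_neq0// tE prodf_seq_neq0; apply/allP => b _ /=.
  by apply/implyP; rewrite subr_eq0 eq_sym.
- by apply/near_cabs; exists 1 => // w _; rewrite fctE tE mulrA -prod_count.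
Qed.

Lemma zero_order_near (f k : K -> K) z m : (\forall w \near z, f w = k w) ->
  zero_order f z m -> zero_order k z m.
Proof.
move=> fk [h [dh hz fh]]; exists h; split=> //.
by move: fk fh; apply: filterS2 => w -> ->.
Qed.

Lemma near_disk z : disk z -> \forall w \near z, disk w.
Proof.
rewrite diskE => z1; apply/near_cabs; exists (1 - cabs z); first by rewrite subr_gt0.
move=> w wz; rewrite diskE -[w](subrK z) (le_lt_trans (cabsD _ _))//.
by rewrite -ltrBrDr.
Qed.

Section Given.
Variables (d : nat) (g : {poly K}).
Hypothesis dg : disk_rooted d g.
Let q := star d g.
Let f := blaschke_map d g.

Let qn z : cabs z <= 1 -> q.[z] != 0.
Proof. exact: star_disk_neq0. Qed.

Lemma derivable_blaschke_map z : cabs z <= 1 -> derivable f z 1.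
Proof. by move=> /qn qz; case: (is_derive_blaschke_map qz). Qed.

Lemma derive1_blaschke_map z : cabs z <= 1 -> derive1 f z = (W d g).[z] / q.[z] ^+ 2.
Proof. by move=> /qn qz; apply: is_derive1E; exact: is_derive_blaschke_map. Qed.

Lemma blaschke_map_disk z : disk z -> disk (f z).
Proof.
rewrite !diskE => z1; rewrite /f /blaschke_map !cabsM cabsV ltr_pdivrMr ?cabs_gt0 ?qn ?ltW//.
rewrite mul1r; have q0 : 0 < cabs q.[z] by rewrite cabs_gt0 qn// ltW.
apply: le_lt_trans (_ : cabs z * cabs q.[z] < _); last by rewrite gtr_pMl.
by rewrite ler_wpM2l ?cabs_ge0// le_star_disk// ltW.
Qed.

Lemma blaschke_map_circle z : cabs z = 1 -> cabs (f z) = 1.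
Proof.
move=> z1; have qz : q.[z] != 0 by rewrite qn// z1.
have : cabs q.[z] != 0 by rewrite cabs_eq0.
rewrite /f /blaschke_map !cabsM cabsV z1 mul1r.
rewrite horner_star_circle ?(disk_rooted_sizeW dg)// cabsM cabsX z1 expr1n mul1r cabsJ.
by move=> g0; rewrite divff.
Qed.

(** As |f| = 1 on the circle, the preimage of [A] in the open disk is also its preimage in the
    closed disk, where compactness follows from continuity. *)
Lemma blaschke_map_proper (A : set K) : A `<=` @disk R -> compact A ->
  compact (@disk R `&` f @^-1` A).
Proof.
move=> AD cA.
have -> : @disk R `&` f @^-1` A = [set z | cabs z <= 1] `&` f @^-1` A.
  apply/seteqP; split=> z [zD fz]; split=> //.
    by move: zD; rewrite diskE => /ltW.
  rewrite diskE lt_neqAle zD andbT; apply/eqP => /blaschke_map_circle f1.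
  by have := AD _ fz; rewrite diskE f1 ltxx.
have clA : closed A by apply: compact_closed => //; exact: norm_hausdorff.
apply: (subclosed_compact _ (@compact_cabs_le R 1)) => [|z []//].
have clD : closed [set z : K | cabs z <= 1].
  by apply: compact_closed; [exact: norm_hausdorff|exact: compact_cabs_le].
move=> p pcl.
have pD : cabs p <= 1.
  by apply: clD => B pB; have [z [[zD _] zB]] := pcl B pB; exists z.
split=> //; apply: clA => B fB.
have fc : {for p, continuous f} by apply: derivable_continuous; exact: derivable_blaschke_map.
by have [z [[_ fz] zB]] := pcl _ (fc _ fB); exists (f z).
Qed.

(** The zeros of f - w are the roots of X g - w star g, of degree d + 1. None has |z| >= 1, since
    there |z g| >= |g| > |w| |star g|. *)
Lemma blaschke_map_degree : has_degree f d.+1.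
Proof.
move=> w; rewrite diskE => w1; pose P := 'X * g - w *: q.
have sg := disk_rooted_size dg.
have P1 : P`_d.+1 != 0.
  rewrite coefB coefZ coefXM /= coef_star ltnn mulr0 subr0.
  by rewrite -[d]/(d.+1.-1) -sg -lead_coefE lead_coef_eq0 -size_poly_eq0 sg.
have sP : size P = d.+2.
  apply/eqP; rewrite eqn_leq; apply/andP; split.
    rewrite (leq_trans (size_polyD _ _))// geq_max size_polyN (leq_trans (size_scale_leq _ _)) ?(leq_trans (size_star _ _))// andbT.
    by rewrite (leq_trans (size_polyMleq _ _))// size_polyX sg.
  by rewrite ltnNge; apply: contra P1 => /(nth_default 0) ->.
have [r PE] := closed_field_poly_normal P.
have P0 : lead_coef P != 0 by rewrite lead_coef_eq0 -size_poly_eq0 sP.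
have sr : size r == d.+1 by move: sP; rewrite {1}PE size_scale// size_prod_XsubC => -[->].
exists (Tuple sr); split=> /= [z zr|z zD].
  have Pz : P.[z] = 0.
    by have /rootP H := etrans (root_prod_XsubC r z) zr; rewrite PE hornerZ H mulr0.
  rewrite diskE ltNge; apply/negP => z1.
  have gz : g.[z] != 0.
    rewrite -cabs_gt0; case: dg => a [s [a0 _ s1 ->]]; rewrite horner_disk_rooted cabs_gt0.
    rewrite mulf_neq0// prodf_seq_neq0; apply/allP => b bs /=; rewrite subr_eq0.
    by apply: contraTneq (s1 b bs) => <-; rewrite -leNgt.
  have : z * g.[z] = w * q.[z].
    by move/eqP: Pz; rewrite hornerD hornerN hornerZ hornerM hornerX subr_eq0 => /eqP.
  move/(congr1 cabs); rewrite !cabsM => E.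
  have g0 : 0 < cabs g.[z] by rewrite cabs_gt0.
  have : cabs w * cabs q.[z] < 1 * cabs g.[z].
    apply: le_lt_trans (_ : cabs w * cabs g.[z] < _); last by rewrite ltr_pM2r.
    by rewrite ler_wpM2l ?cabs_ge0// ge_star_disk.
  by rewrite -E ltr_pM2r// ltNge z1.
have qz : q.[z] != 0 by rewrite qn//; move: zD; rewrite diskE => /ltW.
have dk : \forall x \near (z : K), derivable (fun y => lead_coef P * (q.[y])^-1) x 1.
  apply: filterS (near_horner_neq0 qz) => x qx.
  have dV := derivableV qx (@derivable_horner_num q x).
  exact: (derivableM (derivable_cst (lead_coef P) x 1) dV).
have kz : lead_coef P * (q.[z])^-1 != 0 by rewrite mulf_neq0// invr_eq0.
have Z := zero_order_prod r dk kz.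
refine (zero_order_near _ Z).
apply: filterS (near_horner_neq0 qz) => x qx.
have -> : \prod_(b <- r) (x - b) * (lead_coef P * (q.[x])^-1) = P.[x] / q.[x].
  by rewrite [in RHS]PE horner_disk_rooted; ring.
rewrite /f /blaschke_map hornerD hornerN hornerZ hornerM hornerX mulrBl mulfK//.
Qed.

Lemma blaschke_map_extension : im g.[1] = 0 -> extension_value f 1 1.
Proof.
move=> g1; exists [set z | q.[z] != 0], f; split=> //.
- rewrite openE => z /= /near_horner_neq0; exact.
- by move=> z; rewrite closed_diskE => /qn.
- by move=> z /= qz; case: (is_derive_blaschke_map qz).
- rewrite /f /blaschke_map mul1r horner_star_circle ?(disk_rooted_sizeW dg) ?cabs1//.
  have -> : g.[1]^* = g.[1] by apply: complex_ext; rewrite ?re_conj ?im_conj ?g1 ?oppr0.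
  by rewrite expr1n mul1r divff// (disk_rooted_horner1 dg).
Qed.

Lemma blaschke_map_critical (s : seq K) : (forall z, z \in s -> cabs z < 1) -> size s = d ->
  W d g = \prod_(z <- s) ('X - z%:P) * star d (\prod_(z <- s) ('X - z%:P)) ->
  critical_points f s.
Proof.
move=> s1 sd WE; split=> [z /s1|z zD]; first by rewrite diskE.
set c := \prod_(z <- s) _ in WE; have sc : star d c = \prod_(b <- s) (1 - b^* *: 'X) by rewrite -sd star_prod.
have z1 : cabs z <= 1 by move: zD; rewrite diskE => /ltW.
have scz : (star d c).[z] != 0.
  rewrite sc horner_prod prodf_seq_neq0; apply/allP => b bs /=.
  by rewrite !hornerE mobius_neq0// s1.
have dk : \forall x \near z, derivable (fun y => (star d c).[y] / (q * q).[y]) x 1.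
  apply: filterS (near_horner_neq0 (qn z1)) => x qx.
  have qqx : (q * q).[x] != 0 by rewrite hornerM mulf_neq0.
  have dV := derivableV qqx (@derivable_horner_num (q * q) x).
  exact: (derivableM (@derivable_horner_num (star d c) x) dV).
have kz : (star d c).[z] / (q * q).[z] != 0.
  by rewrite mulf_neq0// invr_eq0 hornerM mulf_neq0// qn.
have Z := zero_order_prod s dk kz.
refine (zero_order_near _ Z).
apply: filterS (near_disk zD) => x; rewrite diskE => /ltW x1.
rewrite derive1_blaschke_map// WE !hornerM horner_prod -expr2 mulrA; congr (_ * _ / _).
by apply: eq_bigr => b _; rewrite hornerXsubC.
Qed.

Lemma blaschke_map_normalized (c : d.-tuple K) : (forall j, disk (tnth c j)) ->
  im g.[1] = 0 -> W d g = \prod_(z <- c) ('X - z%:P) * star d (\prod_(z <- c) ('X - z%:P)) ->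
  normalized_proper_map c f.
Proof.
move=> cD g1 WE; split.
- split; [|exact: blaschke_map_disk|exact: blaschke_map_proper].
  by move=> z; rewrite diskE => /ltW /derivable_blaschke_map.
- exact: blaschke_map_degree.
- by rewrite /f /blaschke_map !mul0r.
- exact: blaschke_map_extension.
- apply: blaschke_map_critical; rewrite ?size_tuple// => z /tnthP[j ->].
  by have := cD j; rewrite diskE.
Qed.

End Given.

End BlaschkeMap.

(** * Proper maps are Blaschke products *)

Section ComplexMeanValue.
Variable R : realType.
Local Notation K := (C R).
Implicit Types (f u v G : K -> K) (z w h a l : K).

(** The real mean value theorem is applied to the projection of G(z + t h) onto the direction of the
    total increment [th]. *)
Lemma complex_mean_value G (G' : K -> K) z h (M : R) :
  (forall t : R, 0 <= t <= 1 -> is_derive (z + rc t * h) (1 : K) G (G' (z + rc t * h))) ->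
  (forall t : R, 0 <= t <= 1 -> cabs (G' (z + rc t * h)) <= M) ->
  cabs (G (z + h) - G z) <= M * cabs h.
Proof.
move=> dG GM; set th := G (z + h) - G z.
have [->|th0] := eqVneq th 0.
  rewrite cabs0 mulr_ge0 ?cabs_ge0// (le_trans (cabs_ge0 _) (GM 0 _))//.
  by rewrite lexx ler01.
pose phi (t : R) : R := re (th^* * G (z + rc t * h)).
have dphi (t : R) : 0 <= t <= 1 -> is_derive t (1 : R) phi (re (th^* * (G' (z + rc t * h) * h))).
  move=> t01; apply/is_deriveP => e e0.
  have m0 : 0 < cabs th * (cabs h + 1) by rewrite mulr_gt0 ?cabs_gt0// ltr_wpDl ?cabs_ge0.
  have [r r0 Hr] := (is_derive_cabsP _ _ _).1 (dG t t01) (e / (cabs th * (cabs h + 1))) (divr_gt0 e0 m0).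
  have h1 : 0 < cabs h + 1 by rewrite ltr_wpDl ?cabs_ge0.
  apply/nbhs_ballP; exists (r / (cabs h + 1)); first by rewrite /= divr_gt0.
  move=> s; rewrite /ball /= sub0r normrN ltr_pdivlMr// => sr.
  have sh : cabs (rc s * h) < r.
    rewrite cabsM cabs_rc (le_lt_trans _ sr)// ler_wpM2l// lerDl//.
  have := Hr _ sh; rewrite /phi.
  have -> : z + rc (t + s) * h = z + rc t * h + rc s * h by rewrite rmorphD /=; ring.
  have -> : re (th^* * G (z + rc t * h + rc s * h)) - re (th^* * G (z + rc t * h))
      - re (th^* * (G' (z + rc t * h) * h)) * s
    = re (th^* * (G (z + rc t * h + rc s * h) - G (z + rc t * h) - G' (z + rc t * h) * (rc s * h))).
    rewrite -[_ * s]mulrC -reMrc -!reN -!reD; congr re; ring.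
  move=> H; rewrite (le_trans (ler_re _))// cabsM cabsJ.
  rewrite (le_trans (ler_wpM2l (cabs_ge0 _) H))// cabsM cabs_rc.
  rewrite -(ler_pM2r h1).
  have -> : cabs th * (e / (cabs th * (cabs h + 1)) * (`|s| * cabs h)) * (cabs h + 1) = e * `|s| * cabs h.
    by field; rewrite !gt_eqF ?cabs_gt0.
  by rewrite ler_wpM2l ?lerDl// mulr_ge0// ltW.
have [c c01 E] : exists2 c, c \in `[0, 1]%R &
    phi 1 - phi 0 = re (th^* * (G' (z + rc c * h) * h)) * (1 - 0).
  apply: (@MVT_segment R phi (fun c => re (th^* * (G' (z + rc c * h) * h)))) => // [x|].
    by rewrite in_itv /= => /andP[x0 x1]; apply: dphi; rewrite !ltW.
  apply/continuous_in_subspaceT => x; rewrite inE /= in_itv /= => x01.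
  by apply: derivable_continuous; case: (dphi x x01).
have c01' : 0 <= c <= 1 by move: c01; rewrite in_itv.
have : cabs th * cabs th <= cabs th * (M * cabs h).
  have -> : cabs th * cabs th = phi 1 - phi 0.
    rewrite -expr2 -re_mulcJ /phi rmorph1 mul1r rmorph0 mul0r addr0 -reN -reD; congr re.
    by rewrite -mulrN -mulrDr -/th mulrC.
  rewrite E subr0 mulr1 (le_trans (re_le_cabs _))// !cabsM cabsJ ler_wpM2l ?cabs_ge0//.
  by rewrite ler_wpM2r ?cabs_ge0// GM.
by rewrite ler_pM2l// cabs_gt0.
Qed.

(** Subtracting the quadratic [p] makes the derivative o(|h|) near z, and the mean value inequality
    integrates this to o(|h|^2). *)
Lemma jet_twice_derivable f z : (exists2 r : R, 0 < r & forall w, cabs (w - z) < r -> derivable f w 1) ->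
  derivable (derive1 f) z 1 -> exists c, jet f z (f z) (derive1 f z) c.
Proof.
move=> [r1 r10 df] /is_derive1P ddf; set l := derive1 (derive1 f) z in ddf.
exists (l / 2); pose p : {poly K} := (derive1 f z) *: ('X - z%:P) + (l / 2) *: ('X - z%:P) ^+ 2.
have p'E w : p^`().[w] = derive1 f z + l * (w - z).
  rewrite derivD !derivZ expr2 derivM !derivXsubC mul1r mulr1.
  by rewrite alg_polyC hornerD hornerC hornerZ hornerD hornerXsubC; field.
move=> e e0; have [r r0 Hr] := (is_derive_cabsP _ _ _).1 ddf e e0.
exists (Num.min r r1); first by rewrite lt_min r0.
move=> h; rewrite lt_min => /andP[hr hr1].
have near_t (t : R) : 0 <= t <= 1 -> cabs (rc t * h) <= cabs h.
  by move=> /andP[t0 t1]; rewrite cabsM cabs_rc ger0_norm// ler_piMl ?cabs_ge0.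
pose F w := f w - p.[w]; pose F' w := derive1 f w - p^`().[w].
have dF (t : R) : 0 <= t <= 1 -> is_derive (z + rc t * h) (1 : K) F (F' (z + rc t * h)).
  move=> t01; have dft : derivable f (z + rc t * h) 1.
    by apply: df; rewrite addrC addKr (le_lt_trans (near_t t t01)).
  exact: (is_deriveB (is_derive1P dft) (is_derive_horner p _)).
have bF (t : R) : 0 <= t <= 1 -> cabs (F' (z + rc t * h)) <= e * cabs h.
  move=> t01; rewrite /F' p'E; have := Hr (rc t * h) (le_lt_trans (near_t t t01) hr).
  have -> : z + rc t * h - z = rc t * h by ring.
  rewrite opprD addrA => /le_trans; apply.
  by rewrite ler_wpM2l ?(ltW e0)// near_t.
have := complex_mean_value dF bF; rewrite /F.
have -> : f (z + h) - p.[z + h] - (f z - p.[z]) = f (z + h) - (f z + derive1 f z * h + l / 2 * h ^+ 2).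
  by rewrite /p expr2 !(hornerXsubC, hornerD, hornerZ, hornerM); ring.
by have -> : e * cabs h ^+ 2 = e * cabs h * cabs h by ring.
Qed.

Lemma exprn_unbounded_gt (x m : R) : 1 < x -> exists n : nat, m < x ^+ n.
Proof.
move=> x1; have x0 : 0 < x - 1 by rewrite subr_gt0.
have bern n : 1 + n%:R * (x - 1) <= x ^+ n.
  elim: n => [|n ih]; first by rewrite mul0r addr0 expr0.
  rewrite exprS -natr1; have := ler_wpM2l (ltW (lt_trans ltr01 x1)) ih.
  have : 0 <= n%:R * (x - 1) * (x - 1) by rewrite !mulr_ge0// ltW.
  by move: (n%:R) => k; lra.
have b0 := le_lt_trans (ler_norm _) (archi_boundP (normr_ge0 (m / (x - 1)))).
exists (Num.bound `|m / (x - 1)|); apply: lt_le_trans (bern _).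
by rewrite ltr_pdivrMr// in b0; apply: (lt_trans b0); rewrite ltrDr.
Qed.

(* The maximum principle is applied to [v ^ n * P] with [n] large; the zeros of [P] are the points
   where [v] need not have a second-order expansion. *)
Lemma max_modulus_punctured v (P : {poly K}) :
  (forall z, cabs z < 1 -> {for z, continuous v}) ->
  (forall z, cabs z < 1 -> P.[z] != 0 -> exists a b c, jet v z a b c) ->
  (forall e : R, 0 < e -> exists2 rho : R, rho < 1 &
    forall z, rho <= cabs z -> cabs z < 1 -> cabs (v z) <= 1 + e) ->
  forall z, cabs z < 1 -> P.[z] != 0 -> cabs (v z) <= 1.
Proof.
move=> vc vj vb z1 z11 Pz1; rewrite leNgt; apply/negP => v1.
pose e := (cabs (v z1) - 1) / 2.
have e0 : 0 < e by rewrite divr_gt0// subr_gt0.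
have e1 : 0 < 1 + e by rewrite addr_gt0.
have ve : 1 + e < cabs (v z1) by rewrite /e; lra.
have [rho rho1 vrho] := vb e e0.
have [m m0 mb] := horner_bounded P 1.
have Pz0 : 0 < cabs P.[z1] by rewrite cabs_gt0.
(* The excess of |v| at [z1] over 1 + e, raised to the power n, outweighs the loss from replacing a
   bound of [P] by its value at [z1]. *)
have [n nP] : exists n : nat, m / cabs P.[z1] < (cabs (v z1) / (1 + e)) ^+ n.
  by apply: exprn_unbounded_gt; rewrite ltr_pdivlMr// mul1r.
pose r := Num.max rho (cabs z1).
have r1 : r < 1 by rewrite gt_max rho1.
have : cabs (v z1 ^+ n * P.[z1]) <= (1 + e) ^+ n * m.
  apply: (@max_modulus R (fun z => v z ^+ n * P.[z]) r) => //; first exact: ltW.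
  - by rewrite mulr_ge0 ?exprn_ge0// ltW.
  - move=> z zr; have z_1 := le_lt_trans zr r1.
    have cn : {for z, continuous (fun z => v z ^+ n)}.
      elim: (n) => [|k ih]; first exact: continuous_cst.
      under [X in {for z, continuous X}]funext do rewrite exprS.
      exact: (continuousM (vc z z_1) ih).
    exact: (continuousM cn (@continuous_horner_num K P z)).
  - move=> z zr vP; have Pz : P.[z] != 0.
      by apply: contra vP => /eqP ->; rewrite mulr0.
    have [a [b [c jv0]]] := vj z (lt_trans zr r1) Pz.
    have [b' [c' jv]] := jetX n jv0.
    have [c2 jP] := jet_horner P z.
    by do 3 eexists; exact: (jetM jv jP).
  - move=> z zr; have z_1 : cabs z < 1 by rewrite zr.
    rewrite cabsM cabsX ler_pM ?exprn_ge0 ?cabs_ge0//; last by rewrite mb// ltW.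
    by rewrite lerXn2r ?nnegrE ?cabs_ge0 ?(ltW e1)// vrho// zr le_max lexx.
  - by rewrite le_max lexx orbT.
rewrite cabsM cabsX leNgt => /negP; apply.
move: nP; rewrite ltr_pdivrMr// expr_div_n mulrAC ltr_pdivlMr ?exprn_gt0//.
by rewrite mulrC.
Qed.

(** If l were nonzero, the step h = s u(z) conj l would move u radially outwards to u(z) (1 + s
    |l|^2) to first order, off the unit circle. *)
Lemma unimodular_derive0 u z : (exists2 r : R, 0 < r & forall w, cabs (w - z) < r -> cabs (u w) = 1) ->
  forall l, is_derive z (1 : K) u l -> l = 0.
Proof.
move=> [r1 r10 u1] l /is_derive_cabsP dl; apply/eqP; rewrite -cabs_eq0 -[_ == _]negbK; apply/negP => l0.
have lgt : 0 < cabs l by rewrite lt_def l0 cabs_ge0.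
have [r r0 Hr] := dl (cabs l / 2) (divr_gt0 lgt (ltr0n R 2)).
have uz : cabs (u z) = 1 by apply: u1; rewrite subrr cabs0.
pose s := Num.min r r1 / (2 * cabs l).
have mn0 : 0 < Num.min r r1 by rewrite lt_min r0.
have s0 : 0 < s by rewrite divr_gt0// mulr_gt0.
pose h := rc s * (u z * l^*).
have hE : cabs h = s * cabs l by rewrite !cabsM uz mul1r cabsJ cabs_rc gtr0_norm.
have hmn : cabs h < Num.min r r1.
  have -> : cabs h = Num.min r r1 / 2 by rewrite hE /s; field; rewrite gt_eqF.
  lra.
move: (hmn); rewrite lt_min => /andP[hr hr1].
have := Hr h hr; have : cabs (u (z + h)) = 1 by apply: u1; rewrite addrAC subrr add0r.
move=> uzh H.
have : re ((u z)^* * (u (z + h) - u z - l * h)) <= cabs l / 2 * cabs h.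
  have := le_trans (re_le_cabs _) (_ : cabs ((u z)^* * (u (z + h) - u z - l * h)) <= cabs l / 2 * cabs h).
  by apply; rewrite cabsM cabsJ uz mul1r.
have : - (cabs l / 2 * cabs h) <= re ((u z)^* * (u (z + h) - u z - l * h)).
  rewrite lerNl -reN (le_trans (re_le_cabs _))// cabsN cabsM cabsJ uz mul1r//.
have -> : (u z)^* * (u (z + h) - u z - l * h) = (u z)^* * u (z + h) - u z * (u z)^* - rc s * ((u z * (u z)^*) * (l * l^*)).
  by rewrite /h; ring.
rewrite !mulcJ uz expr1n rmorph1 mul1r !reD !reN re1 -rmorphM re_rc hE.
have : re ((u z)^* * u (z + h)) <= 1.
  by rewrite (le_trans (re_le_cabs _))// cabsM cabsJ uz uzh mulr1.
have : 0 < s * cabs l ^+ 2 by rewrite mulr_gt0// exprn_gt0.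
nra.
Qed.

End ComplexMeanValue.

(** * Division by the Blaschke product with the same zeros *)

Section BlaschkeFactorization.
Variable R : realType.
Local Notation K := (C R).
Implicit Types (g p q : {poly K}) (z w : K).

Lemma is_derive_near (f k : K -> K) z l : (\forall w \near z, f w = k w) ->
  is_derive z (1 : K) f l -> is_derive z (1 : K) k l.
Proof.
move=> /near_cabs[r r0 fk] /is_derive_cabsP df; apply/is_derive_cabsP => e e0.
have [s s0 H] := df e e0; exists (Num.min r s); first by rewrite lt_min r0.
move=> h; rewrite lt_min => /andP[hr /H].
by rewrite !fk ?subrr ?cabs0// addrAC subrr add0r.
Qed.

Lemma derivable_near (f k : K -> K) z : (\forall w \near z, f w = k w) ->
  derivable f z 1 -> derivable k z 1.
Proof. by move=> fk /is_derive1P df; case: (is_derive_near fk df). Qed.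

Lemma horner_prod_XsubC (s : seq K) w : (\prod_(b <- s) ('X - b%:P)).[w] = \prod_(b <- s) (w - b).
Proof. by rewrite horner_prod; apply: eq_bigr => b _; rewrite hornerXsubC. Qed.

Section Factor.
Variables (f : K -> K) (d : nat) (g : {poly K}) (s : seq K).
Hypothesis fP : proper_holomorphic_self_map f.
Hypothesis f2 : forall z, disk z -> derivable (derive1 f) z 1.
Hypothesis dg : disk_rooted d g.
Hypothesis gs : 'X * g = \prod_(b <- s) ('X - b%:P).
Hypothesis fs : forall z, disk z -> zero_order f z (count_mem z s).
Let p := 'X * g.
Let q := star d g.

Let qn z : cabs z <= 1 -> q.[z] != 0.
Proof. exact: star_disk_neq0. Qed.

(** At a zero of p the quotient f q / p takes the value of the local quotient after cancellation of
    the common factor (w - z)^m. It agrees with that quotient near z, hence is derivable there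
    too. *)
Lemma blaschke_ratio_exists : exists u : K -> K, forall z, cabs z < 1 ->
  [/\ derivable u z 1, u z != 0 & f z * q.[z] = u z * p.[z]].
Proof.
have local z : exists v : K, cabs z < 1 -> exists H : K -> K,
    [/\ derivable H z 1, H z = v, v != 0, \forall w \near z, f w * q.[w] = H w * p.[w] &
        \forall w \near z, w != z -> p.[w] != 0].
  have [z1|z1] := boolP (cabs z < 1); last by exists 0 => z1'; case/negP: z1.
  have zD : disk z by rewrite diskE.
  have [h [dh hz fh]] := fs zD.
  pose p1 := \prod_(b <- s | b != z) ('X - b%:P).
  have p1E w : p1.[w] = \prod_(b <- s | b != z) (w - b).
    by rewrite horner_prod; apply: eq_bigr => b _; rewrite hornerXsubC.
  have pE w : p.[w] = (w - z) ^+ count_mem z s * p1.[w].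
    by rewrite /p gs horner_prod_XsubC p1E -prod_count.
  have p1z : p1.[z] != 0.
    rewrite p1E prodf_seq_neq0; apply/allP => b _ /=.
    by apply/implyP; rewrite subr_eq0 eq_sym.
  exists (h z * (q.[z] / p1.[z])) => _; exists (h * (fun w => q.[w] / p1.[w])).
  have [dqp _] := is_derive_quotient q p1z.
  have dhz : derivable h z 1 by have /near_cabs[r r0] := dh; apply; rewrite subrr cabs0.
  split.
  - exact: (derivableM dhz dqp).
  - by [].
  - by rewrite !mulf_neq0 ?invr_eq0// qn// ltW.
  - move: fh (near_horner_neq0 p1z); apply: filterS2 => w -> p1w.
    by rewrite pE fctE; field.
  - apply: filterS (near_horner_neq0 p1z) => w p1w wz.
    by rewrite pE mulf_neq0// expf_neq0// subr_eq0.
have [v vP] := choice local.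
pose u w := if p.[w] == 0 then v w else f w * q.[w] / p.[w].
exists u => z z1; have [H [dH Hz v0 fH pn]] := vP z z1.
have HE w : f w * q.[w] = H w * p.[w] -> p.[w] != 0 -> H w = u w.
  by move=> fw pw; rewrite /u (negPf pw) fw mulfK.
have uz : u z = H z.
  rewrite /u; case: eqVneq => [_|pz]; first by rewrite Hz.
  have /near_cabs[r r0 fr] := fH.
  by rewrite fr ?subrr ?cabs0// mulfK.
have uH : \forall w \near z, H w = u w.
  move: fH pn; apply: filterS2 => w fw pw.
  have [->|wz] := eqVneq w z; first exact: esym uz.
  exact: HE fw (pw wz).
split; first exact: derivable_near uH dH.
  by rewrite uz Hz.
by have /near_cabs[r r0 fr] := fH; rewrite uz fr// subrr cabs0.
Qed.

(** The preimage of the closed disk of radius [r] is compact, so it has a farthest point [x] from 0;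
    any radius strictly between |x| and 1 serves. *)
Lemma proper_boundary (r : R) : r < 1 -> exists2 rho : R, rho < 1 &
  forall z, rho <= cabs z -> cabs z < 1 -> r < cabs (f z).
Proof.
move=> r1; have [_ fD fc] := fP.
pose A : set K := @disk R `&` f @^-1` [set w | cabs w <= r].
have cA : compact A.
  apply: fc; last exact: compact_cabs_le.
  by move=> w /= wr; rewrite diskE (le_lt_trans wr).
have [[a Aa]|A0] := pselect (A !=set0); last first.
  exists 0 => // z _ z1; rewrite ltNge; apply/negP => fr; apply: A0; exists z.
  by split=> //; rewrite diskE.
have [|x xA xm] := @compact_min R K A (fun z => - cabs z) (ex_intro _ a Aa) cA.
  move=> z _; have cz : {for z, continuous (fun w : K => w)} by exact: cvg_id.
  exact: (continuousN (continuous_cabs cz)).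
have x1 : cabs x < 1 by have [] := xA; rewrite diskE.
exists ((cabs x + 1) / 2); first by lra.
move=> z zx z1; rewrite ltNge; apply/negP => fr.
have /xm : A z by split=> //; rewrite diskE.
by rewrite lerN2; lra.
Qed.

(** |p / q| tends to 1 uniformly at the circle: |q|^2 - |p|^2 is at most c0 (1 - |z|), while |q| is
    bounded below by [c]. *)
Lemma blaschke_boundary (b : R) : b < 1 -> exists2 rho : R, rho < 1 &
  forall z, rho <= cabs z -> cabs z < 1 -> b * cabs q.[z] <= cabs p.[z].
Proof.
move=> b1; have sg := disk_rooted_sizeW dg.
have [c0 c00 H] := blaschke_form_boundary sg sg.
have [c c_gt0 Hc] := star_disk_lb dg.
have e0 : 0 < (1 - b) * c ^+ 2 / (c0 + 1).
  by rewrite divr_gt0 ?ltr_wpDl// mulr_gt0 ?exprn_gt0// subr_gt0.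
exists (1 - (1 - b) * c ^+ 2 / (c0 + 1)); first by lra.
move=> z zr z1; have := H z (ltW z1); rewrite blaschke_form_self -exprMn -cabsM.
have -> : z * g.[z] = p.[z] by rewrite /p hornerM hornerX.
have cq := Hc z (ltW z1); rewrite -/q in cq *.
have pq : cabs p.[z] <= cabs q.[z].
  rewrite /p hornerM hornerX cabsM (le_trans _ (le_star_disk dg (ltW z1)))//.
  by rewrite ler_piMl ?cabs_ge0// ltW.
move: cq pq; have := cabs_ge0 p.[z]; move: (cabs p.[z]) (cabs q.[z]) => x y x0 cy xy.
rewrite ler_norml => /andP[_ xyle].
have h1 : 1 - cabs z <= (1 - b) * c ^+ 2 / (c0 + 1) by lra.
have h2 : c0 * (1 - cabs z) <= (1 - b) * c ^+ 2.
  rewrite ler_pdivlMr ?ltr_wpDl// in h1; have : 0 <= 1 - cabs z by rewrite subr_ge0 ltW.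
  by lra.
have h3 : (1 - b) * c ^+ 2 <= (1 - b) * y ^+ 2.
  by rewrite ler_wpM2l ?subr_ge0 ?(ltW b1)// lerXn2r ?nnegrE ?(ltW c_gt0)// (le_trans (ltW c_gt0)).
have y0 : 0 < y := lt_le_trans c_gt0 cy.
have h4 : y ^+ 2 - x ^+ 2 <= (1 - b) * y ^+ 2 by lra.
rewrite -(ler_pM2r y0).
have : x ^+ 2 <= x * y by rewrite expr2 ler_wpM2l.
by lra.
Qed.

Lemma proper_map_blaschke : exists2 ka : K, cabs ka = 1 &
  forall z, cabs z < 1 -> f z * q.[z] = ka * p.[z].
Proof.
have [_ fD _] := fP; have fD1 z : cabs z < 1 -> cabs (f z) < 1.
  by move=> z1; have := fD z; rewrite !diskE; apply.
have [u uP] := blaschke_ratio_exists.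
have u0 z : cabs z < 1 -> u z != 0 by move=> /uP[].
have uE z : cabs z < 1 -> f z * q.[z] = u z * p.[z] by move=> /uP[].
have uc z : cabs z < 1 -> {for z, continuous u}.
  by move=> /uP[du _ _]; exact: derivable_continuous.
have uV z : cabs z < 1 -> {for z, continuous (fun w => (u w)^-1)}.
  by move=> z1; exact: (continuousV (u0 z z1) (uc z z1)).
have near1 z : cabs z < 1 -> exists2 r : R, 0 < r & forall w, cabs (w - z) < r -> cabs w < 1.
  by move=> z1; have /near_disk/near_cabs[r r0 H] : disk z by [rewrite diskE];
    exists r => // w /H; rewrite diskE.
have uj z : cabs z < 1 -> p.[z] != 0 -> exists a b c, jet u z a b c.
  move=> z1 pz; have [r r0 rD] := near1 z z1.
  have zD : disk z by rewrite diskE.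
  have [c jf] : exists c, jet f z (f z) (derive1 f z) c.
    apply: jet_twice_derivable; last exact: f2.
    by exists r => // w /rD w1; have [H _ _] := fP; apply: H; rewrite diskE.
  have [c1 jq] := jet_horner q z; have [c2 jp] := jet_horner p z.
  have [b' [c' jpV]] := jetV jp pz.
  do 3 eexists; apply: jet_ext (jetM (jetM jf jq) jpV).
  have /near_cabs[r' r'0 pr] := near_horner_neq0 pz.
  exists (Num.min r r'); first by rewrite lt_min r0.
  by move=> w; rewrite lt_min => /andP[/rD w1 /pr pw]; rewrite uE// mulfK.
have ujV z : cabs z < 1 -> p.[z] != 0 -> exists a b c, jet (fun w => (u w)^-1) z a b c.
  move=> z1 pz; have [a [b [c ju]]] := uj z z1 pz.
  have a0 : a != 0 by rewrite -(jet_val ju) u0.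
  by have [b' [c' j]] := jetV ju a0; exists a^-1, b', c'.
have ub (e : R) : 0 < e -> exists2 rho : R, rho < 1 &
    forall z, rho <= cabs z -> cabs z < 1 -> cabs (u z) <= 1 + e.
  move=> e0; have e1 : 0 < 1 + e by rewrite addr_gt0.
  have [|rho rho1 H] := @blaschke_boundary (1 + e)^-1; first by rewrite invf_lt1// ltrDl.
  exists rho => // z zr z1; have := congr1 cabs (uE z z1); rewrite !cabsM => E.
  have q0 : 0 < cabs q.[z] by rewrite cabs_gt0 qn// ltW.
  have pge := H z zr z1.
  have : cabs (u z) * ((1 + e)^-1 * cabs q.[z]) <= 1 * cabs q.[z].
    rewrite (le_trans (ler_wpM2l (cabs_ge0 _) pge))// -E ler_wpM2r ?cabs_ge0//.
    by rewrite ltW// fD1.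
  by rewrite mulrA ler_pM2r// ler_pdivrMr// mul1r.
(* The bound on |u| used |f| < 1 and |p / q| near 1; the bound on 1 / |u| uses |p| <= |q| and
   properness of [f]. *)
have ubV (e : R) : 0 < e -> exists2 rho : R, rho < 1 &
    forall z, rho <= cabs z -> cabs z < 1 -> cabs (u z)^-1 <= 1 + e.
  move=> e0; have e1 : 0 < 1 + e by rewrite addr_gt0.
  have [|rho rho1 H] := @proper_boundary (1 + e)^-1; first by rewrite invf_lt1// ltrDl.
  exists rho => // z zr z1; have := congr1 cabs (uE z z1); rewrite !cabsM => E.
  have q0 : 0 < cabs q.[z] by rewrite cabs_gt0 qn// ltW.
  have uz0 : 0 < cabs (u z) by rewrite cabs_gt0 u0.
  have pq : cabs p.[z] <= cabs q.[z].
    rewrite /p hornerM hornerX cabsM (le_trans _ (le_star_disk dg (ltW z1)))//.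
    by rewrite ler_piMl ?cabs_ge0// ltW.
  have : cabs (f z) * cabs q.[z] <= cabs (u z) * cabs q.[z] by rewrite E ler_wpM2l ?cabs_ge0.
  rewrite ler_pM2r// => fu; rewrite cabsV -[leRHS]invrK lef_pV2 ?posrE ?invr_gt0//.
  by rewrite (le_trans _ fu)// ltW// H.
have u1 z : cabs z < 1 -> p.[z] != 0 -> cabs (u z) = 1.
  move=> z1 pz; apply/eqP; rewrite eq_le (max_modulus_punctured uc uj ub)//=.
  have := max_modulus_punctured uV ujV ubV z1 pz.
  by rewrite cabsV invf_le1// cabs_gt0 u0.
(* At the zeros of p this follows by continuity, since p is nonzero at points z + t with t
   arbitrarily small and positive. *)
have u1' z : cabs z < 1 -> cabs (u z) = 1.
  move=> z1; apply/eqP; apply/negPn/negP => uz.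
  have e0 : 0 < `|cabs (u z) - 1| by rewrite normr_gt0 subr_eq0.
  have [r r0 Hr] := (@continuous_cabsP R u z).1 (uc z z1) _ e0.
  have [r1 r10 r1D] := near1 z z1.
  have p0 : p != 0.
    by rewrite /p mulf_neq0 ?polyX_eq0// -size_poly_eq0 (disk_rooted_size dg).
  pose e := Num.min r r1; have e_gt0 : 0 < e by rewrite lt_min r0.
  have /existsNP[t] : ~ forall t : R, 0 < t < e -> (p \Po ('X + z%:P)).[rc t] = 0.
    move=> H; have := poly0_small_real e_gt0 H => /eqP.
    by rewrite comp_poly2_eq0 ?size_XaddC// (negPf p0).
  move=> /not_implyP[/andP[t0]]; rewrite lt_min => /andP[tr tr1] /eqP.
  rewrite horner_comp hornerD hornerX hornerC => pt.
  have tE : cabs (rc t + z - z) = t by rewrite addrK cabs_rc gtr0_norm.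
  have := Hr (rc t + z); rewrite tE => /(_ tr).
  have ut := u1 (rc t + z) (r1D _ (_ : _ < _)) pt.
  rewrite tE in ut; have {}ut := ut tr1.
  rewrite ltNge => /negP; apply; rewrite -ut ler_norml.
  by apply/andP; split; [rewrite lerNl opprB cabs_dist|rewrite cabsB cabs_dist].
have du0 z : cabs z < 1 -> is_derive z (1 : K) u 0.
  move=> z1; have [/is_derive1P du _ _] := uP z z1.
  have [r r0 rD] := near1 z z1.
  suff <- : derive1 u z = 0 by [].
  by apply: unimodular_derive0 du; exists r => // w /rD; exact: u1'.
exists (u 0); first by rewrite u1'// cabs0.
move=> z z1; rewrite uE//; congr (_ * _).
have z_t (t : R) : 0 <= t <= 1 -> cabs (0 + rc t * z) < 1.
  move=> /andP[t0 t1]; rewrite add0r cabsM cabs_rc ger0_norm// (le_lt_trans _ z1)//.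
  by rewrite ler_piMl ?cabs_ge0.
have := @complex_mean_value R u (fun=> 0) 0 z 0 (fun t t01 => du0 _ (z_t t t01)).
rewrite cabs0 mul0r add0r => /(_ (fun _ _ => lexx _)) H.
by apply/eqP; rewrite -subr_eq0 -cabs_eq0 eq_le H cabs_ge0.
Qed.

End Factor.
End BlaschkeFactorization.

(** * Normalized proper maps in polynomial form, and the theorem *)

Section HeinsTheorem.
Variable R : realType.
Local Notation K := (C R).
Implicit Types (g p q P : {poly K}) (z w a : K) (d : nat).
Local Notation W := blaschke_wronskian.

(** If the multiplicity j were smaller than m, the cofactor [V] at z + t would be t^(m - j) k, which
    tends to 0, although V(z) is nonzero. *)
Lemma dvdp_zero_order P (k : K -> K) z m : {for z, continuous k} ->
  (\forall w \near z, P.[w] = (w - z) ^+ m * k w) -> ('X - z%:P) ^+ m %| P.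
Proof.
move=> kc Pk; have [->|P0] := eqVneq P 0; first exact: dvdp0.
have [j [V]] := multiplicity_XsubC P z; rewrite P0 /= => Vz PE.
have [mj|jm] := leqP m j; first by rewrite PE dvdp_mull// dvdp_exp2l.
have /near_cabs[r r0 Pr] := Pk.
have [r1 r10 kr] := (@continuous_cabsP R k z).1 kc 1 ltr01.
have V0 : 0 < cabs V.[z] by rewrite cabs_gt0.
have [r2 r20 Vr] := (@continuous_cabsP R (horner V) z).1 (@continuous_horner_num K V z) _ (divr_gt0 V0 (ltr0n R 2)).
pose M := cabs (k z) + 1; have M0 : 0 < M by rewrite ltr_wpDl ?cabs_ge0.
pose e := Num.min (Num.min r r1) (Num.min (Num.min r2 1) (cabs V.[z] / 2 / M)).
have e0 : 0 < e by rewrite !lt_min r0 r10 r20 ltr01 !divr_gt0.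
pose t := e / 2; have t0 : 0 < t by rewrite divr_gt0.
have : t < e by rewrite /t; lra.
rewrite /e !lt_min => /andP[/andP[tr tr1] /andP[/andP[tr2 t1] tM]].
have tz : cabs (z + rc t - z) = t by rewrite addrAC subrr add0r cabs_rc gtr0_norm.
have := Pr (z + rc t); rewrite tz => /(_ tr).
have -> : z + rc t - z = rc t by ring.
rewrite PE hornerM horner_exp hornerXsubC.
have -> : z + rc t - z = rc t by ring.
rewrite -(subnK (ltnW jm)) exprD [in RHS]mulrAC => /mulIf; rewrite expf_neq0 ?rc_eq0 ?gt_eqF// => /(_ isT) E.
have kb : cabs (k (z + rc t)) <= M.
  have := kr (z + rc t); rewrite tz => /(_ tr1) H.
  by rewrite -[k _](subrK (k z)) (le_trans (cabsD _ _))// /M addrC lerD// ltW.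
have Vb : cabs V.[z] / 2 < cabs V.[z + rc t].
  have := Vr (z + rc t); rewrite tz => /(_ tr2).
  by have := cabs_dist V.[z] V.[z + rc t]; rewrite cabsB; lra.
have : cabs V.[z + rc t] <= t * M.
  rewrite E cabsM cabsX cabs_rc gtr0_norm// ler_pM ?exprn_ge0 ?cabs_ge0 ?(ltW t0)//.
  move: jm; rewrite -subn_gt0; case: (m - j)%N => // n _.
  by rewrite exprS ler_piMr ?(ltW t0)// exprn_ile1 ?(ltW t0)// ltW.
move: tM; rewrite ltr_pdivlMr//; lra.
Qed.

Lemma dvdp_prod_XsubC_count (s : seq K) P :
  (forall z, z \in s -> ('X - z%:P) ^+ count_mem z s %| P) ->
  \prod_(z <- s) ('X - z%:P) %| P.
Proof.
move=> sP.
have -> : \prod_(z <- s) ('X - z%:P) = \prod_(z <- undup s) ('X - z%:P) ^+ count_mem z s.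
  by rewrite prodr_undup_exp_count.
have : {subset undup s <= s} by move=> z; rewrite mem_undup.
have := undup_uniq s; elim: (undup s) => [|z t ih] /=; first by rewrite big_nil dvd1p.
move=> /andP[zt ut] ts; rewrite big_cons Gauss_dvdp.
  rewrite sP ?ts ?mem_head//= ih// => x xt; apply: ts; rewrite inE xt orbT//.
rewrite big_seq; elim/big_ind: _ => [|p1 p2 h1 h2|x xt].
- exact: coprimep1.
- by rewrite coprimepMr h1.
- rewrite coprimep_expl// coprimep_expr// coprimep_XsubC2// subr_eq0.
  by apply: contraNneq zt => <-.
Qed.

(** With W = X c, self-reciprocity gives c X = star c star X. The roots of c and star c are
    separated by the circle, so c divides star X, and degrees leave a constant. Its positivity is
    seen at 1, by [wronskian_circle_ge]. *)
Lemma wronskian_factor d g (s : seq K) : disk_rooted d g -> size s = d ->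
  (forall z, z \in s -> cabs z < 1) -> \prod_(z <- s) ('X - z%:P) %| W d g ->
  exists2 k : R, 0 < k &
    W d g = rc k *: (\prod_(z <- s) ('X - z%:P) * star d (\prod_(z <- s) ('X - z%:P))).
Proof.
move=> dg sd s1; set c := \prod_(z <- s) _ => /dvdpP[X WE].
have sg := disk_rooted_sizeW dg.
have sc : size c = d.+1 by rewrite size_prod_XsubC sd.
have c0 : c != 0 by rewrite -size_poly_eq0 sc.
have W1 : 0 < re (W d g).[1].
  have [a [r [a0 rd r1 gE]]] := dg.
  have := wronskian_circle_ge rd (@cabs1 R) (fun z zr => ltW (r1 z zr)) gE.
  rewrite expr1n conj1 mul1r; apply: lt_le_trans.
  by rewrite exprn_gt0// cabs_gt0 (disk_rooted_horner1 dg).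
have X0 : X != 0.
  by apply: contraTneq W1 => X0; rewrite WE X0 mul0r horner0 raddf0 ltxx.
have sX : (size X <= d.+1)%N.
  have : (size (W d g) <= (d + d).+1)%N by rewrite -(star_wronskian sg) size_star.
  by rewrite WE size_mul// sc addnS /= -addSn leq_add2r.
have symE : star d c * star d X = c * X.
  by rewrite -starM ?sc// mulrC -[in RHS]mulrC -WE; rewrite mulrC -WE star_wronskian.
have cop : coprimep c (star d c).
  apply: Pdiv.ClosedField.root_coprimep => x; rewrite root_prod_XsubC => xs.
  rewrite -sd star_prod horner_prod prodf_seq_neq0; apply/allP => b bs /=.
  rewrite hornerD hornerN hornerZ hornerX -[1]/(1%:P) hornerC.
  by rewrite mobius_neq0 ?s1// ltW// s1.
have : c %| star d X by rewrite -(Gauss_dvdpr _ cop) symE dvdp_mulr.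
move=> /dvdpP[Y YE].
have sX0 : star d X != 0.
  apply: contra X0 => /eqP sX0; rewrite -(starK sX) sX0; apply/eqP/polyP => i.
  by rewrite coef_star !coef0 conj0 if_same.
have Y0 : Y != 0 by apply: contra sX0 => /eqP Y0; rewrite YE Y0 mul0r.
have /size1_polyC YC : (size Y <= 1)%N.
  have := size_star d X; rewrite YE size_mul// sc addnS /= -add1n leq_add2r; exact.
have XE : X = (Y`_0)^* *: star d c by rewrite -(starK sX) YE YC mul_polyC starZ coefC.
set y := (Y`_0)^* in XE.
have WE' : W d g = y *: (c * star d c) by rewrite WE XE -scalerAl mulrC.
have c1 : 0 < cabs c.[1] ^+ 2.
  rewrite exprn_gt0// cabs_gt0 /c horner_prod_XsubC prodf_seq_neq0; apply/allP => b bs /=.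
  by rewrite subr_eq0; apply: contraTneq (s1 b bs) => <-; rewrite cabs1 ltxx.
have W1E : (W d g).[1] = y * rc (cabs c.[1] ^+ 2).
  by rewrite WE' hornerZ hornerM horner_star_circle ?sc ?cabs1// expr1n mul1r mulcJ.
have imW : im (W d g).[1] = 0.
  have sW : (size (W d g) <= (d + d).+1)%N by rewrite -(star_wronskian sg) size_star.
  have := horner_star_circle sW (@cabs1 R); rewrite star_wronskian// expr1n mul1r.
  by move=> /(congr1 im); rewrite im_conj => ?; lra.
exists (re (W d g).[1] / cabs c.[1] ^+ 2); first by rewrite divr_gt0.
rewrite {1}WE'; congr (_ *: _).
apply: (@mulIf _ (rc (cabs c.[1] ^+ 2))); first by rewrite rc_eq0 gt_eqF.
rewrite -W1E -rmorphM divfK ?gt_eqF//.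
by apply: complex_ext; rewrite ?imW.
Qed.

(** A unimodular a rotates the map by a^2, which absorbs the constant factor of a Blaschke product;
    a real a leaves the map unchanged and is free to rescale the Wronskian. *)
Lemma blaschke_mapZ d g a z : a != 0 -> blaschke_map d (a *: g) z = (a / a^*) * blaschke_map d g z.
Proof.
move=> a0; rewrite /blaschke_map starZ !hornerZ invfM.
by ring.
Qed.

Lemma disk_rootedZ d g a : a != 0 -> disk_rooted d g -> disk_rooted d (a *: g).
Proof.
move=> a0 [b [s [b0 sd s1 ->]]]; exists (a * b), s; split=> //; first by rewrite mulf_neq0.
by rewrite scalerA.
Qed.

(** Both the extension and [k] are continuous at 1 and agree on the radius ending there. *)
Lemma extension_value_eq (f k : K -> K) v : extension_value f 1 v ->
  {for 1, continuous k} -> (forall z, cabs z < 1 -> f z = k z) -> k 1 = v.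
Proof.
move=> [U [F [_ DU hF Ff <-]]] kc fk; apply/eqP; rewrite -subr_eq0 -cabs_eq0 -[_ == _]negbK.
apply/negP => kF.
have U1 : U 1 by apply: DU; rewrite closed_diskE cabs1.
have Fc : {for 1, continuous F} by apply: derivable_continuous; exact: hF.
have e0 : 0 < cabs (k 1 - F 1) / 2 by rewrite divr_gt0// lt_def kF cabs_ge0.
have [r r0 Hr] := (@continuous_cabsP R k 1).1 kc _ e0.
have [r' r'0 Hr'] := (@continuous_cabsP R F 1).1 Fc _ e0.
pose t := Num.min (Num.min r r') 1 / 2.
have m0 : 0 < Num.min (Num.min r r') 1 by rewrite !lt_min r0 r'0 ltr01.
have t0 : 0 < t by rewrite divr_gt0.
have : t < Num.min (Num.min r r') 1 by rewrite /t; lra.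
rewrite !lt_min => /andP[/andP[tr tr'] t1].
have tE : cabs (rc (1 - t) - 1) = t.
  by rewrite -(rmorph1 (@rc R)) -rmorphB cabs_rc addrAC subrr add0r normrN gtr0_norm.
have tD : cabs (rc (1 - t)) < 1 by rewrite cabs_rc gtr0_norm ?subr_gt0// ltrBlDr ltrDl.
have := Hr (rc (1 - t)); rewrite tE => /(_ tr).
have := Hr' (rc (1 - t)); rewrite tE => /(_ tr').
rewrite Ff ?diskE// fk//.
have := cabsD (k 1 - k (rc (1 - t))) (k (rc (1 - t)) - F 1).
by rewrite addrA subrK (cabsB (k 1) (k (rc (1 - t)))); lra.
Qed.

Lemma normalized_proper_map_blaschke d (c : d.-tuple K) (f : K -> K) :
  (forall j, disk (tnth c j)) -> normalized_proper_map c f ->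
  exists g, [/\ disk_rooted d g, im g.[1] = 0,
    W d g = \prod_(z <- c) ('X - z%:P) * star d (\prod_(z <- c) ('X - z%:P)) &
    forall z, cabs z < 1 -> f z = blaschke_map d g z].
Proof.
move=> cD [fP fdeg f0 fext [_ fcrit]].
have c1 z : z \in c -> cabs z < 1 by move=> /tnthP[j ->]; have := cD j; rewrite diskE.
have f2 z : disk z -> derivable (derive1 f) z 1.
  move=> /fcrit[h [dh _ fh]].
  have dhz : derivable h z 1 by have /near_cabs[r r0] := dh; apply; rewrite subrr cabs0.
  apply: (@derivable_near R (horner (('X - z%:P) ^+ count_mem z c) * h)).
    by apply: filterS fh => w ->; rewrite fctE horner_exp hornerXsubC.
  exact: (derivableM (@derivable_horner_num R _ z) dhz).
have disk0 : disk (0 : K) by rewrite diskE cabs0.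
have [s0 [s01 s0z]] := fdeg 0 disk0.
have f_zero z : disk z -> zero_order f z (count_mem z s0).
  by move=> /s0z; apply: zero_order_near; apply/near_cabs; exists 1 => // w _; rewrite subr0.
(* f(0) = 0 puts 0 among the d + 1 zeros; removing one copy leaves the d roots of g. *)
have s00 : 0 \in (s0 : seq K).
  rewrite -has_pred1 has_count lt0n; apply/negP => /eqP c0.
  have [h [_ h0 /near_cabs[r r0 fh]]] := f_zero 0 disk0.
  have := fh 0; rewrite subrr cabs0 => /(_ r0).
  by rewrite f0 c0 expr0 mul1r => /esym/eqP; rewrite (negPf h0).
pose s := rem (0 : K) s0.
have sd : size s = d by rewrite size_rem// size_tuple.
pose g1 := \prod_(b <- s) ('X - b%:P).
have dg1 : disk_rooted d g1.
  exists 1, s; rewrite oner_eq0 scale1r; split=> // z /mem_rem /s01.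
  by rewrite diskE.
have g1s : 'X * g1 = \prod_(b <- s0) ('X - b%:P).
  by rewrite (big_rem (0 : K))//= subr0.
have [ka ka1 fE] := proper_map_blaschke fP f2 dg1 g1s f_zero.
(* Scaling by [be] rotates the map by be / conj be = be^2 = ka. *)
pose be := sqrtC ka.
have be2 : be * be = ka by rewrite -expr2 sqrtCK.
have be1 : cabs be = 1.
  apply/eqP; rewrite -(@eqrXn2 _ 2) ?cabs_ge0 ?ler01//.
  by rewrite expr2 -cabsM be2 ka1 expr1n.
have be0 : be != 0 by rewrite circle_neq0.
have beJ : be / be^* = ka.
  by rewrite -[be^*]invrK inv_conj_circle// invrK.
have dg2 := disk_rootedZ be0 dg1; set g2 := be *: g1 in dg2.
have fE2 z : cabs z < 1 -> f z = blaschke_map d g2 z.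
  move=> z1; have qz : (star d g1).[z] != 0 by rewrite (star_disk_neq0 dg1)// ltW.
  rewrite blaschke_mapZ// beJ; apply: (mulIf qz).
  by rewrite fE// /blaschke_map hornerM hornerX mulrA divfK.
(* The value 1 at 1 reads g(1) = star g (1) = conj g(1). *)
have g21 : im g2.[1] = 0.
  have q1 : (star d g2).[1] != 0 by rewrite (star_disk_neq0 dg2)// cabs1.
  have bc : {for 1, continuous (blaschke_map d g2)}.
    by apply: derivable_continuous; case: (is_derive_blaschke_map q1).
  have := extension_value_eq fext bc fE2; rewrite /blaschke_map mul1r => /(congr1 (fun x => x * (star d g2).[1])).
  rewrite divfK// mul1r horner_star_circle ?(disk_rooted_sizeW dg2) ?cabs1// expr1n mul1r.
  by move=> /(congr1 im); rewrite im_conj => ?; lra.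
have cW : \prod_(z <- c) ('X - z%:P) %| W d g2.
  apply: dvdp_prod_XsubC_count => z zc; have z1 := c1 z zc; have zD : disk z by rewrite diskE.
  have [h [dh _ fh]] := fcrit z zD.
  have dhz : derivable h z 1 by have /near_cabs[r r0] := dh; apply; rewrite subrr cabs0.
  (* Since f' = W / q^2, this is the continuous cofactor of (w - z)^m in the Wronskian. *)
  pose k w := h w * (star d g2 ^+ 2).[w].
  have kc : {for z, continuous k}.
    exact: (continuousM (derivable_continuous dhz) (@continuous_horner_num K (star d g2 ^+ 2) z)).
  apply: (dvdp_zero_order kc).
  move: fh (near_disk zD); apply: filterS2 => w fh wD; have w1 : cabs w < 1 by rewrite -diskE.
  have qw : (star d g2).[w] != 0 by rewrite (star_disk_neq0 dg2)// ltW.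
  have fw : derive1 f w = (W d g2).[w] / (star d g2).[w] ^+ 2.
    rewrite -(derive1_blaschke_map dg2 (ltW w1)); apply: is_derive1E.
    apply: (@is_derive_near R (blaschke_map d g2)).
      by apply: filterS (near_disk wD) => x; rewrite diskE => /fE2/esym.
    by apply: is_derive1P; apply: (derivable_blaschke_map dg2); exact: ltW.
  by rewrite /k horner_exp mulrA -fh fw divfK// expf_neq0.
have [k k0 WE] := wronskian_factor dg2 (size_tuple c) c1 cW.
(* The Wronskian is quadratic, so this real scaling removes the factor [k] without changing the
   map. *)
pose m := (Num.sqrt k)^-1.
have m0 : 0 < m by rewrite invr_gt0 sqrtr_gt0.
have rm0 : rc m != 0 by rewrite rc_eq0 gt_eqF.
exists (rc m *: g2); split.
- exact: disk_rootedZ.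
- by rewrite hornerZ imMrc g21 mulr0.
- rewrite wronskianZ cabs_rc gtr0_norm// WE scalerA -rmorphM /m exprVn sqr_sqrtr ?(ltW k0)//.
  by rewrite mulVf ?gt_eqF// rmorph1 scale1r.
- by move=> z z1; rewrite blaschke_mapZ// conj_rc divff// mul1r fE2.
Qed.

End HeinsTheorem.

Theorem theorem1 (R : realType) (d : nat) (hd : (1 <= d)%N)
    (c : d.-tuple (C R)) (hc : forall j : 'I_d, disk (tnth c j)) :
  (exists f : C R -> C R, normalized_proper_map c f) /\
  (forall f g : C R -> C R,
     normalized_proper_map c f -> normalized_proper_map c g ->
     forall z : C R, disk z -> f z = g z).
Proof.
split.
  have c1 z : z \in c -> cabs z < 1 by move=> /tnthP[j ->]; have := hc j; rewrite diskE.
  have [g [dg g1 Wg]] := blaschke_wronskian_surj (size_tuple c) c1.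
  by exists (blaschke_map d g); exact: blaschke_map_normalized.
move=> f k /(normalized_proper_map_blaschke hc)[g [dg g1 Wg fE]].
move=> /(normalized_proper_map_blaschke hc)[h [dh h1 Wh kE]] z; rewrite diskE => z1.
rewrite fE// kE//.
(* Both signs define the same map, because -1 divided by its conjugate is 1. *)
have [->//|->] := blaschke_wronskian_inj dg dh g1 h1 (etrans Wg (esym Wh)).
by rewrite -scaleN1r blaschke_mapZ ?oppr_eq0 ?oner_eq0// conjN conj1 divff ?mul1r// oppr_eq0 oner_eq0.
Qed.
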